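(* For any Banach space $X$ of type $2$ the following assertions are equivalent. (1) $X$ is not superreflexive. (2) There is some $c>0$ such that $\frac1c n^{1/2}\le RUMD_n(X)\le c\,n^{1/2}$ for $n=1,2,\dots$. (3) There is some $c'>0$ such that $\frac1{c'}n^{1/2}\le RUMD_n(X)$ for $n=1,2,\dots$.
   Context: Banach spaces are over $\mathbb{K}$ (the real or complex scalars). A Banach space $X$ is superreflexive if each Banach space which is finitely representable in $X$ is reflexive. $X$ is of type $2$ if there is $c>0$ with $(\mathbb{E}_\varepsilon\|\sum_k\varepsilon_kx_k\|^2)^{1/2}\le c(\sum_k\|x_k\|^2)^{1/2}$ for all finite sequences $\{x_k\}\subset X$, where the $\varepsilon_k$ are independent uniform signs. Let $\Omega_n=\{-1,1\}^n$ with the uniform probability $\mu_n(\{\omega\})=2^{-n}$, let $\mathcal{F}_0=\{\emptyset,\Omega_n\}$ and let $\mathcal{F}_k$ be the $\sigma$-algebra generated by the coordinates $\omega_1,\dots,\omega_k$. A Walsh-Paley martingale $\{M_k\}_0^n$ with values in $X$ is an $X$-valued martingale over $(\Omega_n,\mu_n)$ with respect to $\{\mathcal{F}_k\}_0^n$; $dM_k:=M_k-M_{k-1}$ for $k\ge1$. Let also $D_n=\{-1,1\}^n$ with uniform probability $P_n$; $\mathbb{E}_{\varepsilon,\omega}$ is the expectation with respect to $P_n\times\mu_n$. $RUMD_n(X)$ is the infimum of all $c>0$ such that $$\Big(\mathbb{E}_{\varepsilon,\omega}\Big\|\sum_{k=1}^n\varepsilon_k\,dM_k(\omega)\Big\|^2\Big)^{1/2}\le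 c\,\big(\mathbb{E}_\omega\|M_n(\omega)\|^2\big)^{1/2}$$ for all Walsh-Paley martingales $\{M_k\}_0^n$ with values in $X$ and $M_0=0$. *)

(* Defs.v *)
From mathcomp Require Import all_boot all_order all_algebra.
From mathcomp Require Import complex.
From mathcomp Require Import all_classical all_reals all_analysis.

Set Implicit Arguments.
Unset Strict Implicit.
Unset Printing Implicit Defensive.

Import Order.TTheory GRing.Theory Num.Theory.
Import numFieldNormedType.Exports.

Local Open Scope classical_set_scope.
Local Open Scope ring_scope.

(* [K R s] is the scalar field: R itself or its complexification R[i]. *)
Variant scalars := RealScalars | ComplexScalars.

Definition K (R : realType) (s : scalars) : numFieldType :=
  match s with RealScalars => R | ComplexScalars => R[i]%C end.

(* In MathComp the norm of a normed K-module takes its values in K (inside the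
   nonnegative reals); [real_part] brings it back to R. *)
Definition real_part (R : realType) (s : scalars) : K R s -> R :=
  match s return K R s -> R with
  | RealScalars => fun z => z
  | ComplexScalars => fun z => complex.Re z
  end.

Definition rabs (R : realType) (s : scalars) (z : K R s) : R :=
  real_part `|z|.

Definition rnorm (R : realType) (s : scalars) (X : normedModType (K R s))
  (x : X) : R := real_part `|x|.

Section Reflexivity.
Context {R : realType} {s : scalars}.
Implicit Types X Y : completeNormedModType (K R s).

Definition dual X : set (X -> K R s) :=
  [set f | linear (f : X -> (K R s)^o) /\ continuous f].

Definition dual_norm X (f : X -> K R s) : R :=
  sup [set rabs (f x) | x in [set x : X | rnorm x <= 1]].

(* Only the values of [phi] on [dual X] are relevant. *)
Definition bidual X : set ((X -> K R s) -> K R s) :=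
  [set phi |
    (forall (a : K R s) (f g : X -> K R s), dual f -> dual g ->
       phi (fun x => a * f x + g x) = a * phi f + phi g) /\
    (exists C : R, forall f, dual f -> rabs (phi f) <= C * dual_norm f)].

Definition reflexive_space X : Prop :=
  forall phi, @bidual X phi -> exists x : X, forall f, dual f -> phi f = f x.

Definition lin_span Y (m : nat) (y : 'I_m -> Y) : set Y :=
  [set u | exists a : 'I_m -> K R s, u = \sum_(i < m) a i *: y i].

Definition finitely_representable Y X : Prop :=
  forall (eps : R) (m : nat) (y : 'I_m -> Y), 0 < eps ->
    exists T : Y -> X,
      (forall (a : K R s) (u v : Y), lin_span y u -> lin_span y v ->
         T (a *: u + v) = a *: T u + T v) /\
      (forall u : Y, lin_span y u ->
         rnorm u <= rnorm (T u) <= (1 + eps) * rnorm u).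

Definition superreflexive X : Prop :=
  forall Y, finitely_representable Y X -> reflexive_space Y.

End Reflexivity.

Definition Omega (n : nat) := {ffun 'I_n -> bool}.

Definition sgn (A : pzRingType) (b : bool) : A := (-1) ^+ b.

Definition expect (R : realType) (T : finType) (f : T -> R) : R :=
  #|T|%:R^-1 * \sum_(t : T) f t.

(* The coordinates omega_1, ..., omega_k are indexed by the i < k. *)
Definition walsh_filtration (n k : nat) : set (set (Omega n)) :=
  <<s [set A | exists (i : 'I_n) (b : bool),
                 (i < k)%N /\ A = [set w : Omega n | w i = b]] >>.

Section Martingales.
Context {R : realType} {s : scalars}.
Variable X : completeNormedModType (K R s).

Definition type2 : Prop :=
  exists2 c : R, 0 < c &
    forall (m : nat) (x : 'I_m -> X),
      Num.sqrt (expect (fun e : Omega m =>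
        rnorm (\sum_(k < m) sgn (K R s) (e k) *: x k) ^+ 2))
      <= c * Num.sqrt (\sum_(k < m) rnorm (x k) ^+ 2).

(* E[M_(k+1) | F_k] = M_k is stated by the integrals over the sets of F_k; the
   common factor 2^(-n) is dropped. *)
Definition walsh_paley_martingale (n : nat) (M : nat -> Omega n -> X) : Prop :=
  (forall k, (k <= n)%N -> forall U : set X, open U ->
     walsh_filtration k (M k @^-1` U)) /\
  (forall k, (k < n)%N -> forall A : set (Omega n), walsh_filtration k A ->
     \sum_(w : Omega n | w \in A) M k.+1 w = \sum_(w : Omega n | w \in A) M k w).

Definition RUMD_bound (n : nat) (c : R) : Prop :=
  forall M : nat -> Omega n -> X,
    walsh_paley_martingale M -> (forall w, M 0%N w = 0) ->
    Num.sqrt (expect (fun ew : Omega n * Omega n =>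
      rnorm (\sum_(k < n)
        sgn (K R s) (ew.1 k) *: (M k.+1 ew.2 - M k ew.2)) ^+ 2))
    <= c * Num.sqrt (expect (fun w : Omega n => rnorm (M n w) ^+ 2)).

Definition RUMD (n : nat) : \bar R :=
  ereal_inf [set c%:E | c in [set c : R | 0 < c /\ RUMD_bound n c]].

End Martingales.

(* Main.v *)
(** Not superreflexive implies (2). By James, a space [Y] finitely representable
    in [X] and not reflexive contains, for every [N], vectors [y_1, ..., y_N] of
    the unit ball with [th * |sum_(i >= j) a_i| <= |sum_i a_i y_i|] for all [a]
    and [j]; these are copied into [X]. With [N = 2^n], average them over the
    dyadic intervals of rank [k] to get [M_k]. This martingale is bounded by 1.
    Testing [sum_k eps_k dM_k(w)] against the tail that starts at the position of
    the path [w], each increment contributes a coefficient whose mean square is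
    bounded below, and orthogonality of the signs gives a lower bound of order
    [sqrt n]. The upper bound is type 2 applied for fixed [w], since
    [E|dM_k|^2 <= 4 E|M_n|^2].

    (3) implies not superreflexive. By type 2, [RUMD_n >= sqrt n / c'] yields
    martingales with [E|dM_k|^2 >= d E|M_n|^2] for a number of indices [k] that
    tends to infinity with [n]. By the pigeonhole principle, one
    selects [N] times between which the energies of [Q M_t - sum_(i <- r) M_(t_i)]
    hardly increase for all multi-indices [r] of past times. Since
    [E (|H| - |E(H | F_j)|)^2 <= E|H|^2 - E|E(H | F_j)|^2], some point [w]
    satisfies all the almost-equalities of norms at once. This forces the averages
    of [Q] vectors among [M_(t_1)(w), ..., M_(t_l)(w)] to stay away from those
    of the later ones, uniformly in [N] and [Q]. In an ultrapower of [X] this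
    produces a bounded sequence with a gap between the convex hulls of its heads
    and of its tails, so by Hahn-Banach the ultrapower is not reflexive. *)

Require Import Defs.
From HB Require Import structures.
From mathcomp Require Import all_boot all_order all_algebra.
From mathcomp Require Import complex generic_quotient.
From mathcomp Require Import all_classical all_reals all_analysis.
From mathcomp Require Import ring lra zify.

Set Implicit Arguments.
Unset Strict Implicit.
Unset Printing Implicit Defensive.

Import Order.TTheory GRing.Theory Num.Theory.
Import numFieldNormedType.Exports.

Local Open Scope classical_set_scope.
Local Open Scope ring_scope.

(** * Scalars and norms *)

(** Why almost equal norms force a gap: let [S1] be a sum of [Q] earlier vectors. If every later
    vector taken [Q] times, and every sum of [Q] later vectors, lies at nearly the same distance rho
    from [S1], the triangle inequality through [S1] bounds [Q] times the norm of a later increment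
    by about 2 rho. One large increment thus keeps all later sums away from [S1]. The obstacle is
    the order of choices: the energies to be controlled involve past times that are still being
    selected. They are indexed by positions in the list of selected times, so their number depends
    on [N] and [Q] only; the tolerance can be fixed before the length of the martingale, and the sum
    of all these energies is one bounded monotone quantity to which the pigeonhole applies. Weights
    that are multiples of 1/Q keep that number finite. Taking Q = n! at the n-th coordinate of the
    ultrapower recovers all rational weights. In the converse direction, the tail coefficient of the
    k-th increment changes by exactly 1/2 in absolute value when the k-th sign of the path is
    flipped, so it cannot be small on average. *)

Section Scalars.
Context {R : realType} {s : scalars}.

(** [K R s] does not reduce while [s] is a variable. Norms are carried to [R] by [real_part] and
    back by this embedding, so that estimates take place in [R] and the two cases of [s] are opened
    in a few lemmas only. *)
Definition inK : R -> K R s :=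
  match s return R -> K R s with
  | RealScalars => fun r => r
  | ComplexScalars => fun r => (r%:C)%C
  end.

Lemma inK_is_zmod_morphism : zmod_morphism inK.
Proof. by rewrite /inK; case: s => //= x y; rewrite rmorphB. Qed.

Lemma inK_is_monoid_morphism : monoid_morphism inK.
Proof. by rewrite /inK; case: s => //=; split=> // x y; rewrite rmorphM. Qed.

HB.instance Definition _ := GRing.isZmodMorphism.Build R (K R s) inK
  inK_is_zmod_morphism.
HB.instance Definition _ := GRing.isMonoidMorphism.Build R (K R s) inK
  inK_is_monoid_morphism.

Lemma inKD x y : inK (x + y) = inK x + inK y.
Proof. exact: (rmorphD inK). Qed.
Lemma inKB x y : inK (x - y) = inK x - inK y.
Proof. exact: (rmorphB inK). Qed.
Lemma inKM x y : inK (x * y) = inK x * inK y.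
Proof. exact: (rmorphM inK). Qed.
Lemma inKN x : inK (- x) = - inK x.
Proof. exact: (rmorphN inK). Qed.
Lemma inK0 : inK 0 = 0.
Proof. exact: (rmorph0 inK). Qed.
Lemma inK1 : inK 1 = 1.
Proof. exact: (rmorph1 inK). Qed.
Lemma inK_nat n : inK n%:R = n%:R.
Proof. exact: (rmorph_nat inK). Qed.
Lemma inK_sum (I : Type) (r : seq I) (P : pred I) (F : I -> R) :
  inK (\sum_(i <- r | P i) F i) = \sum_(i <- r | P i) inK (F i).
Proof. exact: (rmorph_sum inK). Qed.

Lemma real_part_is_zmod_morphism : zmod_morphism (@real_part R s).
Proof. by rewrite /real_part; case: s => //= -[a b] [c d]. Qed.

HB.instance Definition _ := GRing.isZmodMorphism.Build (K R s) R
  (@real_part R s) real_part_is_zmod_morphism.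

Lemma real_partZ r (z : K R s) : real_part (inK r * z) = r * real_part z.
Proof.
rewrite /real_part /inK; case: s z => //= -[a b] /=.
by rewrite mul0r subr0.
Qed.

Lemma inKK r : real_part (inK r) = r.
Proof. by rewrite /real_part /inK; case: s. Qed.

Lemma norm_inK (z : K R s) : `|z| = inK (rabs z).
Proof.
by rewrite /rabs /real_part /inK; case: s z => //= z; rewrite normc_def.
Qed.

Lemma inK_le (x y : R) : (inK x <= inK y) = (x <= y).
Proof. by rewrite /inK; case: s => //=; rewrite lecR. Qed.

Lemma inK_lt (x y : R) : (inK x < inK y) = (x < y).
Proof. by rewrite /inK; case: s => //=; rewrite ltcR. Qed.

Lemma inK_inj : injective inK.
Proof. exact: can_inj inKK. Qed.

Lemma rabs_ge0 (z : K R s) : 0 <= rabs z.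
Proof. by rewrite -inK_le inK0 -norm_inK normr_ge0. Qed.

Lemma rabsM (y z : K R s) : rabs (y * z) = rabs y * rabs z.
Proof. by apply: inK_inj; rewrite inKM -!norm_inK normrM. Qed.

Lemma rabsD (y z : K R s) : rabs (y + z) <= rabs y + rabs z.
Proof. by rewrite -inK_le inKD -!norm_inK ler_normD. Qed.

Lemma rabsN (z : K R s) : rabs (- z) = rabs z.
Proof. by rewrite /rabs normrN. Qed.

Lemma rabs0 : rabs (0 : K R s) = 0.
Proof. by rewrite /rabs normr0 raddf0. Qed.

Lemma rabs_eq0 (z : K R s) : (rabs z == 0) = (z == 0).
Proof. by rewrite -(inj_eq inK_inj) -norm_inK inK0 normr_eq0. Qed.

Lemma rabs_inK r : rabs (inK r) = `|r|.
Proof.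
apply: inK_inj; rewrite -norm_inK; case: (leP 0 r) => r0.
  have r0' : 0 <= inK r by rewrite -inK0 inK_le.
  by rewrite (ger0_norm r0) (ger0_norm r0').
have r0' : inK r <= 0 by rewrite -inK0 inK_le ltW.
by rewrite (ltr0_norm r0) (ler0_norm r0') inKN.
Qed.

Lemma rabs1 : rabs (1 : K R s) = 1.
Proof. by rewrite -inK1 rabs_inK normr1. Qed.

Lemma rabs_nat n : rabs (n%:R : K R s) = n%:R.
Proof. by rewrite -inK_nat rabs_inK ger0_norm. Qed.

Lemma real_part_le_rabs (z : K R s) : real_part z <= rabs z.
Proof.
have : (real_part z) ^+ 2 <= rabs z ^+ 2.
  rewrite /rabs /real_part; case: s z => /=.
    by move=> r; rewrite real_normK // num_real.
  case=> a b /=; rewrite sqr_sqrtr; last by rewrite addr_ge0 // sqr_ge0.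
  by rewrite lerDl sqr_ge0.
move=> h; rewrite -[X in _ <= X]ger0_norm ?rabs_ge0 //.
by apply: le_trans (ler_norm _) _; rewrite -ler_sqr ?nnegrE // !real_normK ?num_real.
Qed.

Lemma real_part_ge_rabs (z : K R s) : - rabs z <= real_part z.
Proof. by rewrite lerNl -raddfN -(rabsN z) real_part_le_rabs. Qed.

Lemma normr_real_part (z : K R s) : `|real_part z| <= rabs z.
Proof. by rewrite ler_norml real_part_ge_rabs real_part_le_rabs. Qed.

(** This phase turns a bound on the real part of a linear functional into the same bound on its
    modulus. *)
Lemma rabs_phase (z : K R s) : exists2 u : K R s, rabs u = 1 & u * z = inK (rabs z).
Proof.
have [->|z0] := eqVneq z 0.
  by exists 1; rewrite ?rabs1 // mulr0 rabs0 inK0.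
exists (inK (rabs z) / z); last by rewrite divfK.
rewrite -norm_inK; apply: inK_inj.
by rewrite -norm_inK inK1 normrM normrV ?unitfE // normr_id divff // normr_eq0.
Qed.

End Scalars.

Arguments inK {R} s _.

Section Norms.
Context {R : realType} {s : scalars} {X : normedModType (K R s)}.
Implicit Types x y : X.

Lemma normE x : `|x| = inK s (rnorm x).
Proof.
rewrite /rnorm; have := normr_ge0 x.
rewrite /real_part /inK; case: s X x => //= Y x.
by rewrite lecE => /andP[/eqP/= h _];
   rewrite -[X in _ = (X +i* _)%C]/(complex.Re `|x|); case: `|x| h => a b /= ->.
Qed.

Lemma rnorm_ge0 x : 0 <= rnorm x.
Proof. by rewrite -(inK_le (s := s)) inK0 -normE normr_ge0. Qed.

Lemma rnormD x y : rnorm (x + y) <= rnorm x + rnorm y.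
Proof. by rewrite -(inK_le (s := s)) inKD -!normE ler_normD. Qed.

Lemma rnormZ (a : K R s) x : rnorm (a *: x) = rabs a * rnorm x.
Proof. by apply: (@inK_inj _ s); rewrite inKM -!normE -norm_inK normrZ. Qed.

Lemma rnormN x : rnorm (- x) = rnorm x.
Proof. by rewrite /rnorm normrN. Qed.

Lemma rnorm0 : rnorm (0 : X) = 0.
Proof. by rewrite /rnorm normr0 raddf0. Qed.

Lemma rnorm_eq0 x : (rnorm x == 0) = (x == 0).
Proof. by rewrite -(inj_eq (@inK_inj _ s)) -normE inK0 normr_eq0. Qed.

Lemma rnorm_distC x y : rnorm (x - y) = rnorm (y - x).
Proof. by rewrite -rnormN opprB. Qed.

Lemma rnormB x y : rnorm (x - y) <= rnorm x + rnorm y.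
Proof. by rewrite -(rnormN y) rnormD. Qed.

Lemma rnorm_lerB x y : rnorm x - rnorm y <= rnorm (x - y).
Proof. by rewrite lerBlDr -{1}(subrK y x) rnormD. Qed.

Lemma rnorm_dist x y : `|rnorm x - rnorm y| <= rnorm (x - y).
Proof.
by rewrite ler_norml rnorm_lerB andbT lerNl opprB rnorm_distC rnorm_lerB.
Qed.

Lemma rnorm_triangle y x z : rnorm (x - z) <= rnorm (x - y) + rnorm (y - z).
Proof. by rewrite (le_trans _ (rnormD _ _)) // subrKA. Qed.

Lemma rnorm_sum (I : Type) (r : seq I) (P : pred I) (F : I -> X) :
  rnorm (\sum_(i <- r | P i) F i) <= \sum_(i <- r | P i) rnorm (F i).
Proof.
elim/big_ind2: _ => [|x a y b ha hb|//]; first by rewrite rnorm0.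
by apply: le_trans (rnormD _ _) _; apply: lerD.
Qed.

Lemma rnormZ_inK r x : rnorm (inK s r *: x) = `|r| * rnorm x.
Proof. by rewrite rnormZ rabs_inK. Qed.

Lemma rnormZ_nat n x : rnorm (n%:R *: x) = n%:R * rnorm x.
Proof. by rewrite rnormZ rabs_nat. Qed.

Lemma rnormMn x n : rnorm (x *+ n) = n%:R * rnorm x.
Proof. by rewrite -rnormZ_nat scaler_nat. Qed.

End Norms.

(** * Hahn-Banach *)

Section HahnBanach.
Context {R : realType} {s : scalars} {V : lmodType (K R s)}.
Implicit Types (p q : V -> R) (u v w : V).

(** Homogeneity is asked as an inequality, which is easier to establish for infima; applied to the
    inverse scalar it gives equality ([sublinearZ]). *)
Definition sublinear p :=
  (forall u v, p (u + v) <= p u + p v) /\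
  (forall r u, 0 < r -> p (inK s r *: u) <= r * p u).

Definition real_linear (f : V -> R) :=
  {morph f : u v / u + v} /\ (forall r u, f (inK s r *: u) = r * f u).

(** A pair [(v, t)] in [C] stands for the demand [t <= f v] on a linear [f] to be found below [p].
    The closure properties and the last clause say that the demands, and all those they imply by
    positive combination, are compatible with [p]. *)
Definition cone_below p (C : set (V * R)) :=
  [/\ C (0, 0),
      forall c d, C c -> C d -> C (c.1 + d.1, c.2 + d.2),
      forall r c, 0 < r -> C c -> C (inK s r *: c.1, r * c.2) &
      forall c, C c -> c.2 <= p c.1].

Lemma sublinearZ p r u : sublinear p -> 0 < r -> p (inK s r *: u) = r * p u.
Proof.
move=> [_ pZ] r0; apply/le_anti; rewrite pZ //=.
have ri : 0 < r^-1 by rewrite invr_gt0.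
have := pZ _ (inK s r *: u) ri.
rewrite scalerA -inKM mulVf ?gt_eqF // inK1 scale1r.
by rewrite ler_pdivlMl.
Qed.

Lemma sublinear0 p : sublinear p -> p 0 = 0.
Proof.
move=> pP; have := @sublinearZ p 2 0 pP (ltr0Sn _ 1); rewrite scaler0 => h; lra.
Qed.

Lemma sublinear_opp p u : sublinear p -> - p (- u) <= p u.
Proof.
move=> pP; have := pP.1 u (- u); rewrite subrr sublinear0 // => h; lra.
Qed.

Definition inf_conv p (C : set (V * R)) u :=
  inf [set p (u + c.1) - c.2 | c in C].

Section InfConv.
Variables (p : V -> R) (C : set (V * R)).
Hypotheses (pP : sublinear p) (CP : cone_below p C).

Lemma inf_conv_lbound u : lbound [set p (u + c.1) - c.2 | c in C] (- p (- u)).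
Proof.
move=> _ [c Cc <-]; case: CP => _ _ _ /(_ _ Cc) h.
have := pP.1 (u + c.1) (- u); rewrite [X in p X](_ : _ = c.1); first by lra.
by rewrite addrC addKr.
Qed.

Lemma inf_conv_le u c : C c -> inf_conv p C u <= p (u + c.1) - c.2.
Proof.
by move=> Cc; apply: ge_inf; [exists (- p (- u)); exact: inf_conv_lbound|exists c].
Qed.

Lemma le_inf_conv u b : (forall c, C c -> b <= p (u + c.1) - c.2) ->
  b <= inf_conv p C u.
Proof.
move=> h; apply: lb_le_inf; first by case: CP => C0 _ _ _; exists (p (u + 0) - 0), (0, 0).
by move=> _ [c Cc <-]; apply: h.
Qed.

Lemma inf_conv_sublinear : sublinear (inf_conv p C).
Proof.
case: (CP) => C0 CD CZ _; split=> [u v|r u r0].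
  rewrite -lerBlDl; apply: le_inf_conv => c Cc.
  rewrite lerBlDl -lerBlDr; apply: le_inf_conv => d Cd.
  rewrite lerBlDr; apply: le_trans (inf_conv_le _ (CD _ _ Cd Cc)) _ => /=.
  have := pP.1 (u + d.1) (v + c.1); rewrite addrACA; lra.
rewrite -ler_pdivrMl //; apply: le_inf_conv => c Cc.
rewrite ler_pdivrMl //; apply: le_trans (inf_conv_le _ (CZ _ _ r0 Cc)) _ => /=.
by rewrite -scalerDr sublinearZ // mulrBr.
Qed.

End InfConv.

(** Zorn's lemma for the reversed pointwise order. The pointwise infimum of a chain is finite
    because every member is at least [- p (- u)] at [u]. *)
Lemma minimal_sublinear p : sublinear p ->
  exists q, [/\ sublinear q, forall u, q u <= p u &
    forall q', sublinear q' -> (forall u, q' u <= q u) -> forall u, q u <= q' u].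
Proof.
move=> pP; pose T := {q : V -> R | sublinear q /\ forall u, q u <= p u}.
pose Rel (q q' : T) := `[< forall u, sval q' u <= sval q u >].
have pT : sublinear p /\ forall u, p u <= p u by [].
have [| |A totA|[q [qP qp]] qmin] := @ZL_preorder T (exist _ p pT) Rel.
- by move=> q; apply/asboolP.
- move=> q1 q2 q3 /asboolP h1 /asboolP h2; apply/asboolP => u.
  exact: le_trans (h2 u) (h1 u).
- have [[q0 Aq0]|A0] := pselect (A !=set0); last first.
    by exists (exist _ p pT) => q Aq; case: A0; exists q.
  pose S u := [set sval q u | q in A].
  pose g u := inf (S u).
  have Slb u : has_lbound (S u).
    exists (- p (- u)) => _ [[q [qP qp]] _ <-] /=.
    by apply: le_trans (sublinear_opp u qP); rewrite lerN2.
  have gle (q : T) u : A q -> g u <= sval q u by move=> Aq; apply: ge_inf => //; exists q.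
  have leg (b : R) u : (forall q : T, A q -> b <= sval q u) -> b <= g u.
    move=> h; apply: lb_le_inf; first by exists (sval q0 u), q0.
    by move=> _ [q Aq <-]; apply: h.
  have gP : sublinear g /\ forall u, g u <= p u.
    split; last by move=> u; apply: le_trans (gle _ _ Aq0) _; exact: (svalP q0).2.
    split=> [u v|r u r0].
      rewrite -lerBlDl; apply: (leg _ _) => q1 Aq1; rewrite lerBlDl -lerBlDr.
      apply: (leg _ _) => q2 Aq2; rewrite lerBlDr.
      (* Subadditivity of the infimum: [q1] and [q2] are comparable, and the smaller of the two,
         evaluated at both [u] and [v], bounds [g (u + v)]. *)
      have [/asboolP h|/asboolP h] := totA _ _ Aq1 Aq2.
        apply: le_trans (gle _ _ Aq2) _; apply: le_trans ((svalP q2).1.1 _ _) _.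
        by rewrite lerD2l.
      apply: le_trans (gle _ _ Aq1) _; apply: le_trans ((svalP q1).1.1 _ _) _.
      by rewrite lerD2r.
    rewrite -ler_pdivrMl //; apply: (leg _ _) => q Aq; rewrite ler_pdivrMl //.
    by apply: le_trans (gle _ _ Aq) _; exact: (svalP q).1.2.
  by exists (exist _ g gP) => q Aq; apply/asboolP => u; exact: gle.
exists q; split=> // q' q'P q'q u.
have q'T : sublinear q' /\ forall u, q' u <= p u.
  by split=> // v; exact: le_trans (q'q v) (qp v).
have /asboolP : Rel (exist _ q' q'T) (exist _ q (conj qP qp)).
  by apply: qmin; apply/asboolP.
exact.
Qed.

(* A minimal sublinear functional is linear: infimal convolution with the ray
   through [v] does not decrease it, so [q u + q v <= q (u + v)]. *)
Lemma sublinear_dominates p : sublinear p ->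
  exists2 f, real_linear f & forall u, f u <= p u.
Proof.
move=> /minimal_sublinear[q [qP qp qmin]]; exists q => //.
have qD : {morph q : u v / u + v}.
  move=> u v; apply/le_anti; rewrite qP.1 /=.
  pose C : set (V * R) := [set (inK s r *: v, r * q v) | r in [set r | 0 <= r]].
  have CP : cone_below q C.
    split.
    - by exists 0; rewrite /= ?inK0 ?scale0r ?mul0r.
    - move=> _ _ [a a0 <-] [b b0 <-]; exists (a + b); first exact: addr_ge0.
      by rewrite /= inKD scalerDl mulrDl.
    - move=> r _ r0 [a a0 <-]; exists (r * a); first by rewrite /= mulr_ge0 // ltW.
      by rewrite /= inKM scalerA mulrA.
    - move=> _ [a a0 <-] /=; move: a0; rewrite /= le_eqVlt => /orP[/eqP<-|a0].
        by rewrite inK0 scale0r mul0r sublinear0.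
      by rewrite sublinearZ.
  have h := qmin _ (inf_conv_sublinear qP CP).
  have C1 : C (v, q v) by exists 1; rewrite /= ?inK1 ?scale1r ?mul1r.
  have := inf_conv_le qP CP u C1 => /= h1.
  rewrite -lerBrDr; apply: le_trans h1; apply: h => w.
  have C0 : C (0, 0) by case: CP.
  by have := inf_conv_le qP CP w C0; rewrite /= addr0 subr0.
have q0 := sublinear0 qP.
have qN u : q (- u) = - q u by have := qD u (- u); rewrite subrr q0; lra.
split=> // r u; case: (ltrgtP r 0) => [r0|r0|->].
- rewrite -[r]opprK inKN scaleNr qN sublinearZ // ?mulNr //; lra.
- exact: sublinearZ.
- by rewrite inK0 scale0r mul0r.
Qed.

(** Take a linear functional below [inf_conv p C]: the pair [(0, 0)] of [C] gives [f <= p], and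
    evaluation at [- c.1] gives the demand of [c]. *)
Lemma separate p C : sublinear p -> cone_below p C ->
  exists f, [/\ real_linear f, forall u, f u <= p u & forall c, C c -> c.2 <= f c.1].
Proof.
move=> pP CP; have [f fL fp] := sublinear_dominates (inf_conv_sublinear pP CP).
have fle u c : C c -> f u <= p (u + c.1) - c.2.
  by move=> Cc; apply: le_trans (fp u) (inf_conv_le pP CP _ Cc).
have C0 : C (0, 0) by case: CP.
exists f; split=> // [u|c Cc].
  by have := fle u _ C0; rewrite /= addr0 subr0.
have fN : f (- c.1) = - f c.1.
  by have := fL.2 (-1) c.1; rewrite inKN inK1 scaleN1r mulN1r.
by have := fle (- c.1) _ Cc; rewrite addNr (sublinear0 pP) fN; lra.
Qed.

End HahnBanach.

(** In the complex case the extension is [f u - i f (i u)], the only complex linear functional with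
    real part [f]. *)
Lemma complexify (R : realType) (s : scalars) (V : lmodType (K R s)) (f : V -> R) :
  real_linear f -> exists F : V -> K R s,
    (forall a u v, F (a *: u + v) = a * F u + F v) /\
    (forall u, real_part (F u) = f u).
Proof.
case: s V f => /= V f [fD fZ].
  by exists f; split=> // a u v; rewrite fD fZ.
exists (fun u => (f u +i* - f ((0 +i* 1)%C *: u))%C); split=> // -[a b] u v.
have e (w : V) : (a +i* b)%C *: w = inK ComplexScalars a *: w + inK ComplexScalars b *: ((0 +i* 1)%C *: w).
  rewrite scalerA -scalerDl; congr (_ *: _).
  by apply/eqP; rewrite eq_complex /=; apply/andP; split; apply/eqP; ring.
have ii (w : V) : (0 +i* 1)%C *: ((0 +i* 1)%C *: w) = inK ComplexScalars (-1) *: w.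
  rewrite scalerA; congr (_ *: _).
  by apply/eqP; rewrite eq_complex /=; apply/andP; split; apply/eqP; ring.
have com (w : V) (r : R) : (0 +i* 1)%C *: (inK ComplexScalars r *: w) =
    inK ComplexScalars r *: ((0 +i* 1)%C *: w).
  by rewrite !scalerA mulrC.
rewrite scalerDr (e u) scalerDr !com ii !fD !fZ.
by apply/eqP; rewrite eq_complex /=; apply/andP; split; apply/eqP; ring.
Qed.

(** * Limits along ultrafilters *)

Section UltraLimits.
Context {R : realType} {U : set_system nat} {UF : UltraFilter U}.
Implicit Types (h g : nat -> R).

Lemma ultra_cvg h (B : R) : (forall n, `|h n| <= B) -> exists l : R, h @ U --> l.
Proof.
move=> hB.
have FU : U (h @^-1` [set` `[- B, B]]).
  by apply: filterS filterT => n _ /=; rewrite in_itv /=; have := hB n; rewrite ler_norml.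
have [l [_ hl]] := @segment_compact R (- B) B (h @ U) _ FU.
exists l; apply/cvgrPdist_lt => e e0.
have [//|UC] := in_ultra_setVsetC [set n | `|l - h n| < e] UF.
have : (h @ U) [set x | ~ `|l - x| < e] by [].
move=> /hl /(_ (nbhsx_ballx l e e0)) [x [/= h1]].
by rewrite /ball /= => h2; case: h1.
Qed.

Definition ulim h := lim (h @ U).

Lemma ulimP h (B : R) : (forall n, `|h n| <= B) -> h @ U --> ulim h.
Proof. by move=> /ultra_cvg hl; apply/cvg_ex. Qed.

Lemma ulim_eq h (l : R) : h @ U --> l -> ulim h = l.
Proof. by move=> hl; apply/cvg_lim. Qed.

Lemma ucvg_le h g (l m : R) : h @ U --> l -> g @ U --> m ->
  U [set n | h n <= g n] -> l <= m.
Proof.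
move=> hl gm hg; rewrite -(cvg_lim _ hl) // -(cvg_lim _ gm) //.
by apply: ler_lim => //; apply/cvg_ex; eexists; [exact: hl|exact: gm].
Qed.

Lemma ucvg0_le h g : g @ U --> (0 : R) -> U [set n | 0 <= h n <= g n] ->
  h @ U --> (0 : R).
Proof.
by move=> g0 hg; apply: (squeeze_cvgr hg _ g0); exact: cvg_cst.
Qed.

Lemma ucvg_dist0 h (l : R) : (fun n => h n - l) @ U --> (0 : R) <-> h @ U --> l.
Proof.
split=> [hl|hl]; last by rewrite -(subrr l); apply: cvgB => //; exact: cvg_cst.
rewrite (_ : h = (fun n => (h n - l) + l)); last by apply/funext => n; rewrite subrK.
by rewrite -[X in _ --> X]add0r; apply: cvgD => //; exact: cvg_cst.
Qed.

End UltraLimits.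

Section UltraScalars.
Context {R : realType} {s : scalars} {U : set_system nat} {UF : UltraFilter U}.

(* Stated with [rabs], so that the real and the complex case look alike. *)
Definition kcvg (h : nat -> K R s) (l : K R s) :=
  (fun n => rabs (h n - l)) @ U --> (0 : R).

Lemma kcvg_ex (h : nat -> K R s) (B : R) : (forall n, rabs (h n) <= B) ->
  exists l, kcvg h l.
Proof.
rewrite /kcvg /rabs /real_part; case: s h => /= h hB.
  have [l hl] := ultra_cvg hB; exists l.
  by rewrite -[X in _ --> X](normr0 R); apply: cvg_norm; apply/ucvg_dist0.
have hr n : `|complex.Re (h n)| <= B.
  exact: le_trans (@normr_real_part R ComplexScalars (h n)) (hB n).
have hi n : `|complex.Im (h n)| <= B.
  apply: le_trans (hB n); have := @normr_real_part R ComplexScalars ((0 +i* 1)%C * h n).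
  rewrite rabsM; case: (h n) => a b /=; rewrite mul0r mul1r sub0r normrN.
  move/le_trans; apply; rewrite /rabs /real_part /=.
  by rewrite expr0n /= add0r expr1n sqrtr1 mul1r.
have [a ha] := ultra_cvg hr; have [b hb] := ultra_cvg hi; exists (a +i* b)%C.
have ha0 : (fun n => `|complex.Re (h n) - a|) @ U --> (0 : R).
  by rewrite -[X in _ --> X](normr0 R); apply: cvg_norm; apply/ucvg_dist0.
have hb0 : (fun n => `|complex.Im (h n) - b|) @ U --> (0 : R).
  by rewrite -[X in _ --> X](normr0 R); apply: cvg_norm; apply/ucvg_dist0.
apply: (@ucvg0_le _ _ _ _ (fun n => `|complex.Re (h n) - a| + `|complex.Im (h n) - b|)).
  by rewrite -[X in _ --> X]addr0; apply: cvgD.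
apply: filterS filterT => n _ /=; case: (h n) => c d /=.
rewrite sqrtr_ge0 /= -[X in _ <= X]ger0_norm ?addr_ge0 // -sqrtr_sqr ler_sqrt.
  rewrite [X in _ <= X]sqrrD !real_normK ?num_real // addrAC lerDl.
  by rewrite pmulrn_lge0 // mulr_ge0.
exact: sqr_ge0.
Qed.

Lemma kcvg_unique (h : nat -> K R s) l m : kcvg h l -> kcvg h m -> l = m.
Proof.
move=> hl hm; apply/eqP; rewrite -subr_eq0 -rabs_eq0 eq_le rabs_ge0 andbT.
have h0 : (fun n => rabs (h n - l) + rabs (h n - m)) @ U --> (0 : R).
  by rewrite -[X in _ --> X]addr0; apply: cvgD.
apply: (ucvg_le (cvg_cst (rabs (l - m))) h0).
apply: filterS filterT => n _ /=.
rewrite (_ : l - m = - (h n - l) + (h n - m)); last by ring.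
by apply: le_trans (rabsD _ _) _; rewrite rabsN.
Qed.

Lemma kcvg_lin (h g : nat -> K R s) a l m : kcvg h l -> kcvg g m ->
  kcvg (fun n => a * h n + g n) (a * l + m).
Proof.
move=> hl gm.
apply: (@ucvg0_le _ _ _ _ (fun n => rabs a * rabs (h n - l) + rabs (g n - m))).
  rewrite -[X in _ --> X]addr0; apply: cvgD => //.
  by rewrite -[X in _ --> X](mulr0 (rabs a)); apply: cvgMr.
apply: filterS filterT => n _ /=; rewrite rabs_ge0 /= -rabsM.
by apply: le_trans (rabsD _ _); rewrite (_ : _ - _ = a * (h n - l) + (g n - m)) //; ring.
Qed.

Lemma kcvg_rabs_le (h : nat -> K R s) l (b : R) : kcvg h l -> (forall n, rabs (h n) <= b) ->
  rabs l <= b.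
Proof.
move=> hl hb.
have h0 : (fun n => b + rabs (h n - l)) @ U --> (b + 0 : R).
  by apply: cvgD => //; exact: cvg_cst.
rewrite -[b]addr0; apply: (ucvg_le (cvg_cst _) h0).
apply: filterS filterT => n _ /=; have := rabsD (l - h n) (h n).
by rewrite subrK -(rabsN (l - h n)) opprB => /le_trans; apply; rewrite addrC lerD2r.
Qed.

Lemma kcvg_real_part_ge (h : nat -> K R s) l (b : R) : kcvg h l ->
  U [set n | b <= real_part (h n)] -> b <= real_part l.
Proof.
move=> hl hb.
have h0 : (fun n => real_part l + rabs (h n - l)) @ U --> (real_part l + 0 : R).
  by apply: cvgD => //; exact: cvg_cst.
rewrite -[real_part l]addr0; apply: (ucvg_le (cvg_cst _) h0).
apply: filterS hb => n /= /le_trans; apply.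
rewrite -[X in real_part X](subrK l) addrC raddfD lerD2l.
exact: real_part_le_rabs.
Qed.

End UltraScalars.

Definition free_ultra : set_system nat :=
  sval (cid (ultraFilterLemma eventually_filter)).

#[global] Instance free_ultra_ultra : UltraFilter free_ultra.
Proof. exact: (svalP (cid (ultraFilterLemma eventually_filter))).1. Qed.

Lemma free_ultra_oo : \oo `<=` free_ultra.
Proof. exact: (svalP (cid (ultraFilterLemma eventually_filter))).2. Qed.

Lemma free_ultra_ge N : free_ultra [set n | (N <= n)%N].
Proof. by apply: free_ultra_oo; exists N. Qed.

Lemma cvg_ultra_sum (R : realType) (U : set_system nat) (UF : UltraFilter U)
    (I : finType) (h : I -> nat -> R) (l : I -> R) :
  (forall i, h i @ U --> l i) -> (fun n => \sum_i h i n) @ U --> \sum_i l i.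
Proof. by move=> hl; apply: cvg_big => [|i _]; [exact: add_continuous|exact: hl]. Qed.

(** * Ultrapowers *)

Section Ultrapower.
Local Open Scope quotient_scope.
Context {R : realType} {s : scalars} {X : completeNormedModType (K R s)}.
Local Notation U := free_ultra.

Record bddseq := BddSeq { bddseq_val :> nat -> X;
  bddseq_bounded : exists B : R, forall n, rnorm (bddseq_val n) <= B }.

Lemma bddseq_add_subproof (u v : bddseq) :
  exists B : R, forall n, rnorm (u n + v n) <= B.
Proof.
case: u v => [u [B uB]] [v [C vC]] /=; exists (B + C) => n.
by apply: le_trans (rnormD _ _) _; apply: lerD.
Qed.
Definition bddseq_add u v := BddSeq (bddseq_add_subproof u v).

Lemma bddseq_scale_subproof (a : K R s) (u : bddseq) :
  exists B : R, forall n, rnorm (a *: u n) <= B.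
Proof.
case: u => [u [B uB]] /=; exists (rabs a * B) => n.
by rewrite rnormZ; apply: ler_wpM2l; rewrite ?rabs_ge0.
Qed.
Definition bddseq_scale a u := BddSeq (bddseq_scale_subproof a u).

Lemma bddseq_zero_subproof : exists B : R, forall n : nat, rnorm (0 : X) <= B.
Proof. by exists 0 => n; rewrite rnorm0. Qed.
Definition bddseq_zero := @BddSeq (fun=> 0) bddseq_zero_subproof.

Definition bddseq_norm (u : bddseq) : R := ulim (U := U) (fun n => rnorm (u n)).

Lemma bddseq_normP (u : bddseq) : (fun n => rnorm (u n)) @ U --> bddseq_norm u.
Proof.
case: u => u [B uB]; apply: (@ulimP _ _ _ _ B) => n /=.
by rewrite ger0_norm ?rnorm_ge0.
Qed.

Arguments bddseq_normP : clear implicits.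

Definition null_diff (u v : bddseq) : Prop := (fun n => rnorm (u n - v n)) @ U --> (0 : R).

Definition bddseq_rel : rel {classic bddseq} := fun u v => `[< null_diff u v >].

Lemma bddseq_rel_refl : reflexive bddseq_rel.
Proof.
move=> u; apply/asboolP; rewrite /null_diff.
under eq_fun do rewrite subrr rnorm0.
exact: cvg_cst.
Qed.

Lemma bddseq_rel_sym : symmetric bddseq_rel.
Proof.
move=> u v; apply/asboolP/asboolP; rewrite /null_diff.
  by under eq_fun do rewrite rnorm_distC.
by under eq_fun do rewrite rnorm_distC.
Qed.

Lemma null_diff_trans (v u w : bddseq) : null_diff u v -> null_diff v w -> null_diff u w.
Proof.
move=> uv vw; apply: (@ucvg0_le _ _ _ _ (fun n => rnorm (u n - v n) + rnorm (v n - w n))).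
  by rewrite -[X in _ --> X]addr0; apply: cvgD.
by apply: filterS filterT => n _ /=; rewrite rnorm_ge0 rnorm_triangle.
Qed.

Lemma bddseq_rel_trans : transitive bddseq_rel.
Proof.
move=> v u w /asboolP uv /asboolP vw; apply/asboolP; exact: null_diff_trans uv vw.
Qed.

Canonical bddseq_equiv := EquivRel bddseq_rel bddseq_rel_refl bddseq_rel_sym bddseq_rel_trans.

Definition ultrapower := {eq_quot bddseq_equiv}.
HB.instance Definition _ := Choice.on ultrapower.

Definition ucls (u : bddseq) : ultrapower := \pi_({eq_quot bddseq_equiv})%qT (u : {classic bddseq}).
Definition urep (x : ultrapower) : bddseq := repr x.

Lemma urepK x : ucls (urep x) = x.
Proof. exact: reprK. Qed.

Lemma ucls_eq u v : ucls u = ucls v <-> null_diff u v.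
Proof.
split=> [/eqmodP/asboolP //|uv]; apply/eqmodP; exact/asboolP.
Qed.

Lemma urep_ucls u : null_diff (urep (ucls u)) u.
Proof. by apply/ucls_eq; rewrite urepK. Qed.

Lemma ucls_ext (u v : bddseq) : (forall n, u n = v n) -> ucls u = ucls v.
Proof.
move=> uv; apply/ucls_eq; rewrite /null_diff.
under eq_fun do rewrite uv subrr rnorm0.
exact: cvg_cst.
Qed.

Definition uadd x y := ucls (bddseq_add (urep x) (urep y)).
Definition uscale a x := ucls (bddseq_scale a (urep x)).
Definition uopp x := uscale (-1) x.
Definition unorm x := inK s (bddseq_norm (urep x)).

Lemma uaddE u v : uadd (ucls u) (ucls v) = ucls (bddseq_add u v).
Proof.
apply/ucls_eq; rewrite /null_diff.
set u' := urep (ucls u); set v' := urep (ucls v).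
apply: (@ucvg0_le _ _ _ _ (fun n => rnorm (u' n - u n) + rnorm (v' n - v n))).
  by rewrite -[X in _ --> X]addr0; apply: cvgD; exact: urep_ucls.
apply: filterS filterT => n _ /=; rewrite rnorm_ge0 opprD addrACA.
exact: rnormD.
Qed.

Lemma uscaleE a u : uscale a (ucls u) = ucls (bddseq_scale a u).
Proof.
apply/ucls_eq; rewrite /null_diff.
rewrite (_ : (fun n => _) = (fun n => rabs a * rnorm (urep (ucls u) n - u n))).
  by rewrite -[X in _ --> X](mulr0 (rabs a)); apply: cvgMr; exact: urep_ucls.
by apply/funext => n; rewrite /= -scalerBr rnormZ.
Qed.

Lemma unormE u : unorm (ucls u) = inK s (bddseq_norm u).
Proof.
congr (inK s _); apply: ulim_eq.
have h := urep_ucls u; have := bddseq_normP u; set l := bddseq_norm u => hl.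
apply/ucvg_dist0; apply/norm_cvg0P.
apply: (@ucvg0_le _ _ _ _ (fun n => rnorm (urep (ucls u) n - u n) + `|rnorm (u n) - l|)).
  rewrite -[X in _ --> X]addr0; apply: cvgD => //.
  by rewrite -[X in _ --> X](normr0 R); apply: cvg_norm; apply/ucvg_dist0.
apply: filterS filterT => n _ /=; rewrite normr_ge0 /=.
rewrite -(subrKA (rnorm (u n))); apply: le_trans (ler_normD _ _) _.
by rewrite lerD2r rnorm_dist.
Qed.

Lemma ultrapower_ind (P : ultrapower -> Prop) : (forall u, P (ucls u)) -> forall x, P x.
Proof. by move=> h x; rewrite -(urepK x). Qed.

Lemma uaddA : associative uadd.
Proof.
elim/ultrapower_ind => u; elim/ultrapower_ind => v; elim/ultrapower_ind => w.
by rewrite !uaddE; apply: ucls_ext => n /=; rewrite addrA.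
Qed.

Lemma uaddC : commutative uadd.
Proof.
elim/ultrapower_ind => u; elim/ultrapower_ind => v.
by rewrite !uaddE; apply: ucls_ext => n /=; rewrite addrC.
Qed.

Lemma uadd0 : left_id (ucls bddseq_zero) uadd.
Proof.
elim/ultrapower_ind => u; rewrite uaddE; apply: ucls_ext => n /=; exact: add0r.
Qed.

Lemma uaddN : left_inverse (ucls bddseq_zero) uopp uadd.
Proof.
elim/ultrapower_ind => u; rewrite /uopp uscaleE uaddE; apply: ucls_ext => n /=.
by rewrite scaleN1r addNr.
Qed.

HB.instance Definition _ := GRing.isZmodule.Build ultrapower uaddA uaddC uadd0 uaddN.

Lemma uscaleA a b x : uscale a (uscale b x) = uscale (a * b) x.
Proof.
elim/ultrapower_ind: x => u; rewrite !uscaleE; apply: ucls_ext => n /=; exact: scalerA.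
Qed.

Lemma uscale1 : left_id 1 uscale.
Proof.
elim/ultrapower_ind => u; rewrite uscaleE; apply: ucls_ext => n /=; exact: scale1r.
Qed.

Lemma uscaleDr : right_distributive uscale +%R.
Proof.
move=> a; elim/ultrapower_ind => u; elim/ultrapower_ind => v.
rewrite [ucls u + _]uaddE !uscaleE [RHS]uaddE; apply: ucls_ext => n /=; exact: scalerDr.
Qed.

Lemma uscaleDl x : {morph uscale^~ x : a b / a + b}.
Proof.
elim/ultrapower_ind: x => u a b.
rewrite /= !uscaleE [RHS]uaddE; apply: ucls_ext => n /=; exact: scalerDl.
Qed.

HB.instance Definition _ := GRing.Zmodule_isLmodule.Build (K R s) ultrapower
  uscaleA uscale1 uscaleDr uscaleDl.

Lemma unormD x y : unorm (x + y) <= unorm x + unorm y.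
Proof.
elim/ultrapower_ind: x => u; elim/ultrapower_ind: y => v.
rewrite [ucls u + ucls v]uaddE !unormE -inKD inK_le.
apply: (ucvg_le (bddseq_normP _) (cvgD (bddseq_normP u) (bddseq_normP v))).
by apply: filterS filterT => n _ /=; rewrite rnormD.
Qed.

Lemma unormZ a x : unorm (a *: x) = `|a| * unorm x.
Proof.
elim/ultrapower_ind: x => u.
rewrite [a *: _]uscaleE !unormE norm_inK -inKM; congr (inK s _).
apply: ulim_eq; rewrite (_ : (fun n => _) = (fun n => rabs a * rnorm (u n))).
  by apply: cvgMr; exact: bddseq_normP.
by apply/funext => n /=; rewrite rnormZ.
Qed.

Lemma unorm0_eq0 x : unorm x = 0 -> x = 0.
Proof.
elim/ultrapower_ind: x => u; rewrite unormE -(inK0 (s := s)) => /inK_inj u0.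
apply/ucls_eq; rewrite /null_diff.
under eq_fun do rewrite /= subr0.
by rewrite -u0; exact: bddseq_normP.
Qed.

HB.instance Definition _ := Lmodule_isNormed.Build (K R s) ultrapower
  unormD unormZ unorm0_eq0.

Lemma rnorm_ucls u : rnorm (ucls u : ultrapower) = bddseq_norm u.
Proof. by rewrite /rnorm [`|_|]unormE inKK. Qed.

Lemma uclsB u v : ucls u - ucls v = ucls (bddseq_add u (bddseq_scale (-1) v)).
Proof. by rewrite -scaleN1r [_ *: _]uscaleE [LHS]uaddE. Qed.

Lemma uclsB_cvg (u v : bddseq) :
  (fun n => rnorm (u n - v n)) @ U --> rnorm (ucls u - ucls v : ultrapower).
Proof.
rewrite uclsB rnorm_ucls; have := bddseq_normP (bddseq_add u (bddseq_scale (-1) v)).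
by under eq_fun do rewrite /= scaleN1r.
Qed.

(* The limit is the class of a diagonal sequence of representatives. *)
Lemma ultrapower_complete (F : set_system ultrapower) :
  ProperFilter F -> cauchy F -> cvg F.
Proof.
move=> FF /cauchyP Fc.
have e0 k : 0 < inK s (k.+1%:R^-1 : R) by rewrite -(inK0 (s := s)) inK_lt invr_gt0.
have /choice[x xP] : forall k, exists x : ultrapower, F (ball x (inK s (k.+1%:R^-1 : R))).
  by move=> k; exact: Fc (e0 k).
have bE (a b : ultrapower) (r : R) : ball a (inK s r) b = (rnorm (a - b) < r) :> Prop.
  by rewrite -ball_normE /= normE inK_lt.
have xx i j : rnorm (x i - x j) < i.+1%:R^-1 + j.+1%:R^-1 :> R.
  have [z [zi zj]] := filter_ex (filterI (xP i) (xP j)).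
  rewrite bE in zi; rewrite bE rnorm_distC in zj.
  by apply: le_lt_trans (rnorm_triangle z _ _) _; apply: ltrD.
pose v k := urep (x k).
pose good k n := forall i j : 'I_k.+1, rnorm (v i n - v j n) <= i.+1%:R^-1 + j.+1%:R^-1.
have goodU k : U [set n | good k n].
  apply: (@filter_forall _ _ (fun i n => forall j : 'I_k.+1, _)) => i.
  apply: (@filter_forall _ _ (fun j n => _ <= _)) => j.
  have := @uclsB_cvg (v i) (v j); rewrite !urepK.
  move/cvgr_lt => /(_ _ (xx i j)); apply: filterS => n /=; exact: ltW.
have good0 n : good 0%N n.
  by move=> i j; rewrite !ord1 subrr rnorm0 addr_ge0.
(* At coordinate [n] the diagonal sequence follows the representative of largest rank [k <= n] for
   which all representatives up to rank [k] are still mutually close there. Such a rank exists since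
   [good 0 n] always holds, and it eventually exceeds any given rank along the ultrafilter. *)
have kapP n : exists k, [/\ (k <= n)%N, good k n &
    forall l, (l <= n)%N -> good l n -> (l <= k)%N].
  pose P k := (k <= n)%N && `[< good k n >].
  have P0 : exists k, P k by exists 0%N; apply/andP; split=> //; exact/asboolP.
  have Pn k : P k -> (k <= n)%N by case/andP.
  case: (ex_maxnP P0 Pn) => k /andP[kn /asboolP gk] kmax; exists k; split=> // l ln gl.
  by apply: kmax; rewrite /P ln; exact/asboolP.
have [kap kP] := choice kapP.
have wB : exists B : R, forall n, rnorm (v (kap n) n) <= B.
  have [B uB] := bddseq_bounded (v 0%N); exists (2 + B) => n.
  have [_ gk _] := kP n; have := gk ord_max ord0; rewrite /= => h.
  rewrite -(subrK (v 0%N n) (v _ n)); apply: le_trans (rnormD _ _) _; apply: lerD => //.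
  apply: le_trans h _; rewrite (_ : 2 = 1 + 1) // lerD // ?invr1 //.
  by rewrite invf_le1 ?ler1n.
pose w := BddSeq wB.
have xw k : rnorm (x k - ucls w) <= 2 * k.+1%:R^-1.
  have := @uclsB_cvg (v k) w; rewrite urepK => h.
  apply: (ucvg_le h (cvg_cst _)).
  apply: filterS (filterI (goodU k) (free_ultra_ge k)) => n [/= gk kn].
  have [_ gl /(_ k kn gk) kl] := kP n.
  have kl' : (k < (kap n).+1)%N by rewrite ltnS.
  have := gl (Ordinal kl') ord_max => /= /le_trans; apply.
  rewrite mulrDl !mul1r lerD2l lef_pV2 ?posrE // ler_nat ltnS //.
apply/cvg_ex; exists (ucls w); apply/fcvg_ballP => e egt0.
have eE : e = inK s (rabs e) by rewrite -norm_inK gtr0_norm.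
have re0 : 0 < rabs e by rewrite -(inK_lt (s := s)) inK0 -eE.
(* The 3 counts one [k.+1%:R^-1] from [z] to [x k] and two from [x k] to the class of [w]. *)
pose k := Num.trunc (3 / rabs e).
have k3 : 3 * k.+1%:R^-1 < rabs e.
  rewrite ltr_pdivrMr // mulrC -ltr_pdivrMr //.
  by apply: Num.Theory.truncnS_gt.
apply: filterS (xP k) => z; rewrite eE !bE => h.
apply: le_lt_trans (rnorm_triangle (x k) _ _) _.
rewrite rnorm_distC; apply: le_lt_trans k3; have := xw k; move: h.
set a : R := rnorm _; set b : R := rnorm _; set c : R := _^-1; lra.
Qed.

HB.instance Definition _ := Uniform_isComplete.Build ultrapower ultrapower_complete.

End Ultrapower.
Arguments ultrapower {R s} X.

(** * The ultrapower is finitely representable *)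

Section FiniteDimension.
Context {R : realType} {s : scalars}.
Local Notation U := free_ultra.

Definition l1 m (a : 'I_m -> K R s) : R := \sum_(i < m) rabs (a i).

Lemma l1_ge0 m (a : 'I_m -> K R s) : 0 <= l1 a.
Proof. by apply: sumr_ge0 => i _; exact: rabs_ge0. Qed.

Lemma rabs_le_l1 m (a : 'I_m -> K R s) i : rabs (a i) <= l1 a.
Proof.
by rewrite /l1 (bigD1 i) //= lerDl; apply: sumr_ge0 => j _; exact: rabs_ge0.
Qed.

Lemma l1_normalize m (a : 'I_m -> K R s) : 0 < l1 a ->
  l1 (fun i => inK s (l1 a)^-1 * a i) = 1.
Proof.
move=> a0; rewrite /l1; under eq_bigr do rewrite rabsM rabs_inK.
by rewrite -mulr_sumr ger0_norm ?invr_ge0 ?l1_ge0 // mulVf // gt_eqF.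
Qed.

Lemma l1_compact m (a : nat -> 'I_m -> K R s) : (forall n, l1 (a n) <= 1) ->
  exists b, (fun n => l1 (fun i => a n i - b i)) @ U --> (0 : R).
Proof.
move=> a1.
have /choice[b bP] : forall i, exists l, kcvg (U := U) (fun n => a n i) l.
  by move=> i; apply: (@kcvg_ex _ _ _ _ _ 1) => n; apply: le_trans (rabs_le_l1 _ _) (a1 n).
exists b; rewrite (_ : 0 = \sum_(i < m) (0 : R)); last by rewrite big1.
exact: cvg_ultra_sum.
Qed.

Lemma rnorm_lincomb_le (Y : normedModType (K R s)) m (a : 'I_m -> K R s)
    (y : 'I_m -> Y) B : (forall i, rnorm (y i) <= B) ->
  rnorm (\sum_(i < m) a i *: y i) <= B * l1 a.
Proof.
move=> yB; apply: le_trans (rnorm_sum _ _ _) _; rewrite /l1 mulr_sumr.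
by apply: ler_sum => i _; rewrite rnormZ mulrC ler_wpM2r ?rabs_ge0.
Qed.

Lemma fin_norm_bound (Y : normedModType (K R s)) m (y : 'I_m -> Y) :
  exists2 B : R, 0 <= B & forall i, rnorm (y i) <= B.
Proof.
exists (\sum_(i < m) rnorm (y i)); first by apply: sumr_ge0 => i _; exact: rnorm_ge0.
by move=> i; rewrite (bigD1 i) //= lerDl; apply: sumr_ge0 => j _; exact: rnorm_ge0.
Qed.

Definition lin_indep (Y : normedModType (K R s)) m (y : 'I_m -> Y) :=
  forall a : 'I_m -> K R s, \sum_(i < m) a i *: y i = 0 -> forall i, a i = 0.

Lemma lincombB (Y : normedModType (K R s)) m (a b : 'I_m -> K R s) (y : 'I_m -> Y) :
  \sum_(i < m) a i *: y i - \sum_(i < m) b i *: y i = \sum_(i < m) (a i - b i) *: y i.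
Proof. by rewrite -sumrB; apply: eq_bigr => i _; rewrite scalerBl. Qed.

Lemma lincombZ (Y : normedModType (K R s)) m c (a : 'I_m -> K R s) (y : 'I_m -> Y) :
  \sum_(i < m) (c * a i) *: y i = c *: \sum_(i < m) a i *: y i.
Proof. by rewrite scaler_sumr; apply: eq_bigr => i _; rewrite scalerA. Qed.

(** Compactness of the [l1] unit sphere, by coordinatewise ultralimits: coefficient vectors of size
    1 whose combinations tend to 0 would have a limit of size 1 with combination 0. *)
Lemma lin_indep_bound (Y : normedModType (K R s)) m (y : 'I_m -> Y) :
  lin_indep y -> exists2 k : R, 0 < k & forall a, k * l1 a <= rnorm (\sum_(i < m) a i *: y i).
Proof.
move=> yi; apply: contrapT => nk.
have /choice[a aP] : forall n : nat, exists a : 'I_m -> K R s, l1 a = 1 /\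
    rnorm (\sum_(i < m) a i *: y i) < n.+1%:R^-1.
  move=> n; apply: contrapT => na; apply: nk; exists n.+1%:R^-1 => [|a].
    by rewrite invr_gt0.
  rewrite leNgt; apply/negP => h; apply: na.
  have a0 : 0 < l1 a.
    rewrite lt_neqAle l1_ge0 andbT; apply/eqP => e; move: h.
    by rewrite -e mulr0 ltNge rnorm_ge0.
  exists (fun i => inK s (l1 a)^-1 * a i); split; first exact: l1_normalize.
  rewrite lincombZ rnormZ_inK ger0_norm ?invr_ge0 ?l1_ge0 //.
  by rewrite mulrC ltr_pdivrMr.
have [|b bP] := l1_compact (a := a); first by move=> n; rewrite (aP n).1.
have [B B0 yB] := fin_norm_bound y.
have b0 : \sum_(i < m) b i *: y i = 0.
  apply/eqP; rewrite -rnorm_eq0 eq_le rnorm_ge0 andbT.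
  have h : (fun n => n.+1%:R^-1 + B * l1 (fun i => a n i - b i)) @ U --> (0 : R).
    rewrite -[X in _ --> X]addr0; apply: cvgD.
      by apply: cvg_trans (@cvg_harmonic R); apply: cvg_app; exact: free_ultra_oo.
    by rewrite -[X in _ --> X](mulr0 B); apply: cvgMl_tmp.
  apply: (ucvg_le (cvg_cst _) h); apply: filterS filterT => n _ /=.
  rewrite -[X in rnorm X](subrK (\sum_(i < m) a n i *: y i)) addrC.
  apply: le_trans (rnormD _ _) _; apply: lerD; first exact: ltW (aP n).2.
  by rewrite rnorm_distC lincombB; exact: rnorm_lincomb_le.
have {}b0 := yi _ b0.
have : (1 : R) <= 0.
  apply: (ucvg_le (cvg_cst _) bP); apply: filterS filterT => n _ /=.
  rewrite -(aP n).1 /l1; apply: ler_sum => i _; by rewrite b0 subr0.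
by rewrite ler10.
Qed.

(** Finite representability concerns arbitrary finite families. Passing to an independent family
    with the same reach makes coefficients unique, hence linear in the vector. *)
Lemma lin_indep_reduction (Y : normedModType (K R s)) m (y : 'I_m -> Y) :
  exists k (z : 'I_k -> Y), lin_indep z /\
    forall a, exists b, \sum_(i < m) a i *: y i = \sum_(i < k) b i *: z i.
Proof.
elim: m y => [|m IH] y; first by exists 0%N, y; split=> [a _ []//|a]; exists a.
have [yi|] := pselect (lin_indep y); first by exists m.+1, y; split=> // a; exists a.
move=> /existsNP[c /not_implyP[c0 /existsNP[j /eqP cj]]].
have yj : y j = \sum_(i < m) (- (c j)^-1 * c (lift j i)) *: y (lift j i).
  rewrite (lincombZ _ (fun i => c (lift j i)) (fun i => y (lift j i))).
  rewrite (bigD1_ord j) //= in c0.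
  rewrite -[y j]scale1r -(mulVf cj) -scalerA.
  by rewrite scaleNr -scalerN; congr (_ *: _); apply/eqP; rewrite -addr_eq0; exact/eqP.
have [k [z [zi zP]]] := IH (fun i => y (lift j i)); exists k, z; split=> // a.
have [b bP] := zP (fun i => a j * (- (c j)^-1 * c (lift j i)) + a (lift j i)).
exists b; rewrite -bP (bigD1_ord j) //= {1}yj.
rewrite -(lincombZ (a j) (fun i => - (c j)^-1 * c (lift j i)) (fun i => y (lift j i))).
by rewrite -big_split; apply: eq_bigr => i _; rewrite scalerDl.
Qed.

Variable X : completeNormedModType (K R s).

Definition bddseq_lincomb m (a : 'I_m -> K R s) (z : 'I_m -> @bddseq R s X) : @bddseq R s X :=
  \big[bddseq_add/bddseq_zero]_(i < m) bddseq_scale (a i) (z i).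

Lemma bddseq_lincombE m (a : 'I_m -> K R s) (z : 'I_m -> @bddseq R s X) n :
  bddseq_lincomb a z n = \sum_(i < m) a i *: z i n.
Proof.
rewrite /bddseq_lincomb; elim/big_rec2: _ => // i x u _ ux.
by rewrite /= ux.
Qed.

Lemma ucls_lincomb m (a : 'I_m -> K R s) (z : 'I_m -> @bddseq R s X) :
  \sum_(i < m) a i *: (ucls (z i) : ultrapower X) = ucls (bddseq_lincomb a z).
Proof.
rewrite /bddseq_lincomb; elim/big_rec2: _ => // i x u _ ->.
by rewrite [_ *: _]uscaleE [LHS]uaddE.
Qed.

Lemma ucls_lincomb_cvg m (a : 'I_m -> K R s) (z : 'I_m -> @bddseq R s X) :
  (fun n => rnorm (\sum_(i < m) a i *: z i n)) @ U -->
    rnorm (\sum_(i < m) a i *: (ucls (z i) : ultrapower X)).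
Proof.
rewrite ucls_lincomb rnorm_ucls.
rewrite (_ : (fun n => _) = (fun n => rnorm (bddseq_lincomb a z n))).
  exact: bddseq_normP.
by apply/funext => n; rewrite bddseq_lincombE.
Qed.

(** Convergence for each fixed [a] becomes uniform because the norms are Lipschitz in [a] for [l1]
    and bounded coefficient vectors have ultralimits. If the set were not in the ultrafilter,
    normalized violating vectors [a n] would have a limit [b] at which the pointwise convergence
    fails. *)
Lemma ucls_lincomb_uniform m (z : 'I_m -> @bddseq R s X) (d : R) : 0 < d ->
  U [set n | forall a : 'I_m -> K R s,
    `|rnorm (\sum_(i < m) a i *: z i n) -
      rnorm (\sum_(i < m) a i *: (ucls (z i) : ultrapower X))| <= d * l1 a].
Proof.
move=> d0; set A := (X in U X).
have [//|UC] := in_ultra_setVsetC A free_ultra_ultra.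
pose D n (a : 'I_m -> K R s) := rnorm (\sum_(i < m) a i *: z i n) -
  rnorm (\sum_(i < m) a i *: (ucls (z i) : ultrapower X)).
have /choice[a aP] : forall n : nat, exists a : 'I_m -> K R s, l1 a <= 1 /\
    ((~` A) n -> d < `|D n a|).
  move=> n; have [An|nA] := pselect (A n).
    exists (fun=> 0); split; last by [].
    by rewrite /l1 big1 // => i _; rewrite rabs0.
  move: (nA); rewrite /A /= => /existsNP[a /negP]; rewrite -ltNge => h.
  have a0 : 0 < l1 a.
    rewrite lt_neqAle l1_ge0 andbT; apply/eqP => e; move: h; rewrite -e mulr0.
    have az i : a i = 0.
      by apply/eqP; rewrite -rabs_eq0 eq_le rabs_ge0 andbT e rabs_le_l1.
    by rewrite !big1 ?rnorm0 ?subrr ?normr0 ?ltxx // => i _; rewrite az scale0r.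
  exists (fun i => inK s (l1 a)^-1 * a i); split; first by rewrite l1_normalize.
  move=> _; rewrite /D !lincombZ !rnormZ_inK -mulrBr normrM normr_id.
  have -> : `|(l1 a)^-1| = (l1 a)^-1 by rewrite ger0_norm // invr_ge0 l1_ge0.
  by rewrite ltr_pdivlMl // mulrC.
have [|b bP] := l1_compact (a := a); first by move=> n; exact: (aP n).1.
have [B1 B10 zB] := fin_norm_bound (fun i => ucls (z i) : ultrapower X).
have /choice[C CP] : forall i, exists C : R, forall n, rnorm (z i n) <= C.
  by move=> i; exact: bddseq_bounded.
pose B2 := \sum_(i < m) `|C i|.
have zB2 n i : rnorm (z i n) <= B2.
  apply: le_trans (CP i n) _; apply: le_trans (ler_norm _) _.
  by rewrite /B2 (bigD1 i) //= lerDl sumr_ge0.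
have h : (fun n => `|D n b| + (B2 + B1) * l1 (fun i => a n i - b i)) @ U --> (0 : R).
  rewrite -[X in _ --> X]addr0; apply: cvgD.
    apply/norm_cvg0P; rewrite /D; apply/ucvg_dist0; exact: ucls_lincomb_cvg.
  by rewrite -[X in _ --> X](mulr0 (B2 + B1)); apply: cvgMl_tmp.
suff : d <= 0 by rewrite leNgt d0.
apply: (ucvg_le (cvg_cst _) h); apply: filterS UC => n /= nA.
apply: le_trans (ltW ((aP n).2 nA)) _.
have -> : D n (a n) = D n b +
    ((rnorm (\sum_(i < m) a n i *: z i n) - rnorm (\sum_(i < m) b i *: z i n)) -
     (rnorm (\sum_(i < m) a n i *: (ucls (z i) : ultrapower X)) -
      rnorm (\sum_(i < m) b i *: (ucls (z i) : ultrapower X)))).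
  by rewrite /D; ring.
apply: le_trans (ler_normD _ _) _; rewrite lerD2l mulrDl.
apply: le_trans (ler_normB _ _) _; apply: lerD.
  by apply: le_trans (rnorm_dist _ _) _; rewrite lincombB; exact: rnorm_lincomb_le.
by apply: le_trans (rnorm_dist _ _) _; rewrite lincombB; exact: rnorm_lincomb_le.
Qed.

Lemma ultrapower_finitely_representable : finitely_representable (ultrapower X) X.
Proof.
move=> eps m y eps0.
have [k [z [zi zP]]] := lin_indep_reduction y.
have [c c0 cP] := lin_indep_bound zi.
(* The solution of (1 + eta) / (1 - eta) = 1 + eps. The map sends a vector to the [n]-th coordinate
   of its representatives, which distorts norms by factors within 1 - eta and 1 + eta; dividing by 1
   - eta makes the lower bound exact. *)
pose eta := eps / (2 + eps).
have eta0 : 0 < eta by rewrite divr_gt0 // addr_gt0.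
have eta1 : eta < 1 by rewrite ltr_pdivrMr ?addr_gt0 // mul1r ltrDr.
have ceta0 : 0 < c * eta by rewrite mulr_gt0.
have [n nP] := filter_ex (ucls_lincomb_uniform (fun i => urep (z i)) ceta0).
have {}nP a : `|rnorm (\sum_(i < k) a i *: urep (z i) n) -
    rnorm (\sum_(i < k) a i *: z i)| <= eta * rnorm (\sum_(i < k) a i *: z i).
  have -> : \sum_(i < k) a i *: z i = \sum_(i < k) a i *: (ucls (urep (z i)) : ultrapower X).
    by apply: eq_bigr => i _; rewrite urepK.
  apply: le_trans (nP a) _; rewrite (mulrC c) -mulrA; apply: ler_wpM2l; first exact: ltW.
  by apply: le_trans (cP a) _; under [X in _ <= rnorm X]eq_bigr do rewrite urepK.
have /choice[co coP] : forall u : ultrapower X, exists a : 'I_k -> K R s,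
    lin_span y u -> u = \sum_(i < k) a i *: z i.
  move=> u; have [[a ua]|nu] := pselect (lin_span y u); last by exists (fun=> 0).
  by have [b bP] := zP a; exists b; rewrite ua bP.
have coE a u : lin_span y u -> u = \sum_(i < k) a i *: z i -> co u = a.
  move=> yu ua; apply/funext => i; apply/eqP; rewrite -subr_eq0; apply/eqP.
  apply: (zi (fun i => co u i - a i)).
  by rewrite -lincombB -ua -coP // subrr.
have spanL a u v : lin_span y u -> lin_span y v -> lin_span y (a *: u + v).
  move=> [b ->] [d ->]; exists (fun i => a * b i + d i).
  rewrite -lincombZ -big_split; by apply: eq_bigr => i _; rewrite scalerDl.
pose r := (1 - eta)^-1.
have r0 : 0 < r by rewrite invr_gt0 subr_gt0.
exists (fun u => inK s r *: \sum_(i < k) co u i *: urep (z i) n); split.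
  move=> a u v yu yv; rewrite (coE (fun i => a * co u i + co v i)).
  - under eq_bigr do rewrite scalerDl.
    rewrite big_split /= lincombZ scalerDr !scalerA; congr (_ *: _ + _); exact: mulrC.
  - exact: spanL.
  - under eq_bigr do rewrite scalerDl.
    by rewrite big_split /= lincombZ -!coP.
move=> u yu; rewrite rnormZ_inK gtr0_norm //.
have := nP (co u); rewrite -coP // ler_norml.
set N := rnorm (\sum_(i < k) _); set M := rnorm u => /andP[h1 h2].
rewrite mulrC ler_pdivlMr ?subr_gt0 // ler_pdivrMr ?subr_gt0 //; apply/andP; split.
  by move: h1; lra.
have e : eta * (2 + eps) = eps by rewrite divfK // gt_eqF // addr_gt0.
have M0 : 0 <= M by exact: rnorm_ge0.
have : (1 + eps) * M * (1 - eta) = (1 + eta) * M.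
  by have -> : (1 + eps) * M * (1 - eta) = (1 + eps - eta * (2 + eps) + eta) * M; [ring|rewrite e; ring].
by move=> ->; move: h2; lra.
Qed.

End FiniteDimension.

(** * Duality *)

Section Duality.
Context {R : realType} {s : scalars}.
Implicit Types Y : completeNormedModType (K R s).

Lemma dual_of_bound Y (F : Y -> K R s) (b : R) :
  (forall a u v, F (a *: u + v) = a * F u + F v) ->
  (forall u, rabs (F u) <= b * rnorm u) -> dual F.
Proof.
move=> Fl Fb; split; first exact: Fl.
have F0 : F 0 = 0 by have := Fl (-1) 0 0; rewrite scaler0 addr0 mulN1r addNr.
have FB u v : F u - F v = F (u - v)
  by rewrite (_ : u - v = (-1) *: v + u) ?Fl ?mulN1r 1?addrC // scaleN1r addrC.
move=> x; apply/(@cvgrPdist_lt _ _ _ (nbhs x)) => e e0.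
have eE : e = inK s (rabs e) by rewrite -norm_inK gtr0_norm.
have re0 : 0 < rabs e by rewrite -(inK_lt (s := s)) inK0 -eE.
pose b' := `|b| + 1.
have b'0 : 0 < b' by rewrite ltr_wpDl.
have d0 : 0 < inK s (rabs e / b') by rewrite -(inK0 (s := s)) inK_lt divr_gt0.
near=> z.
rewrite norm_inK eE inK_lt FB; apply: le_lt_trans (Fb _) _.
have h : rnorm (x - z) < rabs e / b'.
  by rewrite -(inK_lt (s := s)) -normE; near: z; apply: (@cvgr_dist_lt _ _ _ (nbhs x) _ id).
apply: (@le_lt_trans _ _ (b' * rnorm (x - z))).
  apply: ler_wpM2r; first exact: rnorm_ge0.
  by apply: le_trans (ler_norm b) _; rewrite lerDl.
by rewrite mulrC -ltr_pdivlMr.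
Unshelve. all: by end_near. Qed.

Lemma dual_bound Y (F : Y -> K R s) : dual F ->
  exists2 b : R, 0 < b & forall u, rabs (F u) <= b * rnorm u.
Proof.
move=> [Fl Fc].
have F0 : F 0 = 0.
  by have := Fl (-1) 0 0; rewrite scaler0 addr0 scaleN1r addNr.
have FZ a u : F (a *: u) = a * F u by have := Fl a u 0; rewrite addr0 F0 addr0.
have /cvgrPdist_lt /(_ 1 ltr01) := Fc 0.
rewrite F0 => /nbhs_norm0P[e /= e0 eP].
have eE : e = inK s (rabs e) by rewrite -norm_inK gtr0_norm.
have re0 : 0 < rabs e by rewrite -(inK_lt (s := s)) inK0 -eE.
exists (2 / rabs e) => [|u]; first by rewrite divr_gt0.
have [->|u0] := eqVneq u 0; first by rewrite F0 rabs0 rnorm0 mulr0.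
have nu0 : 0 < rnorm u by rewrite lt_neqAle eq_sym rnorm_eq0 u0 rnorm_ge0.
have := eP (inK s (rabs e / 2 / rnorm u) *: u).
rewrite /= normE rnormZ_inK ger0_norm ?divr_ge0 ?rnorm_ge0 ?rabs_ge0 //.
rewrite divfK ?gt_eqF // eE inK_lt rabs_inK ger0_norm ?rabs_ge0 //.
have -> : rabs e / 2 < rabs e by lra.
move=> /(_ isT); rewrite sub0r normrN FZ norm_inK -(inK1 (s := s)) inK_lt.
rewrite rabsM rabs_inK ger0_norm ?divr_ge0 ?rnorm_ge0 ?rabs_ge0 // => h.
rewrite mulrAC ler_pdivlMr // -ler_pdivrMl //.
apply: ltW; rewrite -(ltr_pM2r (x := (rnorm u)^-1)) ?invr_gt0 //.
by rewrite (_ : _ / rnorm u = rabs e / 2 / rnorm u * rabs (F u)) ?mulfV ?gt_eqF //; field; rewrite gt_eqF.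
Qed.

Lemma dual_norm_ge Y (F : Y -> K R s) u : dual F -> rnorm u <= 1 ->
  rabs (F u) <= dual_norm F.
Proof.
move=> /dual_bound[b b0 bP] u1; apply: ub_le_sup; last by exists u.
exists b => _ [v /= v1 <-]; apply: le_trans (bP v) _.
by rewrite -[X in _ <= X]mulr1 ler_wpM2l // ltW.
Qed.

Lemma dual_norm_le Y (F : Y -> K R s) (b : R) : (forall u, rabs (F u) <= b * rnorm u) ->
  0 <= b -> dual_norm F <= b.
Proof.
move=> Fb b0; apply: ge_sup; first by exists (rabs (F 0)), 0; rewrite /= ?rnorm0.
move=> _ [u /= u1 <-]; apply: le_trans (Fb u) _.
by rewrite -[X in _ <= X]mulr1 ler_wpM2l.
Qed.

Lemma rnorm_sublinear Y : sublinear (s := s) (fun u : Y => rnorm u).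
Proof.
split=> [u v|r u r0]; first exact: rnormD.
by rewrite rnormZ_inK gtr0_norm.
Qed.

(** The estimate for [f] is one on the real part of [F]; multiplying the argument by the phase of
    [F u] makes the value real and upgrades it to the modulus. *)
Lemma dual_of_real_linear Y (f : Y -> R) (b : R) : real_linear (s := s) f ->
  (forall u, f u <= b * rnorm u) ->
  exists F : Y -> K R s, [/\ dual F, forall u, rabs (F u) <= b * rnorm u &
    forall u, real_part (F u) = f u].
Proof.
move=> fL fb; have [F [Fl FE]] := complexify fL; exists F.
have FB u : rabs (F u) <= b * rnorm u.
  have [c c1 cE] := rabs_phase (F u).
  have F0 : F 0 = 0 by have := Fl (-1) 0 0; rewrite scaler0 addr0 mulN1r addNr.
  have FZ : F (c *: u) = c * F u by have := Fl c u 0; rewrite addr0 F0 addr0.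
  by rewrite -(inKK (s := s) (rabs _)) -cE -FZ FE -[rnorm u]mul1r -c1 -rnormZ.
by split=> //; exact: dual_of_bound Fl FB.
Qed.

Lemma norming_functional Y (x : Y) : exists F : Y -> K R s,
  [/\ dual F, forall u, rabs (F u) <= rnorm u & real_part (F x) = rnorm x].
Proof.
pose C : set (Y * R) := [set (inK s r *: x, r * rnorm x) | r in [set r | 0 <= r]].
have CP : cone_below (s := s) (fun u : Y => rnorm u) C.
  split.
  - by exists 0; rewrite /= ?inK0 ?scale0r ?mul0r.
  - move=> _ _ [a a0 <-] [b b0 <-]; exists (a + b); first exact: addr_ge0.
    by rewrite /= inKD scalerDl mulrDl.
  - move=> r _ r0 [a a0 <-]; exists (r * a); first by rewrite /= mulr_ge0 // ltW.
    by rewrite /= inKM scalerA mulrA.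
  - by move=> _ [a a0 <-] /=; rewrite rnormZ_inK ger0_norm.
have [f [fL fle fC]] := separate (rnorm_sublinear Y) CP.
have [|F [Fd Fb FE]] := dual_of_real_linear (b := 1) fL; first by move=> u; rewrite mul1r.
exists F; split=> // [u|]; first by have := Fb u; rewrite mul1r.
apply/le_anti; rewrite FE fle /=.
have Cx : C (x, rnorm x) by exists 1; rewrite /= ?inK1 ?scale1r ?mul1r.
exact: fC Cx.
Qed.

End Duality.

(** * Gaps between convex hulls *)

Section ConvexGap.
Context {R : realType} {s : scalars}.
Implicit Types X Y : completeNormedModType (K R s).
Local Notation U := free_ultra.

(* A list of indices stands for the convex combination in
   which every index weighs its multiplicity divided by the length. *)
Definition gap_on X (th : R) (N Q : nat) (y : nat -> X) :=
  (forall i, rnorm (y i) <= 1) /\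
  forall l (r1 r2 : seq nat), size r1 = Q -> size r2 = Q ->
    all (fun i => (i < l)%N) r1 -> all (fun i => (l <= i < N)%N) r2 ->
    th * Q%:R <= rnorm (\sum_(i <- r1) y i - \sum_(i <- r2) y i).

Definition convex_gap X (th : R) := forall N Q, exists y : nat -> X, gap_on th N Q y.

Lemma sum_flatten_nseq (V : nmodType) (y : nat -> V) m r :
  \sum_(i <- flatten (nseq m r)) y i = (\sum_(i <- r) y i) *+ m.
Proof.
elim: m => [|m IH]; first by rewrite big_nil mulr0n.
by rewrite /= big_cat IH mulrS.
Qed.

Lemma size_flatten_nseq (T : Type) m (r : seq T) :
  size (flatten (nseq m r)) = (m * size r)%N.
Proof. by elim: m => //= m IH; rewrite size_cat IH mulSn. Qed.

Lemma all_flatten_nseq (T : Type) (P : pred T) m r :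
  all P r -> all P (flatten (nseq m r)).
Proof. by move=> Pr; elim: m => //= m IH; rewrite all_cat Pr. Qed.

(** The [n]-th coordinate is a system for [N = n] and [Q = n!]. Every positive size [q <= n] divides
    n!, so lists of size [q] are repeated n!/q times and the inequality is divided by that
    number. *)
Lemma gap_ultrapower X (th : R) : convex_gap X th ->
  exists y : nat -> ultrapower X, (forall i, rnorm (y i) <= 1) /\
    forall l (r1 r2 : seq nat), size r1 = size r2 ->
    all (fun i => (i < l)%N) r1 -> all (leq l) r2 ->
    th * (size r1)%:R <= rnorm (\sum_(i <- r1) y i - \sum_(i <- r2) y i).
Proof.
move=> gX; have /choice[x xP] : forall n, exists y : nat -> X, gap_on th n n`! y.
  by move=> n; exact: gX.
have xb i : exists B : R, forall n, rnorm (x n i) <= B.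
  by exists 1 => n; case: (xP n) => h _; exact: h.
pose y i := BddSeq (xb i).
exists (fun i => ucls (y i)); split=> [i|l r1 r2 r12 a1 a2].
  rewrite rnorm_ucls; apply: (ucvg_le (@bddseq_normP _ _ _ (y i)) (cvg_cst (1 : R))).
  by apply: filterS filterT => n _ /=; case: (xP n) => h _; exact: h.
have sumE r : \sum_(i <- r) (ucls (y i) : ultrapower X) =
    ucls (\big[bddseq_add/bddseq_zero]_(i <- r) y i).
  elim: r => [|i r IH]; first by rewrite !big_nil.
  by rewrite !big_cons IH [LHS]uaddE.
have sumEn r n : (\big[bddseq_add/bddseq_zero]_(i <- r) y i : bddseq) n = \sum_(i <- r) x n i.
  elim: r => [|i r IH]; first by rewrite !big_nil.
  by rewrite !big_cons /= IH.
rewrite !sumE; apply: (ucvg_le (cvg_cst _) (@uclsB_cvg _ _ _ _ _)).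
case: (posnP (size r1)) => [->|q0].
  by apply: filterS filterT => n _ /=; rewrite mulr0 rnorm_ge0.
pose N := maxn (size r1) (\max_(i <- r2) i.+1).
apply: filterS (free_ultra_ge N) => n /=; rewrite geq_max => /andP[qn r2n].
rewrite !sumEn; have [_ /(_ l)] := xP n.
have /dvdnP[m mE] : (size r1 %| n`!)%N by rewrite dvdn_fact // q0.
have m0 : (0 < m)%N by case: m mE => //; rewrite mul0n => /eqP; rewrite eqn0Ngt fact_gt0.
move=> /(_ (flatten (nseq m r1)) (flatten (nseq m r2))).
rewrite !size_flatten_nseq -r12 -mE => /(_ erefl erefl).
move=> /(_ (all_flatten_nseq _ a1)) h.
have {}a2 : all (fun i => (l <= i < n)%N) r2.
  apply/allP => i ir; rewrite (allP a2) //=; apply: leq_trans r2n.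
  exact: (@leq_bigmax_seq _ _ xpredT (fun i => i.+1) i ir isT).
move: (h (all_flatten_nseq _ a2)).
by rewrite !sum_flatten_nseq -mulrnBl rnormMn mE natrM mulrCA ler_pM2l // ltr0n.
Qed.

(** A coefficient [c] becomes [trunc (Q * c)] copies of its index. Each of the [size r] terms then
    loses at most 1 in total mass and at most [B] in norm. *)
Lemma multiset_rounding Y (w : nat -> Y) (B : R) (P : pred nat) (Q : nat)
    (r : seq (R * nat)) :
  (forall i, rnorm (w i) <= B) -> all (fun p => (0 <= p.1) && P p.2) r ->
  exists r' : seq nat, [/\ all P r',
    Q%:R * \sum_(p <- r) p.1 <= (size r')%:R + (size r)%:R &
    rnorm (\sum_(i <- r') w i - Q%:R *: \sum_(p <- r) inK s p.1 *: w p.2) <= (size r)%:R * B].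
Proof.
move=> wB; elim: r => [_|[c i] r IH /= /andP[/andP[c0 Pi] /IH[r' [Pr' r'1 r'2]]]].
  by exists [::]; rewrite !big_nil mulr0 scaler0 subr0 rnorm0 mul0r addr0.
have B0 : 0 <= B by apply: le_trans (wB 0%N); exact: rnorm_ge0.
pose a := Num.trunc (Q%:R * c).
have /andP[a1 a2] : a%:R <= Q%:R * c < a.+1%:R by rewrite truncn_itv // mulr_ge0.
exists (nseq a i ++ r'); split.
- by rewrite all_cat all_nseq Pi orbT.
- rewrite big_cons /= size_cat size_nseq mulrDr natrD -(natr1 (size r)).
  rewrite addrACA; move: a2; rewrite -natr1; move: r'1; lra.
- rewrite big_cat big_cons scalerDr opprD addrACA /= -(natr1 (size r)) addrC mulrDl mul1r.
  apply: le_trans (rnormD _ _) _; apply: lerD => //.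
  have -> : \sum_(j <- nseq a i) w j = a%:R *: w i.
    by rewrite big_nseq scaler_nat iter_addr_0.
  rewrite -(inK_nat (s := s) a) -(inK_nat (s := s) Q) scalerA -inKM -scalerBl -inKB.
  rewrite rnormZ_inK -[B]mul1r; apply: ler_pM => //; first exact: rnorm_ge0.
  rewrite ler_norml; move: a2; rewrite -natr1; lra.
Qed.

(** The ultralimit of the evaluations at [y n] is a bidual functional. If a vector [x] represented
    it, [x] would be a weak limit of [y], hence by Mazur close to averages of every tail: two
    averages with successive supports would both be near [x], against the gap. *)
Lemma not_reflexive_of_gap Y (th : R) (y : nat -> Y) : 0 < th ->
  (forall i, rnorm (y i) <= 1) ->
  (forall l (r1 r2 : seq nat), size r1 = size r2 ->
    all (fun i => (i < l)%N) r1 -> all (leq l) r2 ->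
    th * (size r1)%:R <= rnorm (\sum_(i <- r1) y i - \sum_(i <- r2) y i)) ->
  ~ reflexive_space Y.
Proof.
move=> th0 y1 gap Yrefl.
have limP (f : Y -> K R s) : exists l, dual f -> kcvg (U := U) (fun n => f (y n)) l.
  have [fd|] := pselect (dual f); last by move=> nf; exists 0 => fd; case: nf.
  have [l ll] := @kcvg_ex R s U _ (fun n => f (y n)) (dual_norm f)
    (fun n => dual_norm_ge fd (y1 n)).
  by exists l.
have [phi phiP] := choice limP.
have phid : bidual (X := Y) phi.
  split=> [a f g fd gd|]; last first.
    exists 1 => f fd; rewrite mul1r; apply: (kcvg_rabs_le (phiP f fd)) => n.
    exact: dual_norm_ge.
  have fgd : dual (fun x : Y => a * f x + g x).
    have [b b0 fb] := dual_bound fd; have [c c0 gc] := dual_bound gd.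
    apply: (@dual_of_bound _ _ _ _ (rabs a * b + c)) => [k u v|u].
      by rewrite fd.1 gd.1 /GRing.scale /=; ring.
    apply: le_trans (rabsD _ _) _; rewrite rabsM mulrDl -mulrA; apply: lerD => //.
    by rewrite ler_wpM2l ?rabs_ge0.
  by apply: (kcvg_unique (phiP _ fgd)); apply: kcvg_lin; exact: phiP.
have [x xP] := Yrefl phi phid.
(* Mazur's theorem by contradiction. If all averages of indices from [l] on stay at distance [e]
   from [x], the combinations of the [y i - x] with demand [e] times their mass form a cone below
   the norm. Separation gives a functional whose real part at [y n] exceeds that at [x] by [e] for
   all [n >= l], which contradicts weak convergence. *)
have tail l (e : R) : 0 < e -> exists r : seq nat, [/\ all (leq l) r, (0 < size r)%N &
    rnorm (\sum_(i <- r) (y i - x)) < e * (size r)%:R].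
  move=> e0; apply: contrapT => nr.
  have far (r : seq nat) : all (leq l) r -> e * (size r)%:R <= rnorm (\sum_(i <- r) (y i - x)).
    move=> rl; case: (posnP (size r)) => [->|r0]; first by rewrite mulr0 rnorm_ge0.
    by rewrite leNgt; apply/negP => h; apply: nr; exists r.
  pose good (r : seq (R * nat)) := all (fun p => (0 <= p.1) && (l <= p.2)%N) r.
  pose C : set (Y * R) := [set
    (\sum_(p <- r) inK s p.1 *: (y p.2 - x), e * \sum_(p <- r) p.1) | r in [set r | good r]].
  have CP : cone_below (s := s) (fun u : Y => rnorm u) C.
    split.
    - by exists [::]; rewrite /= ?big_nil ?mulr0.
    - move=> _ _ [r1 g1 <-] [r2 g2 <-]; exists (r1 ++ r2) => /=.
        by rewrite /good all_cat; apply/andP.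
      by rewrite !big_cat mulrDr.
    - move=> k _ k0 [r g <-]; exists [seq (k * p.1, p.2) | p <- r] => /=.
        rewrite /good all_map; apply: sub_all g => p /= /andP[p0 ->].
        by rewrite andbT mulr_ge0 // ltW.
      rewrite !big_map /= scaler_sumr; congr (_, _).
        by apply: eq_bigr => p _; rewrite inKM scalerA.
      by rewrite -mulr_sumr mulrCA.
    - move=> _ [r g <-] /=; apply/ler_addgt0Pr => d d0.
      pose B := 1 + rnorm x.
      have yB i : rnorm (y i - x) <= B.
        by apply: le_trans (rnormB _ _) _; rewrite lerD2r.
      have B0 : 0 <= B by apply: le_trans (yB 0%N); exact: rnorm_ge0.
      pose m : R := (size r)%:R.
      (* Rounding costs [m * B] in norm and [m] in mass, the latter weighted by [e]; after division
         by [Q] the total is at most [d]. *)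
      pose Q := (Num.trunc (m * (e + B) / d)).+1.
      have Q0 : (0 : R) < Q%:R by rewrite ltr0n.
      have QP : m * (e + B) <= d * Q%:R.
        by rewrite -ler_pdivrMl // mulrC ltW // truncnS_gt.
      have [r' [r'l r'1 r'2]] := multiset_rounding Q yB g.
      have := far r' r'l; set T := \sum_(p <- r) _ *: _ in r'2 *.
      set T' := \sum_(i <- r') _ in r'2 *; move=> h.
      have h2 : rnorm T' <= Q%:R * rnorm T + m * B.
        rewrite -(subrK (Q%:R *: T) T') addrC; apply: le_trans (rnormD _ _) _.
        by rewrite rnormZ_nat lerD2l.
      rewrite -(ler_pM2l Q0); move/(ler_wpM2l (ltW e0)): r'1 => r'1.
      move: QP h h2 r'1; rewrite /m; lra.
  have [f [fL fle fC]] := separate (rnorm_sublinear Y) CP.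
  have [|F [Fd Fb FE]] := dual_of_real_linear (b := 1) fL; first by move=> u; rewrite mul1r.
  have FB u v : F u - F v = F (u - v).
    by rewrite (_ : u - v = (-1) *: v + u) ?Fd.1 ?scaleN1r 1?addrC // scaleN1r addrC.
  have h := phiP F Fd; rewrite (xP F Fd) in h.
  suff : real_part (F x) + e <= real_part (F x) by rewrite gerDl leNgt e0.
  apply: (kcvg_real_part_ge h); apply: filterS (free_ultra_ge l) => n /= ln.
  have e2 : real_part (F (y n)) - real_part (F x) = f (y n - x) by rewrite -FE -FB raddfB.
  rewrite -lerBrDl e2.
  have Cn : C (y n - x, e).
    exists [:: (1, n)]; first by rewrite /= /good /= ler01 ln.
    by rewrite !big_seq1 inK1 scale1r mulr1.
  exact: fC Cn.
(* Two averages within [th / 3] of [x] are at distance less than [th] from each other. The second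
   list starts after all indices of the first, and repetition gives both the same size. *)
have th3 : 0 < th / 3 by rewrite divr_gt0.
have [r1 [_ r10 h1]] := tail 0%N _ th3.
pose l := \max_(i <- r1) i.+1.
have [r2 [r2l r20 h2]] := tail l _ th3.
have r1l : all (fun i => (i < l)%N) r1.
  by apply/allP => i ir; exact: (@leq_bigmax_seq _ _ xpredT (fun i => i.+1) i ir isT).
have := gap l (flatten (nseq (size r2) r1)) (flatten (nseq (size r1) r2)).
rewrite !size_flatten_nseq mulnC => /(_ erefl (all_flatten_nseq _ r1l) (all_flatten_nseq _ r2l)).
rewrite !sum_flatten_nseq => h.
have sumE r : \sum_(i <- r) (y i - x) = \sum_(i <- r) y i - x *+ size r.
  by rewrite sumrB big_const_seq count_predT iter_addr_0.
rewrite sumE in h1; rewrite sumE in h2; move: h.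
set S1 := \sum_(i <- r1) y i in h1 *; set S2 := \sum_(i <- r2) y i in h2 *.
set n1 := size r1 in r10 h1 *; set n2 := size r2 in r20 h2 *.
have -> : S1 *+ n2 - S2 *+ n1 = (S1 - x *+ n1) *+ n2 - (S2 - x *+ n2) *+ n1.
  by rewrite !mulrnBl -!mulrnA mulnC opprB addrA subrK.
have n1R : 0 < n1%:R :> R by rewrite ltr0n.
have n2R : 0 < n2%:R :> R by rewrite ltr0n.
move=> h; have := le_trans h (rnormB _ _).
rewrite !rnormMn natrM.
move: h1 h2; set u := rnorm _; set v := rnorm _ => h1 h2.
have {}h1 : n2%:R * u < n2%:R * (th / 3 * n1%:R) by rewrite ltr_pM2l.
have {}h2 : n1%:R * v < n1%:R * (th / 3 * n2%:R) by rewrite ltr_pM2l.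
have : 0 < th * (n1%:R * n2%:R) by rewrite !mulr_gt0.
move: h1 h2; lra.
Qed.

Lemma not_superreflexive_of_gap X (th : R) : 0 < th -> convex_gap X th -> ~ superreflexive X.
Proof.
move=> th0 /gap_ultrapower[y [y1 yP]] Xs.
apply: (not_reflexive_of_gap th0 y1 yP).
by apply: Xs; exact: ultrapower_finitely_representable.
Qed.

End ConvexGap.

(** * Walsh-Paley martingales *)

Section ConditionalExpectation.
Context {R : realType} {s : scalars} {X : normedModType (K R s)}.

(** Sums instead of means: the factor [#|T|] cancels in comparisons on the same space. *)
Definition sqnorm (T : finType) (H : T -> X) : R := \sum_w rnorm (H w) ^+ 2.

Lemma sqnorm_ge0 (T : finType) (H : T -> X) : 0 <= sqnorm H.
Proof. by apply: sumr_ge0 => w _; exact: sqr_ge0. Qed.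

Lemma sqr_rnormD (x y : X) : rnorm (x + y) ^+ 2 <= 2 * rnorm x ^+ 2 + 2 * rnorm y ^+ 2.
Proof.
apply: (@le_trans _ _ ((rnorm x + rnorm y) ^+ 2)).
  by rewrite lerXn2r ?nnegrE ?addr_ge0 ?rnorm_ge0 // rnormD.
by have := sqr_ge0 (rnorm x - rnorm y); rewrite sqrrB sqrrD; lra.
Qed.

Lemma sqnormD (T : finType) (H G : T -> X) :
  sqnorm (fun w => H w + G w) <= 2 * sqnorm H + 2 * sqnorm G.
Proof.
rewrite /sqnorm !mulr_sumr -big_split; apply: ler_sum => w _; exact: sqr_rnormD.
Qed.

Lemma sqnormB (T : finType) (H G : T -> X) :
  sqnorm (fun w => H w - G w) <= 2 * sqnorm H + 2 * sqnorm G.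
Proof.
apply: le_trans (sqnormD _ _) _; rewrite lerD2l /sqnorm.
by under eq_bigr do rewrite rnormN.
Qed.

Variables (n : nat).
Implicit Types (w u v : Omega n) (H G r Z : Omega n -> X).

(** Its classes are the atoms of the [j]-th sigma-algebra, through which measurability and
    conditional expectations are handled. *)
Definition agree (j : nat) : rel (Omega n) :=
  fun w u => [forall i : 'I_n, (i < j)%N ==> (w i == u i)].

Lemma agreeP j w u : reflect (forall i : 'I_n, (i < j)%N -> w i = u i) (agree j w u).
Proof.
apply: (iffP forallP) => h i; first by move=> ij; have := h i; rewrite ij => /eqP.
by apply/implyP => ij; apply/eqP; exact: h.
Qed.

Lemma agree_refl j w : agree j w w.
Proof. exact/agreeP. Qed.

Lemma agree_sym j w u : agree j w u = agree j u w.
Proof. by apply/agreeP/agreeP => h i ij; rewrite h. Qed.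

Lemma agree_trans j u w v : agree j w u -> agree j u v -> agree j w v.
Proof. by move=> /agreeP h /agreeP k; apply/agreeP => i ij; rewrite h // k. Qed.

Lemma agree_le j k w u : (j <= k)%N -> agree k w u -> agree j w u.
Proof. by move=> jk /agreeP h; apply/agreeP => i ij; apply: h; exact: leq_trans jk. Qed.

Definition adapted (j : nat) (T : Type) (Z : Omega n -> T) :=
  forall w u, agree j w u -> Z w = Z u.

Lemma adapted_le j k T (Z : Omega n -> T) : (j <= k)%N -> adapted j Z -> adapted k Z.
Proof. by move=> jk Zj w u wu; apply: Zj; exact: agree_le wu. Qed.

(** [r] is the conditional expectation of [H] with respect to the first [j] coordinates. As a
    relation with equal sums over atoms it avoids dividing by the size of an atom in [X]. *)
Definition condexp (j : nat) H r :=
  adapted j r /\ forall w, \sum_(u | agree j w u) H u = \sum_(u | agree j w u) r u.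

Lemma condexp_adapted j Z : adapted j Z -> condexp j Z Z.
Proof. by split. Qed.

Lemma condexpD j H G r q : condexp j H r -> condexp j G q ->
  condexp j (fun w => H w + G w) (fun w => r w + q w).
Proof.
move=> [ra Hr] [qa Gq]; split=> [w u wu|w]; first by rewrite (ra _ _ wu) (qa _ _ wu).
by rewrite !big_split /= Hr Gq.
Qed.

Lemma condexpN j H r : condexp j H r -> condexp j (fun w => - H w) (fun w => - r w).
Proof.
move=> [ra Hr]; split=> [w u wu|w]; first by rewrite (ra _ _ wu).
by rewrite !sumrN Hr.
Qed.

Lemma condexpB j H G r q : condexp j H r -> condexp j G q ->
  condexp j (fun w => H w - G w) (fun w => r w - q w).
Proof. by move=> Hr Gq; apply: condexpD => //; exact: condexpN. Qed.

Lemma condexp_sum j (I : eqType) (t : seq I) (F G : I -> Omega n -> X) :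
  (forall i, i \in t -> condexp j (F i) (G i)) ->
  condexp j (fun w => \sum_(i <- t) F i w) (fun w => \sum_(i <- t) G i w).
Proof.
elim: t => [_|i t IH FG].
  split=> [w u _|w]; first by rewrite !big_nil.
  by apply: eq_bigr => u _; rewrite !big_nil.
have [|ha hs] := condexpD (FG i (mem_head _ _)) (IH _).
  by move=> k kt; apply: FG; rewrite inE kt orbT.
split=> [w u wu|w]; first by rewrite !big_cons; exact: ha.
by under eq_bigr do rewrite big_cons; under [RHS]eq_bigr do rewrite big_cons; exact: hs.
Qed.

(** On an atom [r] is constant, and its norm times the size of the atom is the norm of the sum of
    [H], hence at most the sum of the norms of [H]. Multiply by the norm of [r] and sum over the
    atoms. *)
Lemma condexp_cross j H r : condexp j H r ->
  sqnorm r <= \sum_w rnorm (H w) * rnorm (r w).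
Proof.
move=> [ra Hr]; pose c w : R := #|[pred u | agree j w u]|%:R.
have c0 w : 0 < c w.
  by rewrite /c ltr0n; apply/card_gt0P; exists w; rewrite inE agree_refl.
have ca w u : agree j w u -> c w = c u.
  move=> wu; congr _%:R; apply: eq_card => v; rewrite !inE.
  apply/idP/idP; apply: agree_trans => //; by rewrite agree_sym.
have e w : rnorm (r w) ^+ 2 <= \sum_(u | agree j w u) (c w)^-1 * (rnorm (r w) * rnorm (H u)).
  rewrite -mulr_sumr -mulr_sumr ler_pdivlMl // expr2 mulrCA; apply: ler_wpM2l; first exact: rnorm_ge0.
  rewrite /c -rnormMn; apply: le_trans (rnorm_sum _ _ _); rewrite Hr.
  under [X in _ <= rnorm X]eq_bigr => u wu do rewrite -(ra _ _ wu).
  by rewrite sumr_const.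
apply: (le_trans (ler_sum _ (fun w _ => e w))).
rewrite (exchange_big_dep predT) //=; apply: ler_sum => u _.
have -> : \sum_(w | agree j w u) (c w)^-1 * (rnorm (r w) * rnorm (H u)) =
    \sum_(w | agree j w u) (c u)^-1 * (rnorm (r u) * rnorm (H u)).
  by apply: eq_bigr => w wu; rewrite (ca _ _ wu) (ra _ _ wu).
rewrite sumr_const (eq_card (B := [pred v | agree j u v])); last first.
  by move=> v; rewrite !inE agree_sym.
by rewrite -mulr_natl -/(c u) mulrA mulfV ?gt_eqF // mul1r mulrC.
Qed.

(** A substitute for Pythagoras valid in every normed space, because it compares norms only: expand
    the square and bound the cross term by [condexp_cross]. *)
Lemma condexp_defect j H r : condexp j H r ->
  \sum_w (rnorm (H w) - rnorm (r w)) ^+ 2 <= sqnorm H - sqnorm r.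
Proof.
move=> /condexp_cross h.
have -> : \sum_w (rnorm (H w) - rnorm (r w)) ^+ 2 =
    sqnorm H - 2 * (\sum_w rnorm (H w) * rnorm (r w)) + sqnorm r.
  by rewrite /sqnorm mulr_sumr -sumrB -big_split; apply: eq_bigr => w _ /=; ring.
lra.
Qed.

Lemma condexp_le j H r : condexp j H r -> sqnorm r <= sqnorm H.
Proof.
move=> /condexp_defect h; rewrite -subr_ge0; apply: le_trans h.
by apply: sumr_ge0 => w _; exact: sqr_ge0.
Qed.

End ConditionalExpectation.

(** * The sets of the filtration are the unions of atoms *)

Section WalshFiltration.
Context {n : nat}.
Implicit Types (w u : Omega n) (A : set (Omega n)).

Lemma walsh_filtration_agree k A w u :
  walsh_filtration k A -> agree k w u -> A w -> A u.
Proof.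
have : walsh_filtration (n := n) k `<=` [set A | forall w u, agree k w u -> A w -> A u].
  apply: smallest_sub => [|_ [i [b [ik ->]]] v v' /agreeP vv' /= <-]; last by rewrite vv'.
  split=> [//|B hB v v' vv' [_ nB]|F hF v v' vv' [i _ Fi]].
    by split=> // Bv'; apply: nB; apply: hB Bv'; rewrite agree_sym.
  by exists i => //; exact: hF vv' Fi.
by move=> h /h; exact.
Qed.

Lemma walsh_filtration_closed k :
  [/\ walsh_filtration k (set0 : set (Omega n)),
      forall A, walsh_filtration k A -> walsh_filtration k (~` A) &
      forall F : nat -> set (Omega n), (forall i, walsh_filtration k (F i)) ->
        walsh_filtration k (\bigcup_i F i)].
Proof.
have [h0 hC hU] : sigma_algebra setT (walsh_filtration (n := n) k).
  exact: smallest_sigma_algebra.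
by split=> // A /hC; rewrite setTD.
Qed.

Lemma walsh_filtrationI k A B : walsh_filtration k A -> walsh_filtration k B ->
  walsh_filtration k (A `&` B).
Proof.
have [h0 hC hU] := walsh_filtration_closed k => hA hB.
rewrite -[A `&` B]setCK setCI; apply: (hC _ _).
have -> : ~` A `|` ~` B = \bigcup_i (if i == 0%N then ~` A else ~` B).
  apply/seteqP; split=> v /=; first by case=> hv; [exists 0%N|exists 1%N].
  by case=> i _; case: eqP; [left|right].
by apply: hU => i; case: eqP => _; exact: hC.
Qed.

Lemma walsh_filtration_cyl k w : walsh_filtration k [set u : Omega n | agree k w u].
Proof.
have [h0 hC hU] := walsh_filtration_closed k.
(* Induction on the number [m] of coordinates inspected; those of index at least [k] impose
   nothing. *)
suff h m : (m <= n)%N -> walsh_filtration k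
    [set u : Omega n | forall i : 'I_n, (i < m)%N -> (i < k)%N -> w i = u i].
  have := h n (leqnn n); congr walsh_filtration; apply/seteqP; split=> u /= hu.
    by apply/agreeP => i ik; apply: hu.
  by move=> i _ ik; move/agreeP : hu; apply.
elim: m => [_|m IH mn].
  have -> : [set u : Omega n | forall i : 'I_n, (i < 0)%N -> (i < k)%N -> w i = u i] = ~` set0.
    by apply/seteqP; split=> [u _ //|u _ i].
  exact: hC.
have [mk|km] := ltnP m k; last first.
  have := IH (ltnW mn); congr walsh_filtration; apply/seteqP; split=> u /= hu i.
    rewrite ltnS leq_eqVlt => /orP[/eqP->|]; last exact: hu.
    by rewrite ltnNge km.
  by move=> im; apply: hu; exact: ltnW.
have -> : [set u : Omega n | forall i : 'I_n, (i < m.+1)%N -> (i < k)%N -> w i = u i] =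
    [set u : Omega n | forall i : 'I_n, (i < m)%N -> (i < k)%N -> w i = u i] `&`
    [set u : Omega n | u (Ordinal mn) = w (Ordinal mn)].
  apply/seteqP; split=> u /= => [hu|[hu1 hu2] i].
    by split=> [i im|]; [apply: hu; exact: ltnW|rewrite hu].
  rewrite ltnS leq_eqVlt => /orP[/eqP im _|]; last exact: hu1.
  by have -> : i = Ordinal mn by exact/val_inj.
apply: walsh_filtrationI; first exact: IH (ltnW mn).
by apply: sub_sigma_algebra; exists (Ordinal mn), (w (Ordinal mn)).
Qed.

Lemma walsh_filtration_of_agree k A :
  (forall w u, agree k w u -> A w -> A u) -> walsh_filtration k A.
Proof.
move=> hA; have [h0 hC hU] := walsh_filtration_closed k.
pose F (o : option (Omega n)) :=
  [set u | exists2 w, o = Some w & A w /\ agree k w u].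
have Fk o : walsh_filtration k (F o).
  case: o => [w|]; last first.
    by rewrite (_ : F None = set0) //; apply/seteqP; split=> // u [].
  have [Aw|nAw] := pselect (A w).
    rewrite (_ : F (Some w) = [set u | agree k w u]); first exact: walsh_filtration_cyl.
    by apply/seteqP; split=> [u [_ [<-] []]//|u wu]; exists w.
  by rewrite (_ : F (Some w) = set0) //; apply/seteqP; split=> // u [_ [<-] []].
(* The finite union of cylinders is written as a sequence, as sigma-algebras require; numbers that
   code no path contribute the empty set. *)
have -> : A = \bigcup_i F (unpickle i); last by apply: hU => i; exact: Fk.
apply/seteqP; split=> [u Au|u [i _ [w _ [Aw wu]]]]; last exact: hA wu Aw.
by exists (pickle u) => //; exists u; [rewrite pickleK|split=> //; exact: agree_refl].
Qed.

End WalshFiltration.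

Section WalshPaley.
Context {R : realType} {s : scalars} {X : completeNormedModType (K R s)} {n : nat}.
Implicit Types M : nat -> Omega n -> X.

(** Points of [X] are closed, so measurability can be tested on the complement of the single value
    [M k w]. *)
Lemma walsh_paley_adapted M k : walsh_paley_martingale M -> (k <= n)%N -> adapted k (M k).
Proof.
move=> [Mm _] kn w u wu.
have Uo : open (~` [set M k w]).
  by apply: closed_openC; apply: accessible_closed_set1; apply: hausdorff_accessible; exact: norm_hausdorff.
apply: contrapT => h; have /= := walsh_filtration_agree (Mm k kn _ Uo) _ _ => /(_ u w).
by apply => //; [rewrite agree_sym|move=> e; apply: h].
Qed.

Lemma walsh_paley_condexp M j i : walsh_paley_martingale M ->
  (j <= i <= n)%N -> condexp j (M i) (M j).
Proof.
move=> Mwp /andP[ji ni]; split.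
  by apply: walsh_paley_adapted => //; exact: leq_trans ni.
move=> w; elim: i ji ni => [|i IH] ji ni.
  by move: ji; rewrite leqn0 => /eqP->.
move: ji; rewrite leq_eqVlt => /orP[/eqP-> //|ji].
rewrite -IH //; last exact: ltnW.
have := Mwp.2 i ni [set u | agree j w u].
have hA : walsh_filtration i [set u : Omega n | agree j w u].
  apply: walsh_filtration_of_agree => u v uv /= wu.
  by apply: agree_trans wu _; exact: agree_le uv.
have e u : (u \in [set u | agree j w u]) = agree j w u.
  by apply/idP/idP => [/set_mem|/mem_set].
by move=> /(_ hA); rewrite !(eq_bigl _ _ e).
Qed.

Lemma walsh_paleyP M :
  (forall k, (k <= n)%N -> adapted k (M k)) ->
  (forall k, (k < n)%N -> condexp k (M k.+1) (M k)) -> walsh_paley_martingale M.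
Proof.
move=> Ma Mc; split=> [k kn U _|k kn A kA].
  by apply: walsh_filtration_of_agree => w u wu /=; rewrite (Ma k kn w u wu).
pose c (w : Omega n) : R := #|[pred u | agree k w u]|%:R.
have c0 w : c w != 0.
  by rewrite /c pnatr_eq0 -lt0n; apply/card_gt0P; exists w; rewrite inE agree_refl.
have ca w u : agree k w u -> c w = c u.
  move=> wu; congr _%:R; apply: eq_card => v; rewrite !inE.
  by apply/idP/idP; apply: agree_trans => //; rewrite agree_sym.
have inA w u : agree k w u -> (w \in A) = (u \in A).
  move=> wu; apply/idP/idP => /set_mem h; apply/mem_set.
    exact: walsh_filtration_agree kA wu h.
  by apply: walsh_filtration_agree kA _ h; rewrite agree_sym.
(* Since [A] is a union of atoms, replacing [F] by its averages over atoms preserves the sum over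
   [A]; equality of the sums over atoms is then enough. *)
have key (F : Omega n -> X) :
    \sum_(w | w \in A) F w = \sum_(w | w \in A) inK s (c w)^-1 *: \sum_(u | agree k w u) F u.
  under [RHS]eq_bigr do rewrite scaler_sumr.
  rewrite (exchange_big_dep (fun u => u \in A)) /=; last first.
    by move=> w u wA wu; rewrite -(inA _ _ wu).
  apply: eq_bigr => u uA.
  rewrite (eq_bigr (fun=> inK s (c u)^-1 *: F u)); last first.
    by move=> w /andP[_ wu]; rewrite (ca _ _ wu).
  rewrite sumr_const (eq_card (B := [pred v | agree k u v])); last first.
    move=> v; rewrite unfold_in [RHS]unfold_in /=; apply/andP/idP => [[_ vu]|uv].
      by rewrite agree_sym.
    by rewrite -(inA _ _ uv) agree_sym.
  rewrite -scaler_nat scalerA -(inK_nat (s := s)) -inKM -/(c u) mulfV //.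
  by rewrite inK1 scale1r.
rewrite key [RHS]key; apply: eq_bigr => w _.
by rewrite (Mc k kn).2.
Qed.

(* The increment is the difference of [M k.+1 - Z] and its conditional expectation
   [M k - Z]. *)
Lemma sqnorm_increment M j k (Z : Omega n -> X) : walsh_paley_martingale M ->
  (j <= k < n)%N -> adapted j Z ->
  sqnorm (fun w => M k.+1 w - M k w) <= 4 * sqnorm (fun w => M k.+1 w - Z w).
Proof.
move=> Mwp /andP[jk kn] Zj.
have h : condexp k (fun w => M k.+1 w - Z w) (fun w => M k w - Z w).
  apply: condexpB; first by apply: walsh_paley_condexp => //; rewrite leqnSn.
  exact: condexp_adapted (adapted_le jk Zj).
have := condexp_le h.
have -> : sqnorm (fun w => M k.+1 w - M k w) =
    sqnorm (fun w => (M k.+1 w - Z w) - (M k w - Z w)).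
  by apply: eq_bigr => w _; rewrite opprB addrA subrK.
have := sqnormB (fun w => M k.+1 w - Z w) (fun w => M k w - Z w); lra.
Qed.

Lemma sqnorm_increment_le M k : walsh_paley_martingale M -> (k < n)%N ->
  sqnorm (fun w => M k.+1 w - M k w) <= 4 * sqnorm (M n).
Proof.
move=> Mwp kn.
have Z0 : adapted (n := n) 0 (fun=> 0 : X) by [].
have h : (0 <= k < n)%N by [].
apply: le_trans (sqnorm_increment Mwp h Z0) _; rewrite ler_pM2l //.
have -> : sqnorm (fun w => M k.+1 w - 0) = sqnorm (M k.+1).
  by apply: eq_bigr => w _; rewrite subr0.
by apply: condexp_le (walsh_paley_condexp Mwp _); rewrite kn leqnn.
Qed.

End WalshPaley.

(** * From martingales to gaps *)

Section TimeSelection.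
Context {R : realType}.
Variables (P m : nat) (B eta : R) (H : seq nat -> nat -> R).
Hypotheses (eta0 : 0 < eta) (PB : B < P%:R * eta).
Hypotheses (H0 : forall p t, 0 <= H p t)
  (HB : forall p t, (t < m)%N -> all (fun i => (i < t)%N) p -> H p t <= B).
Hypothesis Hmono : forall p t t', all (fun i => (i < t)%N) p ->
  (t <= t' < m)%N -> H p t <= H p t'.

(** [P] blocks, each long enough for the remaining selection, and one more place so that the right
    end of the last block is still an admissible time. *)
Fixpoint selection_length (J : nat) : nat :=
  if J is J'.+1 then (P * selection_length J').+1 else 0.

(* Pigeonhole: [H p] increases by less than [P * eta] over [P] consecutive blocks of
   length [L]. *)
Lemma stable_chunk p a L : all (fun i => (i < a)%N) p -> (a + P * L < m)%N ->
  exists2 c, (c < P)%N & H p (a + c.+1 * L) - H p (a + c * L) <= eta.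
Proof.
move=> pa aPm; apply: contrapT => nc.
have inc c : (c <= P)%N -> c%:R * eta <= H p (a + c * L).
  elim: c => [|c IH] cP; first by rewrite mul0r.
  have := IH (ltnW cP); have : eta < H p (a + c.+1 * L) - H p (a + c * L).
    by rewrite ltNge; apply/negP => h; apply: nc; exists c.
  by rewrite -natr1 mulrDl mul1r; lra.
have := inc P (leqnn P); rewrite leNgt; apply/negP; rewrite negbK.
apply: le_lt_trans PB; apply: HB => //.
by apply: sub_all pa => i /leq_trans; apply; exact: leq_addr.
Qed.

(** The first time is the left end of a block on which [H p] is stable, and the others are selected
    inside that block with this time appended to [p]. Later choices never leave the block, so by
    monotonicity the stability gained at each stage persists. *)
Lemma select_times J p a b : all (fun i => (i < a)%N) p ->
  (a + selection_length J <= b <= m)%N ->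
  exists t : seq nat, [/\ size t = J, sorted ltn t, all (fun i => (a <= i < b)%N) t &
    forall l i, (l <= i < J)%N ->
      H (p ++ take l t) (nth 0%N t i) - H (p ++ take l t) (nth 0%N t l) <= eta].
Proof.
elim: J p a b => [|J IH] p a b pa /andP[ab bm].
  by exists [::]; split=> // l i; rewrite ltn0 andbF.
set L := selection_length J in IH.
have aPb : (a + P * L < b)%N by move: ab; rewrite /= -/L addnS.
have [c cP cE] := stable_chunk pa (leq_trans aPb bm).
have cL : (a + c.+1 * L <= a + P * L)%N by rewrite leq_add2l leq_mul2r cP orbT.
have pc : all (fun i => (i < (a + c * L).+1)%N) (rcons p (a + c * L)%N).
  rewrite all_rcons ltnSn; apply: sub_all pa => i /ltnW ia.
  by rewrite ltnS; apply: leq_trans ia _; exact: leq_addr.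
have bP : ((a + c * L).+1 + L <= (a + c.+1 * L).+1 <= m)%N.
  apply/andP; split; first by rewrite addSn ltnS mulSn addnCA addnC.
  by apply: leq_trans bm; apply: leq_trans aPb; rewrite ltnS.
have [t [tJ tsort tab tP]] := IH _ _ _ pc bP.
exists ((a + c * L)%N :: t); split.
- by rewrite /= tJ.
- rewrite /= path_min_sorted //; apply: sub_all tab => i /andP[h _]; exact: h.
- rewrite /= leq_addr /=; apply/andP; split.
    by apply: leq_ltn_trans aPb; rewrite leq_add2l leq_mul2r ltnW ?orbT.
  apply: sub_all tab => i /andP[h1 h2]; apply/andP; split.
    by apply: leq_trans (ltnW h1); exact: leq_addr.
  by apply: leq_trans h2 _; apply: leq_trans aPb; rewrite ltnS.
- move=> [|l] [|i] //=; first by rewrite cats0 subrr ltW.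
    rewrite ltnS cats0 => iJ; apply: le_trans cE; rewrite lerD2r.
    have /allP/(_ (nth 0%N t i)) := tab; rewrite mem_nth ?tJ // => /(_ isT)/andP[h1 h2].
    apply: Hmono; first by apply: sub_all pa => j /= ja; lia.
    rewrite -ltnS h2 /=; apply: leq_trans bm; apply: leq_ltn_trans aPb.
    exact: cL.
  by rewrite ltnS => h; rewrite -cat_rcons; exact: tP.
Qed.

End TimeSelection.

(** * Almost equal norms at a single path, and the gap they force *)

Section GapFromIncrements.
Context {R : realType} {s : scalars} {X : completeNormedModType (K R s)}.

Lemma sqr_rnorm_sum (I : Type) (r : seq I) (F : I -> X) :
  rnorm (\sum_(i <- r) F i) ^+ 2 <= (size r)%:R * \sum_(i <- r) rnorm (F i) ^+ 2.
Proof.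
elim: r => [|i r IH]; first by rewrite big_nil rnorm0 expr0n mul0r.
rewrite !big_cons /= -natr1 mulrDl mul1r mulrDr.
set S := \sum_(j <- r) F j in IH *; set q := \sum_(j <- r) _ in IH *.
set a := rnorm (F i); set N : R := (size r)%:R in IH *.
have N0 : 0 <= N by [].
have h1 : rnorm (F i + S) ^+ 2 <= (a + rnorm S) ^+ 2.
  by rewrite lerXn2r ?nnegrE ?addr_ge0 ?rnorm_ge0 // rnormD.
suff h : 2 * (a * rnorm S) <= N * a ^+ 2 + q.
  by apply: le_trans h1 _; rewrite sqrrD -mulr_natl; lra.
have q0 : 0 <= q by apply: sumr_ge0 => j _; exact: sqr_ge0.
have [N00|Nn0] := eqVneq N 0.
  have -> : rnorm S = 0.
    by apply/eqP; rewrite -sqrf_eq0 eq_le sqr_ge0 andbT; move: IH; rewrite N00 mul0r.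
  by rewrite N00 mulr0 mulr0 mul0r add0r.
have Np : 0 < N by rewrite lt_neqAle eq_sym Nn0.
rewrite -(ler_pM2l Np); have := sqr_ge0 (N * a - rnorm S).
rewrite sqrrB exprMn; move: IH; rewrite -mulr_natl; nra.
Qed.

Lemma condexpMn n j (H r : Omega n -> X) k : condexp j H r ->
  condexp j (fun w => H w *+ k) (fun w => r w *+ k).
Proof.
move=> [ra Hr]; split=> [w u wu|w]; first by rewrite (ra _ _ wu).
by rewrite !sumrMnl Hr.
Qed.

Lemma sqnormMn (T : finType) (H : T -> X) k :
  sqnorm (fun w => H w *+ k) = k%:R ^+ 2 * sqnorm H.
Proof.
by rewrite /sqnorm mulr_sumr; apply: eq_bigr => w _; rewrite rnormMn exprMn.
Qed.

Lemma sqnorm_sum (T : finType) (I : eqType) (r : seq I) (F : I -> T -> X) (sg : R) :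
  (forall i, i \in r -> sqnorm (F i) <= sg) ->
  sqnorm (fun w => \sum_(i <- r) F i w) <= (size r)%:R ^+ 2 * sg.
Proof.
move=> Fs; apply: (@le_trans _ _ (\sum_w (size r)%:R * \sum_(i <- r) rnorm (F i w) ^+ 2)).
  by apply: ler_sum => w _; exact: sqr_rnorm_sum.
rewrite -mulr_sumr exchange_big expr2 -mulrA /=; apply: ler_wpM2l => //.
rewrite big_seq; apply: le_trans (ler_sum _ (fun i ir => Fs i ir)) _.
by rewrite -big_seq big_const_seq count_predT iter_addr_0 mulr_natl.
Qed.

(* [kap j] is the time at which the [j]-th term of the sequence is observed. *)
Record sampled_martingale n (m : nat) (kap : nat -> nat) (F : nat -> Omega n -> X) := {
  sampled_condexp : forall i j, (i <= j < m)%N -> condexp (kap i) (F j) (F i);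
  sampled_mono : forall i j, (i <= j < m)%N -> (kap i <= kap j)%N }.

(** In [gap_of_vectors] the norms are at most [C0 * D] with [C0] the bracket here, and the gap is
    [Q * D / 4]; dividing by [C0 * D] leaves the inverse of [4 * C0]. *)
Definition gap_const (d : R) : R := (4 * (Num.sqrt (4 / d) + 1))^-1.

Lemma gap_const_gt0 d : 0 < gap_const d.
Proof. by rewrite invr_gt0 mulr_gt0 // ltr_wpDl // sqrtr_ge0. Qed.

Lemma sqrt_bound (a b E : R) : (a - b) ^+ 2 <= E -> `|a - b| <= Num.sqrt E.
Proof. by move=> h; rewrite -sqrtr_sqr; apply: ler_wsqrtr. Qed.

(** Nonempty lists [r2] below [N] force [l < N], so the two extra vectors [x N] and [x N.+1] lie
    after [l]. Taken [Q] times, both are within [rho + e] of the head sum [S1], whence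
    [Q * D <= 2 * (rho + e)], while the tail sum is at distance at least [rho - e] from [S1]. *)
Lemma gap_of_vectors (N Q : nat) (d E : R) (x : nat -> X) : (0 < Q)%N -> 0 < d -> 0 <= E ->
  d / 4 * rnorm (x 0%N) ^+ 2 + 64 * E < rnorm (x N.+1 - x N) ^+ 2 ->
  (forall i, (i < N.+2)%N -> (rnorm (x i) - rnorm (x 0%N)) ^+ 2 <= E) ->
  (forall l (r1 r2 : seq nat), (l < N.+2)%N -> size r1 = Q -> size r2 = Q ->
    all (fun i => (i < l)%N) r1 -> all (fun i => (l <= i < N.+2)%N) r2 ->
    (rnorm (\sum_(i <- r2) x i - \sum_(i <- r1) x i) -
     rnorm (x l *+ Q - \sum_(i <- r1) x i)) ^+ 2 <= E) ->
  exists y : nat -> X, gap_on (gap_const d) N Q y.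
Proof.
move=> Q0 d0 E0; set D := rnorm (_ - _) => hD hx hC.
pose e := Num.sqrt E; pose C0 := Num.sqrt (4 / d) + 1.
have p0 : 0 <= d / 4 * rnorm (x 0%N) ^+ 2 by rewrite mulr_ge0 ?sqr_ge0 // divr_ge0 // ltW.
have D0 : 0 < D.
  rewrite lt_neqAle eq_sym rnorm_ge0 andbT; apply/eqP => h; move: hD.
  by rewrite h expr0n /=; lra.
(* The factor 64 in the hypothesis on [D] is the square of this 8. *)
have eD : e <= D / 8.
  rewrite -[D / 8]ger0_norm ?divr_ge0 ?rnorm_ge0 // -sqrtr_sqr; apply: ler_wsqrtr.
  rewrite exprMn; move: hD; lra.
have x0D : rnorm (x 0%N) <= Num.sqrt (4 / d) * D.
  have d4 : 0 <= 4 / d by rewrite divr_ge0 // ltW.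
  rewrite -[D]ger0_norm ?rnorm_ge0 // -sqrtr_sqr -sqrtrM //.
  rewrite -[rnorm (x 0%N)]ger0_norm ?rnorm_ge0 // -sqrtr_sqr; apply: ler_wsqrtr.
  rewrite mulrAC ler_pdivlMr //; move: hD; lra.
have xD i : (i < N.+2)%N -> rnorm (x i) <= C0 * D.
  move=> /hx/sqrt_bound; rewrite -/e ler_norml => /andP[_ h].
  rewrite /C0 mulrDl mul1r; move: x0D eD h D0; lra.
have C00 : 0 < C0 by rewrite ltr_wpDl // sqrtr_ge0.
have CD0 : 0 < C0 * D by rewrite mulr_gt0.
(* The unit bound is required at all indices while [x] is controlled only below [N.+2], hence the
   value 0 beyond. *)
exists (fun i => if (i < N.+2)%N then inK s (C0 * D)^-1 *: x i else 0); split=> [i|].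
  case: ifP => [iN|_]; last by rewrite rnorm0.
  by rewrite rnormZ_inK ger0_norm ?invr_ge0 ?(ltW CD0) // ler_pdivrMl // mulr1 xD.
move=> l r1 r2 s1 s2 a1 a2.
have lN : (l < N)%N.
  case: r2 s2 a2 => [s20|i r2 _ /= /andP[/andP[li iN] _]]; last exact: leq_ltn_trans iN.
  by move: Q0; rewrite -s20.
have sumE r : all (fun i => (i < N.+2)%N) r ->
    \sum_(i <- r) (if (i < N.+2)%N then inK s (C0 * D)^-1 *: x i else 0) =
    inK s (C0 * D)^-1 *: \sum_(i <- r) x i.
  move=> /allP rN; rewrite scaler_sumr; apply: eq_big_seq => i /rN; by move=> ->.
rewrite !sumE; first last.
- by apply: sub_all a1 => i il; exact: leqW (leqW (ltn_trans il lN)).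
- by apply: sub_all a2 => i /andP[_ iN]; exact: leqW (leqW iN).
rewrite -scalerBr rnormZ_inK ger0_norm ?invr_ge0 ?(ltW CD0) // ler_pdivlMl //.
have -> : C0 * D * (gap_const d * Q%:R) = Q%:R * D / 4.
  by rewrite /gap_const -/C0; field; rewrite gt_eqF.
have a2' : all (fun i => (l <= i < N.+2)%N) r2.
  by apply: sub_all a2 => i /andP[li iN]; rewrite li; exact: leqW (leqW iN).
have bnd r : size r = Q -> all (fun i => (l <= i < N.+2)%N) r ->
  `|rnorm (\sum_(i <- r) x i - \sum_(i <- r1) x i) -
   rnorm (x l *+ Q - \sum_(i <- r1) x i)| <= e.
  by move=> sr ar; apply/sqrt_bound/hC => //; exact: leqW (leqW lN).
set S1 := \sum_(i <- r1) x i in bnd *; set rho := rnorm (x l *+ Q - S1) in bnd *.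
(* A list repeating one index [Q] times is an admissible tail, so the hypothesis on lists also
   controls single vectors. *)
have top i : (l <= i < N.+2)%N -> rnorm (x i *+ Q - S1) <= rho + e.
  move=> il; have := bnd (nseq Q i); rewrite size_nseq all_nseq il orbT.
  rewrite big_nseq iter_addr_0 => /(_ erefl isT); rewrite ler_norml; lra.
have := bnd r2 s2 a2'; rewrite ler_norml -/S1 [X in _ -> _ <= X]rnorm_distC => /andP[h2 _].
have h3 : Q%:R * D <= 2 * (rho + e).
  rewrite /D -rnormMn mulrnBl.
  have t1 := top N.+1; have t2 := top N.
  have := rnorm_triangle S1 (x N.+1 *+ Q) (x N *+ Q).
  have lN1 : (l <= N.+1)%N by exact: ltnW (leqW lN).
  rewrite (rnorm_distC S1); move: t1 t2; rewrite !ltnS leqnSn leqnn lN1 (ltnW lN).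
  by move=> /(_ isT) ? /(_ isT) ?; lra.
(* The distance is at least [rho - e >= Q * D / 2 - 2 * e], and [2 * e <= D / 4 <= Q * D / 4]. *)
have Q1 : 1 <= Q%:R :> R by rewrite ler1n.
have : D <= Q%:R * D by rewrite ler_peMl // ltW.
move: h2 h3 eD; lra.
Qed.

(** Many monotone energies are controlled through their sum: all increases are nonnegative, so each
    is at most the total. *)
Lemma sum_split_bound (T : finType) (P : pred T) (a b eta : R) (x y : T -> R) :
  (a + \sum_(r | P r) x r) - (b + \sum_(r | P r) y r) <= eta ->
  b <= a -> (forall r, P r -> y r <= x r) ->
  a - b <= eta /\ forall r, P r -> x r - y r <= eta.
Proof.
move=> h ba yx; rewrite opprD addrACA -sumrB in h.
have h0 r : P r -> 0 <= x r - y r by move=> Pr; rewrite subr_ge0 yx.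
split=> [|r Pr].
  by apply: le_trans h; rewrite lerDl; apply: sumr_ge0 => r; exact: h0.
apply: le_trans h; rewrite (bigD1 r) //= addrCA lerDl addr_ge0 ?subr_ge0 //.
by apply: sumr_ge0 => q /andP[Pq _]; exact: h0.
Qed.

(** Each condition of [gap_of_vectors] is an almost-equality between the norm of a variable and that
    of its conditional expectation, so [condexp_defect] bounds its mean square error by an energy
    increase. The times are selected so that these increases are small, and the error summed over
    all conditions is small at some path where the last increment is large. *)
Lemma gap_of_sampled (N Q : nat) (d : R) : 0 < d -> (0 < Q)%N ->
  exists m, forall n kap (F : nat -> Omega n -> X) (sg : R), 0 < sg ->
    sampled_martingale m kap F ->
    (forall j, (j < m)%N -> sqnorm (F j) <= sg) ->
    (forall i j, (i < j < m)%N -> d * sg <= sqnorm (fun w => F j w - F i w)) ->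
    exists y : nat -> X, gap_on (gap_const d) N Q y.
Proof.
move=> d0 Q0; pose J := N.+2; pose Tup := (Q.-tuple 'I_J)%type.
pose Cond := ('I_J * (Tup * Tup))%type.
(* The number of conditions: one for each triple of a level and two lists, and one for each norm.
   With [eta'] below, 64 times the total error amounts to at most [d * sg / 8]. *)
pose cJ : R := #|{: Cond}|%:R + J%:R.
have cJ0 : 0 < cJ by rewrite ltr_wpDl // ltr0n.
pose eta' := d / (64 * (8 * cJ)).
have eta'0 : 0 < eta' by rewrite divr_gt0 // !mulr_gt0.
(* An upper bound for [H] in units of [sg]: 1 for [F t], and twice Q^2 plus twice Q^2 for each
   tuple. *)
pose B' : R := 1 + #|{: Tup}|%:R * (4 * Q%:R ^+ 2).
pose P := (Num.trunc (B' / eta')).+1.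
have PB' : B' < P%:R * eta' by rewrite -ltr_pdivrMr // truncnS_gt.
exists (selection_length P J) => n kap F sg sg0 [Fc kapm] Fs Fd.
set m := selection_length P J in Fc kapm Fs Fd.
pose Zp (p : seq nat) (r : Tup) w := \sum_(i <- r) F (nth 0%N p i) w.
pose D p (r : Tup) t := sqnorm (fun w => F t w *+ Q - Zp p r w).
(* The entries of [r] are positions in the list [p] of selected times. The type [Tup] is thus
   independent of [m], and only tuples referring to times already selected enter the sum. *)
pose H p t := sqnorm (F t) + \sum_(r : Tup | all (fun i : 'I_J => (i < size p)%N) r) D p r t.
have D_ge0 p r t : 0 <= D p r t by exact: sqnorm_ge0.
have nth_lt p t (i : nat) : all (fun i => (i < t)%N) p -> (nth 0%N p i <= t)%N.
  move=> pt; case: (ltnP i (size p)) => ip; last by rewrite nth_default.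
  by apply: ltnW; apply: (allP pt); exact: mem_nth.
have DB p r t : all (fun i => (i < t)%N) p -> (t < m)%N -> D p r t <= 4 * Q%:R ^+ 2 * sg.
  move=> pt tm; apply: le_trans (sqnormB _ _) _; rewrite sqnormMn.
  have h1 : Q%:R ^+ 2 * sqnorm (F t) <= Q%:R ^+ 2 * sg by rewrite ler_wpM2l ?sqr_ge0 // Fs.
  have h2 : sqnorm (Zp p r) <= Q%:R ^+ 2 * sg.
    rewrite -[X in X%:R](size_tuple r); apply: sqnorm_sum => i _; apply: Fs.
    by apply: leq_ltn_trans tm; exact: nth_lt.
  by move: h1 h2; lra.
have Dmono p r t t' : all (fun i => (i < t)%N) p -> (t <= t' < m)%N -> D p r t <= D p r t'.
  move=> pt tt'; have tm : (t < m)%N by case/andP: tt' => /leq_ltn_trans; apply.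
  apply: (@condexp_le _ _ _ _ (kap t)).
  apply: condexpB; first by apply: condexpMn; exact: Fc.
  apply: condexp_adapted => w u wu; apply: eq_bigr => i _.
  have it : (nth 0%N p i <= t)%N by exact: nth_lt.
  have itm : (nth 0%N p i <= nth 0%N p i < m)%N by rewrite leqnn /=; exact: leq_ltn_trans tm.
  apply: (Fc _ _ itm).1; apply: agree_le wu; apply: kapm; by rewrite it.
have Smono t t' : (t <= t' < m)%N -> sqnorm (F t) <= sqnorm (F t').
  by move=> tt'; exact: condexp_le (Fc _ _ tt').
pose eta := eta' * sg; pose B := B' * sg.
have eta0 : 0 < eta by rewrite mulr_gt0.
have PB : B < P%:R * eta by rewrite mulrA ltr_pM2r.
have H0 p t : 0 <= H p t by rewrite addr_ge0 ?sqnorm_ge0 // sumr_ge0.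
have HB p t : (t < m)%N -> all (fun i => (i < t)%N) p -> H p t <= B.
  move=> tm pt; rewrite /H /B /B' mulrDl mul1r; apply: lerD; first exact: Fs.
  apply: (@le_trans _ _ (\sum_(r : Tup) 4 * Q%:R ^+ 2 * sg)); last first.
    by rewrite sumr_const -[X in X <= _]mulr_natl mulrA; exact: lexx.
  rewrite big_mkcond; apply: ler_sum => r _; case: ifP => _; first exact: DB.
  by rewrite !mulr_ge0 ?sqr_ge0 // ltW.
have Hmono p t t' : all (fun i => (i < t)%N) p -> (t <= t' < m)%N -> H p t <= H p t'.
  move=> pt tt'; apply: lerD; first exact: Smono.
  by apply: ler_sum => r _; exact: Dmono.
have mm : (0 + selection_length P J <= m <= m)%N by rewrite add0n leqnn.
have [tau [tauJ tsort tm tP]] := select_times eta0 PB H0 HB Hmono (p := [::]) isT mm.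
pose M i := F (nth 0%N tau i).
have tauM l i : (l <= i < J)%N -> (nth 0%N tau l <= nth 0%N tau i < m)%N.
  move=> /andP[li iJ]; apply/andP; split; last first.
    by have := all_nthP 0%N tm i; rewrite tauJ => /(_ iJ)/andP[].
  move: li; rewrite leq_eqVlt => /orP[/eqP-> //|li]; apply: ltnW.
  apply: (sorted_ltn_nth ltn_trans 0%N tsort) => //; rewrite inE tauJ //.
  exact: ltn_trans iJ.
have takeM l : (l < J)%N -> all (fun i => (i < nth 0%N tau l)%N) (take l tau).
  move=> lJ; apply/(all_nthP 0%N) => i; rewrite size_takel ?tauJ ?(ltnW lJ) // => il.
  rewrite nth_take //; apply: (sorted_ltn_nth ltn_trans 0%N tsort) => //; rewrite inE tauJ //.
  exact: ltn_trans lJ.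
pose Z (r : Tup) w := \sum_(i <- r) M i w.
have ZE l (r : Tup) : (l < J)%N -> all (fun i : 'I_J => (i < l)%N) r -> Zp (take l tau) r = Z r.
  move=> lJ /allP rl; apply/funext => w; apply: eq_big_seq => i /rl il.
  by rewrite nth_take.
have key l i : (l <= i < J)%N -> sqnorm (M i) - sqnorm (M l) <= eta /\
    forall r : Tup, all (fun i : 'I_J => (i < l)%N) r ->
      sqnorm (fun w => M i w *+ Q - Z r w) - sqnorm (fun w => M l w *+ Q - Z r w) <= eta.
  move=> li; have lJ : (l < J)%N by case/andP: li => /leq_ltn_trans; apply.
  have := tP l i li; rewrite /H /= size_takel ?tauJ ?(ltnW lJ) // => hh.
  have [||h1 h2] := sum_split_bound hh.
  - exact: Smono (tauM _ _ li).
  - by move=> r rl; apply: Dmono; [exact: takeM|exact: tauM].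
  by split=> // r rl; have := h2 r rl; rewrite /D (ZE l).
pose valid (c : Cond) := all (fun i : 'I_J => (i < c.1)%N) c.2.1 &&
  all (fun i : 'I_J => (c.1 <= i)%N) c.2.2.
pose g (c : Cond) w := (rnorm (Z c.2.2 w - Z c.2.1 w) - rnorm (M c.1 w *+ Q - Z c.2.1 w)) ^+ 2.
(* [Z r2 - Z r1] taken [Q] times is the sum over [r2] of the [M i *+ Q - Z r1], each of energy at
   most [rho + eta]. By Cauchy-Schwarz [Z r2 - Z r1] has energy at most [rho + eta], and its
   conditional expectation has energy [rho]. *)
have gB c : valid c -> \sum_w g c w <= eta.
  case: c => l [r1 r2] /andP[/= v1 v2].
  have hr2 : condexp (kap (nth 0%N tau l)) (Z r2) (fun w => M l w *+ Q).
    have := @condexp_sum R s X n (kap (nth 0%N tau l)) _ r2 (fun i => M i) (fun=> M l).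
    have -> : (fun w => \sum_(i <- r2) M l w) = (fun w => M l w *+ Q).
      by apply/funext => w; rewrite big_const_seq count_predT iter_addr_0 size_tuple.
    apply=> i /(allP v2) li; apply: Fc; apply: tauM; by rewrite li ltn_ord.
  have hr1 : adapted (kap (nth 0%N tau l)) (Z r1).
    move=> w u wu; apply: eq_big_seq => i /(allP v1) il.
    have iM := tauM i i; rewrite leqnn ltn_ord in iM.
    apply: (Fc _ _ (iM isT)).1; apply: agree_le wu; apply: kapm; apply: tauM.
    by rewrite (ltnW il) ltn_ord.
  apply: le_trans (condexp_defect (condexpB hr2 (condexp_adapted hr1))) _.
  set rho := sqnorm (fun w => M l w *+ Q - _).
  suff : sqnorm (fun w => Z r2 w - Z r1 w) <= rho + eta by lra.
  have Q20 : 0 < Q%:R ^+ 2 :> R by rewrite exprn_gt0 // ltr0n.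
  rewrite -(ler_pM2l Q20) -sqnormMn.
  have -> : sqnorm (fun w => (Z r2 w - Z r1 w) *+ Q) =
      sqnorm (fun w => \sum_(i <- r2) (M i w *+ Q - Z r1 w)).
    apply: eq_bigr => w _; rewrite sumrB big_const_seq count_predT iter_addr_0 size_tuple.
    by rewrite mulrnBl sumrMnl.
  rewrite -[X in X%:R](size_tuple r2); apply: sqnorm_sum => i /(allP v2) li.
  have := (key l i _).2 r1 v1; rewrite li ltn_ord => /(_ isT); rewrite -/rho; lra.
pose h (i : 'I_J) w := (rnorm (M i w) - rnorm (M 0%N w)) ^+ 2.
have hB i : \sum_w h i w <= eta.
  have i0 : (0 <= i < J)%N by rewrite ltn_ord.
  apply: le_trans (condexp_defect (Fc _ _ (tauM _ _ i0))) _.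
  exact: (key _ _ i0).1.
pose err w := \sum_(c | valid c) g c w + \sum_i h i w.
have g0 c w : 0 <= g c w by exact: sqr_ge0.
have h0 i w : 0 <= h i w by exact: sqr_ge0.
have err0 w : 0 <= err w by rewrite addr_ge0 // sumr_ge0.
have errB : \sum_w err w <= cJ * eta.
  rewrite big_split /= exchange_big [X in _ + X <= _]exchange_big /= mulrDl; apply: lerD.
    apply: (@le_trans _ _ (\sum_(c : Cond) eta)).
      by rewrite big_mkcond; apply: ler_sum => c _; case: ifP => [/gB //|_]; exact: ltW.
    by rewrite sumr_const -[X in X <= _]mulr_natl; exact: lexx.
  apply: (le_trans (ler_sum _ (fun i _ => hB i))).
  by rewrite sumr_const -[X in X <= _]mulr_natl card_ord.
(* Otherwise summation over all paths would bound the energy of the last increment, at least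
   [d * sg], by [d * sg / 4 + d * sg / 8]. *)
have [w wP] : exists w, d / 4 * rnorm (M 0%N w) ^+ 2 + 64 * err w < rnorm (M N.+1 w - M N w) ^+ 2.
  apply: contrapT => /forallNP nw.
  have h1 : sqnorm (fun w => M N.+1 w - M N w) <= d / 4 * sqnorm (M 0%N) + 64 * \sum_w err w.
    rewrite /sqnorm !mulr_sumr -big_split; apply: ler_sum => w _.
    by rewrite leNgt; apply/negP; exact: nw.
  have NJ : (nth 0%N tau N < nth 0%N tau N.+1)%N.
    by apply: (sorted_ltn_nth ltn_trans 0%N tsort); rewrite ?inE ?tauJ.
  have NN : (N <= N.+1 < J)%N by rewrite leqnSn ltnSn.
  have := Fd (nth 0%N tau N) (nth 0%N tau N.+1); rewrite NJ /=.
  have /andP[_ ->] := tauM _ _ NN.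
  move=> /(_ isT) h2.
  have h3 : sqnorm (M 0%N) <= sg.
    by apply: Fs; have /andP[] := tauM 0%N 0%N isT.
  have h4 : d / 4 * sqnorm (M 0%N) <= d / 4 * sg by rewrite ler_wpM2l // divr_ge0 // ltW.
  have h5 : 64 * (cJ * eta) = d * sg / 8.
    rewrite /eta /eta'; field; exact: lt0r_neq0.
  have h6 := le_trans h2 h1; have h7 : 0 < d * sg by rewrite mulr_gt0.
  have h8 : 64 * \sum_w err w <= d * sg / 8 by rewrite -h5 ler_pM2l.
  move: h4 h6 h7 h8; clear; lra.
apply: (gap_of_vectors (x := fun i => M i w) Q0 d0 (err0 w) wP) => [i iJ|l r1 r2 lJ s1 s2 a1 a2].
  apply: (@le_trans _ _ (h (Ordinal iJ) w)) => //.
  rewrite /err (bigD1 (Ordinal iJ) (P := xpredT)) //= addrCA lerDl addr_ge0 //; apply: sumr_ge0 => //.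
have inordE (r : seq nat) : all (fun i => (i < J)%N) r ->
    \sum_(i <- map (@inord N.+1) r) M i w = \sum_(i <- r) M i w.
  by move=> /allP rJ; rewrite big_map; apply: eq_big_seq => i /rJ iJ; rewrite inordK.
have t1P : size (map (@inord N.+1) r1) == Q by rewrite size_map s1.
have t2P : size (map (@inord N.+1) r2) == Q by rewrite size_map s2.
pose c : Cond := (Ordinal lJ, (Tuple t1P, Tuple t2P)).
have a1J : all (fun i => (i < J)%N) r1 by apply: sub_all a1 => i /ltn_trans; apply.
have a2J : all (fun i => (i < J)%N) r2 by apply: sub_all a2 => i /andP[].
have vc : valid c.
  apply/andP; split; rewrite /= all_map; apply/allP => i ir /=.
    by rewrite inordK; [exact: (allP a1)|exact: (allP a1J)].
  by rewrite inordK; [have /andP[] := allP a2 _ ir|exact: (allP a2J)].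
apply: (@le_trans _ _ (g c w)); first by rewrite /g /Z /= !inordE.
by rewrite /err (bigD1 c) //= -addrA lerDl addr_ge0 //; apply: sumr_ge0.
Qed.

End GapFromIncrements.

(** * Type 2 and random unconditionality *)

Section RUMDBounds.
Context {R : realType} {s : scalars} {X : completeNormedModType (K R s)}.

Lemma le_sqr_of_sqrt (a b c : R) : 0 <= a -> 0 <= b -> 0 <= c ->
  (Num.sqrt a <= c * Num.sqrt b) = (a <= c ^+ 2 * b).
Proof.
move=> a0 b0 c0; rewrite -[in RHS](sqr_sqrtr a0) -[in RHS](sqr_sqrtr b0) -exprMn.
by rewrite ler_sqr // nnegrE ?mulr_ge0 ?sqrtr_ge0.
Qed.

Definition transform_energy n (M : nat -> Omega n -> X) : R :=
  \sum_(ew : Omega n * Omega n)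
    rnorm (\sum_(k < n) sgn (K R s) (ew.1 k) *: (M k.+1 ew.2 - M k ew.2)) ^+ 2.

Lemma transform_energy_ge0 n (M : nat -> Omega n -> X) : 0 <= transform_energy M.
Proof. by apply: sumr_ge0 => e _; exact: sqr_ge0. Qed.

Lemma card_Omega_gt0 n : 0 < #|Omega n|%:R :> R.
Proof. by rewrite card_ffun card_bool ltr0n expn_gt0. Qed.

(** Clearing denominators and roots: the left mean runs over pairs, the right one over single paths,
    which leaves one factor [#|Omega n|]. *)
Lemma RUMD_boundP n (b : R) : 0 <= b ->
  RUMD_bound X n b <-> forall M : nat -> Omega n -> X, walsh_paley_martingale M ->
    (forall w, M 0%N w = 0) ->
    transform_energy M <= b ^+ 2 * (#|Omega n|%:R * sqnorm (M n)).
Proof.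
move=> b0; have C0 := card_Omega_gt0 n.
have e1 (M : nat -> Omega n -> X) :
    (Num.sqrt (expect (fun ew : Omega n * Omega n =>
      rnorm (\sum_(k < n) sgn (K R s) (ew.1 k) *: (M k.+1 ew.2 - M k ew.2)) ^+ 2))
    <= b * Num.sqrt (expect (fun w : Omega n => rnorm (M n w) ^+ 2))) =
    (transform_energy M <= b ^+ 2 * (#|Omega n|%:R * sqnorm (M n))).
  rewrite le_sqr_of_sqrt //; first last.
  - by rewrite mulr_ge0 ?invr_ge0 // sqnorm_ge0.
  - by rewrite mulr_ge0 ?invr_ge0 // transform_energy_ge0.
  rewrite /expect -/(transform_energy M) -/(sqnorm (M n)) card_prod natrM.
  rewrite ler_pdivrMl ?mulr_gt0 //; congr (_ <= _).
  by field; exact: lt0r_neq0.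
split=> h M Mwp M0; first by rewrite -e1; exact: h.
by rewrite e1; exact: h.
Qed.

Definition type2_constant (c : R) := forall (m : nat) (x : 'I_m -> X),
  Num.sqrt (expect (fun e : Omega m =>
    rnorm (\sum_(k < m) sgn (K R s) (e k) *: x k) ^+ 2))
  <= c * Num.sqrt (\sum_(k < m) rnorm (x k) ^+ 2).

Lemma type2_energy (c : R) : 0 < c ->
  type2_constant c ->
  forall n (M : nat -> Omega n -> X), transform_energy M <=
    c ^+ 2 * (#|Omega n|%:R * \sum_(k < n) sqnorm (fun w => M k.+1 w - M k w)).
Proof.
move=> c0 hc n M; have C0 := card_Omega_gt0 n.
rewrite /transform_energy -(pair_bigA _ (fun e w : Omega n =>
  rnorm (\sum_(k < n) sgn (K R s) (e k) *: (M k.+1 w - M k w)) ^+ 2)) /=.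
rewrite exchange_big /= [X in _ * (_ * X)]exchange_big /= mulr_sumr mulr_sumr.
apply: ler_sum => w _; have := hc n (fun k => M k.+1 w - M k w).
rewrite le_sqr_of_sqrt ?(ltW c0) //; first last.
- by apply: sumr_ge0 => k _; exact: sqr_ge0.
- by rewrite mulr_ge0 ?invr_ge0 // sumr_ge0 // => e _; exact: sqr_ge0.
by rewrite /expect ler_pdivrMl // mulrCA.
Qed.

Lemma type2_RUMD_bound (c : R) : 0 < c ->
  type2_constant c ->
  forall n, RUMD_bound X n (2 * c * Num.sqrt n%:R).
Proof.
move=> c0 hc n; apply/RUMD_boundP => [|M Mwp M0].
  by rewrite mulr_ge0 ?sqrtr_ge0 // mulr_ge0 // ltW.
apply: le_trans (type2_energy c0 hc M) _.
have -> : (2 * c * Num.sqrt n%:R) ^+ 2 * (#|Omega n|%:R * sqnorm (M n)) =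
    c ^+ 2 * (#|Omega n|%:R * (n%:R * (4 * sqnorm (M n)))).
  by rewrite !exprMn sqr_sqrtr //; ring.
apply: ler_wpM2l; first exact: sqr_ge0.
apply: ler_wpM2l => //; rewrite mulr_natl.
rewrite -[X in _ *+ X]card_ord -sumr_const; apply: ler_sum => k _.
exact: sqnorm_increment_le.
Qed.

Lemma increasing_martingales (c c' : R) : 0 < c -> 0 < c' ->
  type2_constant c ->
  (forall n, (1 <= n)%N -> ((c'^-1 * Num.sqrt n%:R)%:E <= RUMD X n)%E) ->
  forall n, (1 <= n)%N -> exists2 M : nat -> Omega n -> X, walsh_paley_martingale M &
    (2 * c * c') ^- 2 * n%:R * sqnorm (M n) < \sum_(k < n) sqnorm (fun w => M k.+1 w - M k w).
Proof.
move=> c0 c'0 hc hR n n1; have C0 := card_Omega_gt0 n.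
have n0 : (0 : R) < n%:R by rewrite ltr0n.
(* Half of the assumed lower bound, hence strictly below the infimum and not an admissible
   constant. *)
pose b := (2 * c')^-1 * Num.sqrt n%:R.
have b0 : 0 < b by rewrite mulr_gt0 ?sqrtr_gt0 // invr_gt0 mulr_gt0.
have nb : ~ RUMD_bound X n b.
  move=> hb; have : (RUMD X n <= b%:E)%E by apply: ereal_inf_lbound; exists b.
  move/(le_trans (hR n n1)); rewrite lee_fin /b ler_pM2r ?sqrtr_gt0 //.
  rewrite lef_pV2 ?posrE ?mulr_gt0 //; lra.
have [M [Mwp [M0 hM]]] : exists M : nat -> Omega n -> X, walsh_paley_martingale M /\
    (forall w, M 0%N w = 0) /\ b ^+ 2 * (#|Omega n|%:R * sqnorm (M n)) < transform_energy M.
  apply: contrapT => nM; apply: nb; apply/(RUMD_boundP _ (ltW b0)) => M Mwp M0.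
  by rewrite leNgt; apply/negP => h; apply: nM; exists M.
exists M => //; have h := lt_le_trans hM (type2_energy c0 hc M).
rewrite -(ltr_pM2l C0) -(ltr_pM2l (x := c ^+ 2)) ?exprn_gt0 //; apply: le_lt_trans h.
have -> : b ^+ 2 = (2 * c')^-1 ^+ 2 * n%:R by rewrite /b exprMn sqr_sqrtr.
rewrite le_eqVlt; apply/orP; left; apply/eqP.
by field; rewrite !gt_eqF.
Qed.

(** No increment has energy above [4 * sg], and those that are not [good] contribute at most half of
    the total, so [4 * size goods > del * n / 2]. The choice of [n] makes this number of indices at
    least [m]. *)
Lemma gap_of_energy (del : R) : 0 < del ->
  (forall n, (1 <= n)%N -> exists2 M : nat -> Omega n -> X, walsh_paley_martingale M &
    del * n%:R * sqnorm (M n) < \sum_(k < n) sqnorm (fun w => M k.+1 w - M k w)) ->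
  convex_gap X (gap_const (del / 8)).
Proof.
move=> del0 hM N Q.
have d0 : 0 < del / 8 by rewrite divr_gt0.
case: (posnP Q) => [->|Q0].
  exists (fun=> 0); split=> [i|l r1 r2 _ _ _ _]; first by rewrite rnorm0.
  by rewrite mulr0 rnorm_ge0.
have [m mP] := gap_of_sampled (X := X) N d0 Q0.
pose n := (Num.trunc (8 * m%:R / del)).+1.
have nm : 8 * m%:R < del * n%:R by rewrite -ltr_pdivrMl // mulrC truncnS_gt.
have [M Mwp ME] := hM n isT.
set sg := sqnorm (M n) in ME.
have inc k : (k < n)%N -> sqnorm (fun w => M k.+1 w - M k w) <= 4 * sg.
  by move=> kn; exact: sqnorm_increment_le.
have sg0 : 0 < sg.
  rewrite lt_neqAle sqnorm_ge0 andbT; apply/eqP => sg0; move: ME.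
  rewrite -sg0 mulr0 ltNge => /negP; apply; apply: sumr_le0 => k _.
  by apply: le_trans (inc k _) _; rewrite -?sg0 ?mulr0.
pose good k := del / 2 * sg <= sqnorm (fun w => M k.+1 w - M k w).
pose goods := [seq k <- iota 0 n | good k].
have gm : (m <= size goods)%N.
  have h : \sum_(k < n) sqnorm (fun w => M k.+1 w - M k w) <=
      (size goods)%:R * (4 * sg) + n%:R * (del / 2 * sg).
    rewrite -(big_mkord xpredT (fun k => sqnorm (fun w => M k.+1 w - M k w))).
    rewrite (bigID good) /=; apply: lerD.
      rewrite -big_filter /index_iota subn0 -/goods big_seq.
      apply: (@le_trans _ _ (\sum_(k <- goods) 4 * sg)).
        rewrite [X in _ <= X]big_seq; apply: ler_sum => k.
        by rewrite mem_filter mem_iota => /andP[_ /andP[_ kn]]; exact: inc.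
      by rewrite big_const_seq count_predT iter_addr_0 [X in _ <= X]mulr_natl.
    apply: (@le_trans _ _ (\sum_(0 <= k < n) del / 2 * sg)); last first.
      by rewrite big_const_nat subn0 iter_addr_0 [X in _ <= X]mulr_natl.
    rewrite big_mkcond; apply: ler_sum => k _; case: ifP => [|_].
      by rewrite -ltNge => /ltW.
    by rewrite mulr_ge0 ?ltW // divr_gt0.
  have := lt_le_trans ME h; rewrite -(ler_nat R).
  rewrite -subr_gt0.
  rewrite (_ : _ - _ = sg * (4 * (size goods)%:R - del * n%:R / 2)); last by field.
  by rewrite pmulr_rgt0 //; move: nm; lra.
(* The time just after the [j]-th large increment. An earlier sample is known before that increment,
   so [sqnorm_increment] bounds the energy of the difference of the samples below by
   [del / 2 * sg / 4], the source of [del / 8]. *)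
pose kap j := (nth 0%N goods j).+1.
have gsort : sorted ltn goods by apply: sorted_filter (iota_ltn_sorted 0 n); exact: ltn_trans.
have gn j : (j < m)%N -> (nth 0%N goods j < n)%N.
  move=> jm; have := mem_nth 0%N (leq_trans jm gm).
  by rewrite mem_filter mem_iota => /andP[_ /andP[]].
have gmono i j : (i < j < m)%N -> (nth 0%N goods i < nth 0%N goods j)%N.
  move=> /andP[ij jm]; apply: (sorted_ltn_nth ltn_trans 0%N gsort) => //.
    by rewrite inE (ltn_trans ij) // (leq_trans jm).
  by rewrite inE (leq_trans jm).
have kmono i j : (i <= j < m)%N -> (kap i <= kap j)%N.
  move=> /andP[]; rewrite leq_eqVlt => /orP[/eqP-> //|ij] jm.
  by apply: ltnW; rewrite ltnS; apply: gmono; rewrite ij.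
apply: (mP n kap (fun j => M (kap j)) sg sg0) => [|j jm|i j ijm].
- split=> // i j ijm; apply: walsh_paley_condexp => //; rewrite kmono //=.
  by apply: gn; case/andP: ijm.
- apply: condexp_le (walsh_paley_condexp (j := kap j) Mwp _); rewrite leqnn andbT.
  exact: gn.
- have jm : (j < m)%N by case/andP: ijm.
  have im : (i < m)%N by case/andP: ijm => /ltn_trans; apply.
  have h : (kap i <= nth 0%N goods j < n)%N by rewrite gmono // gn.
  have Za := walsh_paley_adapted Mwp (gn _ im : (kap i <= n)%N).
  have := sqnorm_increment Mwp h Za.
  have : good (nth 0%N goods j).
    by have := mem_nth 0%N (leq_trans jm gm); rewrite mem_filter => /andP[].
  by rewrite /good /kap; lra.
Qed.

Lemma not_superreflexive_of_RUMD : type2 X ->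
  (exists2 c' : R, 0 < c' &
    forall n : nat, (1 <= n)%N -> ((c'^-1 * Num.sqrt n%:R)%:E <= RUMD X n)%E) ->
  ~ superreflexive X.
Proof.
move=> [c c0 hc] [c' c'0 hc'].
have del0 : 0 < (2 * c * c') ^- 2 by rewrite invr_gt0 exprn_gt0 // !mulr_gt0.
apply: (not_superreflexive_of_gap (gap_const_gt0 ((2 * c * c') ^- 2 / 8))).
exact: gap_of_energy del0 (increasing_martingales c0 c'0 hc hc').
Qed.

End RUMDBounds.

(** * James systems *)

Section James.
Context {R : realType} {s : scalars}.
Implicit Types X Y : completeNormedModType (K R s).

Definition james_system X (th : R) N :=
  exists x : 'I_N -> X, (forall i, rnorm (x i) <= 1) /\
    forall (a : 'I_N -> K R s) (j : nat),
      th * rabs (\sum_(i < N | (j <= i)%N) a i) <= rnorm (\sum_(i < N) a i *: x i).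

(** An explicit bound in place of the supremum [dual_norm]: under linear combinations it is updated
    by arithmetic alone. *)
Definition dual_ball Y (b : R) (f : Y -> K R s) :=
  dual f /\ forall x, rabs (f x) <= b * rnorm x.

Lemma dual_ball_lin Y (b c : R) (a : K R s) (f g : Y -> K R s) :
  dual_ball b f -> dual_ball c g -> dual_ball (rabs a * b + c) (fun x => a * f x + g x).
Proof.
move=> [fd fb] [gd gc].
have h u : rabs (a * f u + g u) <= (rabs a * b + c) * rnorm u.
  apply: le_trans (rabsD _ _) _; rewrite rabsM mulrDl -mulrA; apply: lerD => //.
  by rewrite ler_wpM2l ?rabs_ge0.
split=> //; apply: dual_of_bound h => k u v.
by rewrite fd.1 gd.1 /GRing.scale /=; ring.
Qed.

Lemma dual_ball0 Y : dual_ball 0 (fun _ : Y => 0 : K R s).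
Proof.
have h u : rabs (0 : K R s) <= 0 * rnorm (u : Y) by rewrite rabs0 mul0r.
by split=> //; apply: dual_of_bound h => k u v; rewrite mulr0 addr0.
Qed.

Lemma dual_ball_le Y (b c : R) (f : Y -> K R s) : b <= c -> dual_ball b f -> dual_ball c f.
Proof.
move=> bc [fd fb]; split=> // x; apply: le_trans (fb x) _.
by rewrite ler_wpM2r ?rnorm_ge0.
Qed.

Lemma dual_ball_of_real_part Y (b : R) (f : Y -> K R s) :
  (forall a u v, f (a *: u + v) = a * f u + f v) ->
  (forall u, real_part (f u) <= b * rnorm u) -> dual_ball b f.
Proof.
move=> fl fb.
have f0 : f 0 = 0 by have := fl (-1) 0 0; rewrite scaler0 addr0 mulN1r addNr.
have h u : rabs (f u) <= b * rnorm u.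
  have [c c1 cE] := rabs_phase (f u).
  have fZ : f (c *: u) = c * f u by have := fl c u 0; rewrite addr0 f0 addr0.
  by rewrite -(inKK (s := s) (rabs _)) -cE -fZ -[rnorm u]mul1r -c1 -rnormZ.
by split=> //; exact: dual_of_bound fl h.
Qed.

Lemma lin_rowE m (G : 'rV[K R s]_m -> K R s) :
  (forall a u v, G (a *: u + v) = a * G u + G v) ->
  forall c, G c = \sum_(i < m) c 0 i * G (delta_mx 0 i).
Proof.
move=> Gl c; have G0 : G 0 = 0 by have := Gl (-1) 0 0; rewrite scaler0 addr0 mulN1r addNr.
rewrite {1}(row_sum_delta c); elim/big_ind2: _ => // [u a v b <- <-|i _].
  by have := Gl 1 a b; rewrite scale1r mul1r.
by have := Gl (c 0 i) (delta_mx 0 i) 0; rewrite addr0 G0 addr0.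
Qed.

(** * A bidual functional that is not an evaluation *)

Section NonReflexive.
Context {Y : completeNormedModType (K R s)} (F : (Y -> K R s) -> K R s) (C : R).
Hypothesis FL : forall (a : K R s) (f g : Y -> K R s), dual f -> dual g ->
  F (fun x => a * f x + g x) = a * F f + F g.
Hypotheses (C0 : 0 < C) (FC : forall b f, 0 <= b -> dual_ball b f -> rabs (F f) <= C * b).

Lemma bidual0 : F (fun=> 0) = 0.
Proof.
have d0 := (dual_ball0 Y).1; have := FL (-1) d0 d0; by rewrite !mulN1r !addNr.
Qed.

Lemma bidual_comb m (l : 'I_m -> K R s) (f : 'I_m -> Y -> K R s) :
  (forall i, dual (f i)) ->
  dual (fun x => \sum_(i < m) l i * f i x) /\
  F (fun x => \sum_(i < m) l i * f i x) = \sum_(i < m) l i * F (f i).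
Proof.
move=> fd; have h (r : seq 'I_m) : dual (fun x => \sum_(i <- r) l i * f i x) /\
    F (fun x => \sum_(i <- r) l i * f i x) = \sum_(i <- r) l i * F (f i).
  elim: r => [|i r [IH1 IH2]].
    rewrite (_ : (fun x => _) = fun=> 0); last by apply/funext => x; rewrite big_nil.
    by rewrite big_nil bidual0; split=> //; exact: (dual_ball0 Y).1.
  rewrite (_ : (fun x => _) = fun x => l i * f i x + \sum_(i <- r) l i * f i x); last first.
    by apply/funext => x; rewrite big_cons.
  rewrite big_cons FL // IH2; split=> //.
  have [b _ bP] := dual_bound (fd i); have [c _ cP] := dual_bound IH1.
  exact: (dual_ball_lin (l i) (conj (fd i) bP) (conj IH1 cP)).1.
exact: h.
Qed.

(* Separation in ['rV_m] gives a combination of the [f i] of norm at most 1 on which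
   [F] takes a value larger than [C]. *)
Lemma helly m (f : 'I_m -> Y -> K R s) (eps : R) : 0 < eps -> (forall i, dual (f i)) ->
  exists y, rnorm y <= C + 1 /\ forall i, rabs (f i y - F (f i)) <= eps.
Proof.
(* The penalty is such that [p (y, b - fv y) < C + 1] yields both the norm bound on [y] and
   deviations of at most [eps]. *)
move=> eps0 fd; pose L := (C + 1) / eps.
have C10 : 0 < C + 1 by rewrite addr_gt0.
have L0 : 0 < L by rewrite divr_gt0.
apply: contrapT => ny.
pose fv y : 'rV[K R s]_m := \row_i f i y.
pose b : 'rV[K R s]_m := \row_i F (f i).
pose nl (c : 'rV[K R s]_m) : R := \sum_i rabs (c 0 i).
pose p (w : Y * 'rV[K R s]_m) : R := rnorm w.1 + L * nl w.2.
have fvL a u v : fv (a *: u + v) = a *: fv u + fv v.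
  by apply/rowP => i; rewrite !mxE (fd i).1.
have nlZ r c : nl (r *: c) = rabs r * nl c.
  by rewrite /nl mulr_sumr; apply: eq_bigr => i _; rewrite mxE rabsM.
have pP : sublinear (s := s) p.
  split=> [u v|r u r0].
    rewrite /p addrACA -mulrDr; apply: lerD; first exact: rnormD.
    rewrite ler_pM2l // -big_split; apply: ler_sum => i _ /=; rewrite mxE; exact: rabsD.
  by rewrite /p /= rnormZ_inK nlZ rabs_inK gtr0_norm // mulrDr mulrCA.
have far y : C + 1 <= p (y, b - fv y).
  rewrite leNgt; apply/negP => h; apply: ny; exists y.
  have n0 : 0 <= nl (b - fv y) by apply: sumr_ge0 => i _; exact: rabs_ge0.
  have r0 := rnorm_ge0 y; rewrite /p /= in h.
  split; first by have : 0 <= L * nl (b - fv y) by [rewrite mulr_ge0 // ltW|]; move: h; lra.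
  move=> i; have : nl (b - fv y) <= eps.
    have : L * nl (b - fv y) <= L * eps by rewrite /L divfK ?gt_eqF //; move: h r0; rewrite /L; lra.
    by rewrite ler_pM2l.
  apply: le_trans; rewrite -rabsN opprB.
  have -> : F (f i) - f i y = (b - fv y) 0 i by rewrite !mxE.
  by rewrite /nl (bigD1 i) //= lerDl; apply: sumr_ge0 => j _; exact: rabs_ge0.
(* The demands with [l = 0] give [g (y, - fv y) >= 0], hence [g (0, fv y) <= rnorm y]; the one with
   [y = 0] and [l = 1] gives [g (0, b) >= C + 1]. *)
pose D : set ((Y * 'rV[K R s]_m) * R) := [set q | exists y (l : R), 0 <= l /\
  q = ((y, inK s l *: b - fv y), l * (C + 1))].
have fv0 : fv 0 = 0.
  by have := fvL (-1) 0 0; rewrite scaler0 addr0 scaleN1r addNr.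
have fvD u v : fv (u + v) = fv u + fv v by have := fvL 1 u v; rewrite !scale1r.
have fvZ a u : fv (a *: u) = a *: fv u by have := fvL a u 0; rewrite fv0 !addr0.
have DP : cone_below p D.
  split.
  - by exists 0, 0; rewrite inK0 scale0r fv0 subr0 mul0r.
  - move=> _ _ [y [l [l0 ->]]] [z [k [k0 ->]]]; exists (y + z), (l + k).
    by rewrite addr_ge0 // fvD inKD scalerDl mulrDl opprD addrACA.
  - move=> r _ r0 [y [l [l0 ->]]]; exists (inK s r *: y), (r * l).
    split; first by rewrite mulr_ge0 // ltW.
    by rewrite fvZ inKM -scalerA mulrA /= -scalerBr.
  - move=> _ [y [l [l0 ->]]] /=; move: l0; rewrite le_eqVlt => /orP[/eqP<-|l0].
      by rewrite mul0r /p addr_ge0 ?rnorm_ge0 // mulr_ge0 ?(ltW L0) // sumr_ge0 // => i _; exact: rabs_ge0.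
    have := far (inK s l^-1 *: y); rewrite -(ler_pM2l l0) -(sublinearZ _ pP l0).
    rewrite [inK s l *: _](_ : _ = (y, inK s l *: b - fv y)) //.
    congr (_, _); first by rewrite /= scalerA -inKM mulfV ?gt_eqF // inK1 scale1r.
    by rewrite /= scalerBr -fvZ scalerA -inKM mulfV ?gt_eqF // inK1 scale1r.
have [g [gL gp gD]] := separate pP DP.
have g0 : g 0 = 0.
  by have := gL.2 0 0; rewrite scaler0 mul0r.
have gN u : g (- u) = - g u by have := gL.2 (-1) u; rewrite inKN inK1 scaleN1r mulN1r.
have gy y : g (0, fv y) <= rnorm y.
  have h1 : D ((- y, fv y), 0).
    by exists (- y), 0; rewrite inK0 scale0r -scaleN1r fvZ !scaleN1r sub0r opprK mul0r.
  have h2 : D ((y, - fv y), 0).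
    by exists y, 0; rewrite inK0 scale0r sub0r mul0r.
  have := gp (y, 0); rewrite /p /=; have -> : nl 0 = 0.
    by rewrite /nl big1 // => i _; rewrite mxE rabs0.
  rewrite mulr0 addr0; apply: le_trans.
  have -> : (y, 0) = (y, - fv y) + (0, fv y) :> Y * 'rV[K R s]_m.
    by congr (_, _); rewrite /= ?addr0 // addNr.
  by rewrite gL.1 lerDr; exact: gD h2.
have gb : C + 1 <= g (0, b).
  by have := gD ((0, b), C + 1); apply; exists 0, 1; rewrite inK1 scale1r fv0 subr0 mul1r.
have GL : real_linear (s := s) (fun c : 'rV[K R s]_m => g (0, c)).
  split=> [u v|r u].
    by rewrite -gL.1; congr g; congr (_, _); rewrite /= addr0.
  by rewrite -gL.2; congr g; congr (_, _); rewrite /= scaler0.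
have [G [Gl GE]] := complexify GL.
have Gsum := lin_rowE Gl.
pose l i := G (delta_mx 0 i).
have [hd hF] := bidual_comb l fd.
have hE y : \sum_(i < m) l i * f i y = G (fv y).
  by rewrite Gsum; apply: eq_bigr => i _; rewrite mxE mulrC.
have FE : F (fun x => \sum_(i < m) l i * f i x) = G b.
  by rewrite hF Gsum; apply: eq_bigr => i _; rewrite mxE mulrC.
have hb : dual_ball 1 (fun x => \sum_(i < m) l i * f i x).
  apply: dual_ball_of_real_part => [a u v|u]; last by rewrite hE GE mul1r.
  by rewrite !hE fvL Gl.
have := FC ler01 hb; rewrite FE => h.
have := real_part_le_rabs (G b); rewrite GE; move: gb h; lra.
Qed.

(* Separation in ['rV_m] gives a combination [z] of the [y i] such that
   [|F h - h z| <= tau |h|] for all [h]. *)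
Lemma annihilating_functional m (y : 'I_m -> Y) (tau eps : R) : 0 < tau -> 0 < eps ->
  (forall y, exists b h, [/\ 0 <= b, dual_ball b h & tau * b < rabs (F h - h y)]) ->
  exists f, [/\ dual_ball 1 f, forall i, rabs (f (y i)) <= eps & tau < rabs (F f)].
Proof.
move=> tau0 eps0 far; apply: contrapT => nf; pose L := tau / eps.
have L0 : 0 < L by rewrite divr_gt0.
have FZ a f : dual f -> F (fun x => a * f x) = a * F f.
  move=> fd; have := FL a fd (dual_ball0 Y).1; rewrite bidual0 addr0 => <-.
  by congr F; apply/funext => x; rewrite addr0.
have ballZ a (b : R) (f : Y -> K R s) : dual_ball b f -> dual_ball (rabs a * b) (fun x => a * f x).
  move=> fb; have := dual_ball_lin a fb (dual_ball0 Y); rewrite addr0.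
  by congr dual_ball; apply/funext => x; rewrite addr0.
(* If this failed for [h], then [h] divided by [n'] would be the functional sought. The margin
   [e / tau] keeps the divisor positive when [b] and [S] vanish. *)
have small b h : 0 <= b -> dual_ball b h ->
    rabs (F h) <= tau * b + L * \sum_i rabs (h (y i)).
  move=> b0 hb; set S := \sum_i _.
  have S0 : 0 <= S by apply: sumr_ge0 => i _; exact: rabs_ge0.
  pose n := b + S / eps.
  have n0 : 0 <= n by rewrite addr_ge0 // divr_ge0 // ltW.
  have -> : tau * b + L * S = tau * n by rewrite /n /L; field; rewrite gt_eqF.
  apply/ler_addgt0Pr => e e0; pose n' := n + e / tau.
  have n'0 : 0 < n' by rewrite ltr_wpDl // divr_gt0.
  have nn' : n <= n' by rewrite lerDl divr_ge0 // ltW.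
  have -> : tau * n + e = tau * n' by rewrite /n'; field; rewrite gt_eqF.
  rewrite leNgt; apply/negP => hF; apply: nf.
  exists (fun x => inK s n'^-1 * h x); split.
  - apply: dual_ball_le (ballZ _ _ _ hb); rewrite rabs_inK gtr0_norm ?invr_gt0 //.
    rewrite ler_pdivrMl // mulr1; apply: le_trans nn'.
    by rewrite lerDl divr_ge0 // ltW.
  - move=> i; rewrite rabsM rabs_inK gtr0_norm ?invr_gt0 // ler_pdivrMl //.
    have : rabs (h (y i)) <= S.
      by rewrite /S (bigD1 i) //= lerDl; apply: sumr_ge0 => j _; exact: rabs_ge0.
    move/le_trans; apply; rewrite -ler_pdivrMr //; apply: le_trans nn'.
    by rewrite lerDr.
  - rewrite FZ; last exact: hb.1.
    by rewrite rabsM rabs_inK gtr0_norm ?invr_gt0 // ltr_pdivlMl // mulrC.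
pose nl (c : 'rV[K R s]_m) : R := L * \sum_i rabs (c 0 i).
have pP : sublinear (s := s) nl.
  split=> [u v|r u r0].
    rewrite /nl -mulrDr ler_pM2l // -big_split; apply: ler_sum => i _ /=; rewrite mxE; exact: rabsD.
  rewrite /nl mulrCA; apply: ler_wpM2l; first exact: ltW.
  rewrite mulr_sumr; apply: ler_sum => i _; by rewrite mxE rabsM rabs_inK gtr0_norm.
pose ev (h : Y -> K R s) : 'rV[K R s]_m := \row_i h (y i).
(* A functional meeting these demands sends [ev h] to the real part of [h z] for a fixed combination
   [z] of the [y i]. The real part of [F h - h z] is then at most [tau * b] for all [h], and a
   rotation of [h] contradicts [far]. *)
pose D : set ('rV[K R s]_m * R) := [set q | exists h (b : R), [/\ 0 <= b, dual_ball b h &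
  q = (ev h, real_part (F h) - tau * b)]].
have DP : cone_below nl D.
  split.
  - exists (fun=> 0), 0; split=> //; first exact: dual_ball0.
    rewrite bidual0 mulr0 subr0 raddf0; congr (_, _).
    by apply/rowP => i; rewrite !mxE.
  - move=> _ _ [h [b [b0 hb ->]]] [k [c [c0 kc ->]]].
    exists (fun x => 1 * h x + k x), (b + c); split; first exact: addr_ge0.
      by have := dual_ball_lin 1 hb kc; rewrite rabs1 mul1r.
    rewrite FL; [|exact: hb.1|exact: kc.1].
    congr (_, _); first by apply/rowP => i; rewrite !mxE mul1r.
    by rewrite /= mul1r raddfD /=; ring.
  - move=> r _ r0 [h [b [b0 hb ->]]].
    exists (fun x => inK s r * h x), (r * b); split; first by rewrite mulr_ge0 // ltW.
      by have := ballZ (inK s r) _ _ hb; rewrite rabs_inK gtr0_norm.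
    rewrite FZ; last exact: hb.1.
    congr (_, _); first by apply/rowP => i; rewrite !mxE.
    by rewrite /= real_partZ; ring.
  - move=> _ [h [b [b0 hb ->]]] /=; rewrite lerBlDr addrC.
    apply: le_trans (real_part_le_rabs _) _; apply: le_trans (small b h b0 hb) _.
    by rewrite /nl lerD2l; under [X in _ <= _ * X]eq_bigr do rewrite mxE.
have [g [gL gp gD]] := separate pP DP.
have [G [Gl GE]] := complexify gL.
pose z := \sum_i G (delta_mx 0 i) *: y i.
have [b [h [b0 hb hz]]] := far z.
have [u u1 uE] := rabs_phase (F h - h z).
have uhb : dual_ball b (fun x => u * h x) by have := ballZ u _ _ hb; rewrite u1 mul1r.
have hl := hb.1.1.
have h0 : h 0 = 0 by have := hl (-1) 0 0; rewrite scaler0 addr0 scaleN1r addNr.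
have evz : G (ev (fun x => u * h x)) = u * h z.
  rewrite (lin_rowE Gl) /z.
  have hs (r : seq 'I_m) : h (\sum_(i <- r) G (delta_mx 0 i) *: y i) =
      \sum_(i <- r) G (delta_mx 0 i) * h (y i).
    elim: r => [|i r IH]; first by rewrite !big_nil.
    by rewrite !big_cons hl IH.
  rewrite hs mulr_sumr; apply: eq_bigr => i _; rewrite mxE; ring.
have hD : D (ev (fun x => u * h x), real_part (F (fun x => u * h x)) - tau * b).
  by exists (fun x => u * h x), b.
have := gD _ hD; rewrite /= -GE evz FZ; last exact: hb.1.
have e : real_part (u * F h) - real_part (u * h z) = rabs (F h - h z).
  by rewrite -raddfB -mulrBr uE; exact: inKK.
by rewrite lerBlDl -lerBlDr e leNgt hz.
Qed.

(** Otherwise there are vectors approximating [F] to within 1/(k+1) on norm-one functionals. Norming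
    functionals show that they form a Cauchy sequence, and the limit in the complete space [Y] would
    represent [F]. *)
Lemma bidual_far : (forall x, exists2 f, dual f & F f <> f x) ->
  exists2 tau : R, 0 < tau &
    forall y, exists b h, [/\ 0 <= b, dual_ball b h & tau * b < rabs (F h - h y)].
Proof.
move=> nF; apply: contrapT => nfar.
have /choice[y yP] : forall k : nat, exists y : Y, forall b h, 0 <= b -> dual_ball b h ->
    rabs (F h - h y) <= k.+1%:R^-1 * b.
  move=> k; apply: contrapT => ny; apply: nfar; exists k.+1%:R^-1; first by rewrite invr_gt0.
  move=> y; apply: contrapT => nbh; apply: ny; exists y => b h b0 hb.
  by rewrite leNgt; apply/negP => hh; apply: nbh; exists b, h.
have yC k l : rnorm (y k - y l) <= k.+1%:R^-1 + l.+1%:R^-1.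
  have [h [hd hb <-]] := norming_functional (y k - y l).
  have hball : dual_ball 1 h by split=> // x; rewrite mul1r.
  have hB u v : h (u - v) = h u - h v.
    by have := hd.1 (-1) v u; rewrite scaleN1r (addrC _ u) => ->; rewrite /GRing.scale /= mulN1r addrC.
  rewrite hB (_ : _ - _ = - (F h - h (y k)) + (F h - h (y l))); last by ring.
  apply: le_trans (real_part_le_rabs _) _; apply: le_trans (rabsD _ _) _; rewrite rabsN.
  by apply: lerD; rewrite -[X in _ <= X]mulr1; exact: yP.
have small (e : R) : 0 < e -> exists k, k.+1%:R^-1 < e.
  move=> e0; exists (Num.trunc e^-1); rewrite invf_plt ?posrE //; exact: truncnS_gt.
have ycvg : cvg (y @ \oo).
  apply: cauchy_cvg; apply/cauchyP => e e0.
  have eE : e = inK s (rabs e) by rewrite -norm_inK gtr0_norm.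
  have re0 : 0 < rabs e by rewrite -(inK_lt (s := s)) inK0 -eE.
  have [k kP] := small (rabs e / 2) (divr_gt0 re0 (ltr0Sn _ 1)).
  exists (y k); exists k => // l /= kl.
  rewrite -ball_normE /= normE eE inK_lt; apply: le_lt_trans (yC k l) _.
  have : l.+1%:R^-1 <= k.+1%:R^-1 :> R by rewrite lef_pV2 ?posrE // ler_nat ltnS.
  by move: kP; set u : R := k.+1%:R^-1; set v : R := l.+1%:R^-1; lra.
have [h hd] := nF (lim (y @ \oo)); case; set l := lim _.
have [b b0 hb] := dual_bound hd.
have hball : dual_ball b h by [].
apply/eqP; rewrite -subr_eq0 -rabs_eq0 eq_le rabs_ge0 andbT.
apply/ler_addgt0Pr => e e0; rewrite add0r.
have e1 : 0 < e / (2 * b) by rewrite divr_gt0 // mulr_gt0.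
have [k kP] := small _ e1.
have /cvgrPdist_lt/(_ (inK s (e / (2 * b)))) := ycvg.
rewrite -[X in X < _](inK0 (s := s)) inK_lt => /(_ e1)[m _ mP].
pose i := maxn k m; have := mP i (leq_maxr _ _); rewrite /= normE inK_lt -/l => il.
have ik : i.+1%:R^-1 <= k.+1%:R^-1 :> R by rewrite lef_pV2 ?posrE // ler_nat ltnS leq_maxl.
have hB u v : h u - h v = h (u - v).
  by have := hd.1 (-1) v u; rewrite scaleN1r (addrC _ u) => ->; rewrite /GRing.scale /= mulN1r addrC.
rewrite (_ : F h - h l = (F h - h (y i)) - h (l - y i)); last by rewrite -hB; ring.
apply: le_trans (rabsD _ _) _; rewrite rabsN.
apply: le_trans (lerD (yP i b h (ltW b0) hball) (hb (l - y i))) _.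
rewrite mulrC -mulrDr.
have eE : e = b * (e / (2 * b) + e / (2 * b)) by field; rewrite gt_eqF.
by rewrite [X in _ <= X]eE ler_pM2l //; apply: lerD; apply: ltW => //; exact: le_lt_trans kP.
Qed.

(** Alternating choice: a functional almost vanishing on the vectors found so far, with [F] still
    large on it, and then by [helly] a vector at which all the functionals, the new one included,
    nearly take their values under [F]. *)
Lemma biorthogonal_sequence (tau eps : R) N : 0 < tau -> 0 < eps ->
  (forall y, exists b h, [/\ 0 <= b, dual_ball b h & tau * b < rabs (F h - h y)]) ->
  exists (y : nat -> Y) (f : nat -> Y -> K R s),
    [/\ forall i, (i < N)%N -> rnorm (y i) <= C + 1,
        forall i, (i < N)%N -> dual_ball 1 (f i) /\ tau < rabs (F (f i)),
        forall i j, (i < j < N)%N -> rabs (f j (y i)) <= eps &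
        forall i j, (j <= i < N)%N -> rabs (f j (y i) - F (f j)) <= eps].
Proof.
move=> tau0 eps0 far; elim: N => [|N [y [f [yC fB fy1 fy2]]]].
  by exists (fun=> 0), (fun _ _ => 0); split=> // i j; rewrite ltn0 andbF.
have [g [gB gy Fg]] := annihilating_functional (fun i : 'I_N => y i) tau0 eps0 far.
pose f' j := if j == N then g else f j.
have f'd (j : 'I_N.+1) : dual (f' j).
  rewrite /f'; case: eqP => [_|/eqP jN]; first exact: gB.1.
  by apply: (fB j _).1.1; rewrite ltn_neqAle jN -ltnS ltn_ord.
have [z [zC zf]] := helly eps0 f'd.
pose y' i := if i == N then z else y i.
have lt i : (i < N.+1)%N -> i <> N -> (i < N)%N.
  by move=> iN /eqP h; rewrite ltn_neqAle h -ltnS.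
exists y', f'; split=> [i iN|i iN|i j /andP[ij jN]|i j /andP[ji iN]].
- by rewrite /y'; case: eqP => // /(lt _ iN); exact: yC.
- by rewrite /f'; case: eqP => // /(lt _ iN); exact: fB.
- have iN' : (i < N)%N by exact: leq_trans ij _.
  rewrite /y' ltn_eqF //= /f'; case: eqP => [_|/(lt _ jN) jN'].
    exact: (gy (Ordinal iN')).
  by apply: fy1; rewrite ij.
- rewrite /y'; case: eqP => [iE|/(lt _ iN) iN'].
    by have jN : (j < N.+1)%N by [rewrite ltnS -iE]; exact: (zf (Ordinal jN)).
  rewrite /f' (ltn_eqF (leq_ltn_trans ji iN')) /=.
  by apply: fy2; rewrite ji.
Qed.

End NonReflexive.

(** Up to [eps * A], with [A] the [l1] size of [a], the [k]-th functional sends the combination [z]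
    to [phi k] times the tail sum [S k]. The error is absorbed because each [a i] is a difference of
    two tail sums: [tau * A <= 2 * N * (rnorm z + eps * A)], and [tau = 4 * N * eps] gives
    [eps * A <= rnorm z]. *)
Lemma james_of_biorthogonal Y (tau C : R) N (y : nat -> Y) (f : nat -> Y -> K R s)
    (phi : nat -> K R s) : 0 < tau -> 0 < C ->
  (forall i, (i < N)%N -> rnorm (y i) <= C) ->
  (forall j, (j < N)%N -> dual_ball 1 (f j) /\ tau < rabs (phi j)) ->
  (forall i j, (i < j < N)%N -> rabs (f j (y i)) <= tau / (4 * N%:R)) ->
  (forall i j, (j <= i < N)%N -> rabs (f j (y i) - phi j) <= tau / (4 * N%:R)) ->
  james_system Y (tau / (2 * C)) N.
Proof.
move=> tau0 C0 yC fB fy1 fy2.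
case: (posnP N) => [->|N0].
  exists (fun=> 0); split=> [i|a j]; first by rewrite rnorm0.
  by rewrite !big_ord0 rabs0 mulr0 rnorm_ge0.
have NR : 0 < N%:R :> R by rewrite ltr0n.
set eps := tau / _ in fy1 fy2.
have epsN : eps * (4 * N%:R) = tau by rewrite divfK // gt_eqF // mulr_gt0.
have eps0 : 0 < eps by rewrite divr_gt0 // mulr_gt0.
exists (fun i => inK s C^-1 *: y i); split=> [i|a j].
  by rewrite rnormZ_inK gtr0_norm ?invr_gt0 // ler_pdivrMl // mulr1 yC.
have -> : \sum_(i < N) a i *: (inK s C^-1 *: y i) = inK s C^-1 *: \sum_(i < N) a i *: y i.
  by rewrite scaler_sumr; apply: eq_bigr => i _; rewrite !scalerA mulrC.
rewrite rnormZ_inK gtr0_norm ?invr_gt0 //.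
set z := \sum_(i < N) a i *: y i; pose A := l1 a.
have A0 : 0 <= A by exact: l1_ge0.
pose S (j : nat) := \sum_(i < N | (j <= i)%N) a i.
have Sb k : tau * rabs (S k) <= rnorm z + eps * A.
  case: (ltnP k N) => kN; last first.
    rewrite /S big_pred0; first by rewrite rabs0 mulr0 addr_ge0 ?rnorm_ge0 // mulr_ge0 // ltW.
    by move=> i; apply/negbTE; rewrite -ltnNge; apply: leq_trans kN.
  have [[fd fb] phik] := fB k kN.
  have f0 : f k 0 = 0 by have := fd.1 (-1) 0 0; rewrite scaler0 addr0 scaleN1r addNr.
  have fz : f k z = \sum_(i < N) a i * f k (y i).
    rewrite /z; elim: (index_enum _) => [|i r IH]; first by rewrite !big_nil.
    by rewrite !big_cons fd.1 IH.
  have e : phi k * S k = f k z - \sum_(i < N) a i * (f k (y i) - (if (k <= i)%N then phi k else 0)).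
    rewrite fz -sumrB /S big_mkcond mulr_sumr; apply: eq_bigr => i _.
    by case: ifP => _; ring.
  apply: (@le_trans _ _ (rabs (phi k * S k))).
    by rewrite rabsM ler_wpM2r ?rabs_ge0 // ltW.
  rewrite e; apply: le_trans (rabsD _ _) _; rewrite rabsN; apply: lerD.
    by apply: le_trans (fb z) _; rewrite mul1r.
  rewrite /A /l1 mulr_sumr.
  have rs (r : seq 'I_N) (G : 'I_N -> K R s) : rabs (\sum_(i <- r) G i) <= \sum_(i <- r) rabs (G i).
    elim: r => [|i r IH]; first by rewrite !big_nil rabs0.
    by rewrite !big_cons; apply: le_trans (rabsD _ _) _; rewrite lerD2l.
  apply: le_trans (rs _ _) _; apply: ler_sum => i _; rewrite rabsM mulrC.
  apply: ler_wpM2r; first exact: rabs_ge0.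
  case: ifP => ki; first by apply: fy2; rewrite ki ltn_ord.
  by rewrite subr0; apply: fy1; rewrite ltnNge ki.
have aS (i : 'I_N) : a i = S i - S i.+1.
  rewrite /S (bigD1 i) //= [X in _ + X - _](eq_bigl (fun k : 'I_N => (i < k)%N)) ?addrK //.
  by move=> k; rewrite ltn_neqAle andbC eq_sym.
have AB : tau * A <= 2 * N%:R * (rnorm z + eps * A).
  have -> : 2 * N%:R * (rnorm z + eps * A) = \sum_(i < N) 2 * (rnorm z + eps * A).
    by rewrite sumr_const card_ord -[RHS]mulr_natl; ring.
  rewrite {1}/A /l1 mulr_sumr; apply: ler_sum => i _; rewrite aS.
  have := ler_wpM2l (ltW tau0) (rabsD (S i) (- S i.+1)); rewrite rabsN mulrDr.
  by have := Sb i; have := Sb i.+1; lra.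
have AZ : eps * A <= rnorm z.
  have : 4 * N%:R * (eps * A) <= 2 * N%:R * (rnorm z + eps * A).
    by rewrite mulrA (mulrC _ eps) epsN.
  rewrite -subr_ge0 (_ : _ - _ = (2 * N%:R) * (rnorm z - eps * A)); last by ring.
  by rewrite pmulr_rge0 ?mulr_gt0 // subr_ge0.
rewrite -/(S j) (_ : _ * rabs (S j) = C^-1 * (tau / 2 * rabs (S j))); last first.
  by field; rewrite gt_eqF.
by rewrite ler_pM2l ?invr_gt0 //; have := Sb j; lra.
Qed.

Lemma james_of_not_reflexive Y : ~ reflexive_space Y ->
  exists2 th : R, 0 < th & forall N, james_system Y th N.
Proof.
move=> /existsNP[F /not_implyP[[FL [C0 FC0]] nF]].
pose C := `|C0| + 1.
have Cp : 0 < C by rewrite ltr_wpDl.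
have FC b f : 0 <= b -> dual_ball b f -> rabs (F f) <= C * b.
  move=> b0 [fd fb]; apply: le_trans (FC0 f fd) _.
  have h1 := dual_norm_le fb b0.
  have h2 : 0 <= dual_norm f.
    apply: le_trans (dual_norm_ge (u := 0) fd _); first exact: rabs_ge0.
    by rewrite rnorm0.
  apply: (@le_trans _ _ (C * dual_norm f)); last by rewrite ler_pM2l.
  rewrite ler_wpM2r //; apply: le_trans (ler_norm _) _; by rewrite lerDl.
have {}nF x : exists2 f, dual f & F f <> f x.
  apply: contrapT => nf; apply: nF; exists x => f fd.
  by apply: contrapT => h; apply: nf; exists f.
have [tau tau0 far] := bidual_far nF.
have C10 : 0 < C + 1 by rewrite addr_gt0.
exists (tau / (2 * (C + 1))) => [|N]; first by rewrite divr_gt0 // mulr_gt0.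
have [->|N0] := posnP N.
  exists (fun=> 0); split=> [i|a j]; first by rewrite rnorm0.
  by rewrite !big_ord0 rabs0 mulr0 rnorm_ge0.
have eps0 : 0 < tau / (4 * N%:R) by rewrite divr_gt0 // mulr_gt0 // ltr0n.
have [y [f [h1 h2 h3 h4]]] := biorthogonal_sequence FL Cp FC N tau0 eps0 far.
exact: (james_of_biorthogonal tau0 C10 h1 h2 h3 h4).
Qed.

(** Representability with distortion 2 suffices: the images are halved to return to the unit ball,
    which halves [th]. *)
Lemma james_of_not_superreflexive X : ~ superreflexive X ->
  exists2 th : R, 0 < th & forall N, james_system X th N.
Proof.
move=> /existsNP[Y /not_implyP[YX /james_of_not_reflexive[th th0 YJ]]].
exists (th / 2) => [|N]; first by rewrite divr_gt0.
have [y [y1 yP]] := YJ N; have [T [TL TB]] := YX 1 N y ltr01.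
have span0 : lin_span y 0.
  by exists (fun=> 0); rewrite big1 // => i _; rewrite scale0r.
have T0 : T 0 = 0.
  by have := TL (-1) _ _ span0 span0; rewrite scaler0 addr0 scaleN1r addNr.
have spany i : lin_span y (y i).
  exists (fun j => (j == i)%:R); rewrite (bigD1 i) //= eqxx scale1r big1 ?addr0 //.
  by move=> j /negbTE->; rewrite scale0r.
have spanL a u v : lin_span y u -> lin_span y v -> lin_span y (a *: u + v).
  move=> [b ->] [d ->]; exists (fun i => a * b i + d i).
  by rewrite scaler_sumr -big_split; apply: eq_bigr => i _; rewrite scalerDl scalerA.
exists (fun i => inK s 2^-1 *: T (y i)); split=> [i|a j].
  rewrite rnormZ_inK gtr0_norm // ler_pdivrMl // mulr1.
  have /andP[_ h] := TB _ (spany i); apply: le_trans h _.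
  by have := y1 i; lra.
have Tsum (r : seq 'I_N) : T (\sum_(i <- r) a i *: y i) = \sum_(i <- r) a i *: T (y i) /\
    lin_span y (\sum_(i <- r) a i *: y i).
  elim: r => [|i r [IH1 IH2]]; first by rewrite !big_nil.
  by rewrite !big_cons TL // IH1; split=> //; exact: spanL.
have -> : \sum_(i < N) a i *: (inK s 2^-1 *: T (y i)) = inK s 2^-1 *: T (\sum_(i < N) a i *: y i).
  by rewrite (Tsum _).1 scaler_sumr; apply: eq_bigr => i _; rewrite !scalerA mulrC.
rewrite rnormZ_inK gtr0_norm //; have [_ /TB/andP[h _]] := Tsum (index_enum _).
by have := yP a j; move: h; lra.
Qed.

End James.

(** * Dyadic averages *)

Section Flip.
Context {n : nat}.
Implicit Types (w : Omega n) (k : 'I_n).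

Definition flip k w : Omega n := [ffun i => if i == k then ~~ w i else w i].

Lemma flipK k : involutive (flip k).
Proof. by move=> w; apply/ffunP => i; rewrite !ffunE; case: eqP => // _; rewrite negbK. Qed.

Lemma flip_agree k w : agree k w (flip k w).
Proof. by apply/agreeP => i ik; rewrite ffunE -val_eqE /= ltn_eqF. Qed.

Lemma sum_flip (V : nmodType) k (F : Omega n -> V) : \sum_w F (flip k w) = \sum_w F w.
Proof. by rewrite [RHS](reindex_inj (inv_inj (flipK k))). Qed.

(** Flipping the [k]-th sign negates each cross term that contains it once. *)
Lemma rademacher_orthogonal (R : realType) (g : 'I_n -> R) :
  \sum_(e : Omega n) (\sum_k sgn R (e k) * g k) ^+ 2 = #|Omega n|%:R * \sum_k g k ^+ 2.
Proof.
have sgnN b : sgn R (~~ b) = - sgn R b by case: b; rewrite /sgn /= ?expr0 ?expr1 ?opprK.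
have cross k l : k != l -> \sum_(e : Omega n) sgn R (e k) * sgn R (e l) = 0.
  move=> kl; set S := (LHS); suff : S = - S by lra.
  rewrite {1}/S -(sum_flip k) -sumrN; apply: eq_bigr => e _.
  rewrite !ffunE eqxx (negbTE (_ : l != k)); last by rewrite eq_sym.
  by rewrite sgnN mulNr.
under eq_bigr do rewrite expr2 big_distrlr /=.
rewrite exchange_big mulr_sumr /=; apply: eq_bigr => k _.
rewrite exchange_big (bigD1 k) //= [X in _ + X]big1 ?addr0.
  rewrite (eq_bigr (fun=> g k ^+ 2)) => [|e _]; first by rewrite sumr_const [RHS]mulr_natl.
  rewrite mulrACA -!expr2 (_ : sgn R (e k) ^+ 2 = 1) ?mul1r // /sgn.
  by case: (e k); rewrite ?expr0 ?expr1 ?sqrrN expr1n.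
move=> l lk; under eq_bigr do rewrite mulrACA.
by rewrite -mulr_suml cross 1?eq_sym // mul0r.
Qed.

End Flip.

Section DyadicMartingale.
Context {R : realType} {s : scalars} {X : completeNormedModType (K R s)} {n : nat}.
Variable x : 'I_(2 ^ n) -> X.
Implicit Types (w : Omega n).

(** The default [false] makes [pos] total on [nat]; it does not affect ranks up to [n]. *)
Definition bit w (k : nat) : bool := if insub k is Some i then w i else false.

Lemma bitE w (k : 'I_n) : bit w k = w k.
Proof. by rewrite /bit valK. Qed.

(* The dyadic interval of rank [k] that contains the path [w] is the [pos w k]-th. *)
Fixpoint pos w (k : nat) : nat :=
  if k is k'.+1 then ((pos w k').*2 + bit w k')%N else 0.

Lemma pos_adapted k w u : (k <= n)%N -> agree k w u -> pos w k = pos u k.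
Proof.
elim: k => //= k IH kn wu; rewrite (IH (ltnW kn)); last exact: agree_le wu.
by congr (_ + _)%N; rewrite (bitE w (Ordinal kn)) (bitE u (Ordinal kn)) (agreeP _ _ _ wu).
Qed.

Lemma pos_divE w k m : (pos w (k + m) %/ 2 ^ m)%N = pos w k.
Proof.
elim: m => [|m IH]; first by rewrite addn0 divn1.
rewrite addnS expnS divnMA /= -IH; congr (_ %/ _)%N.
by rewrite divn2 halfD doubleK odd_double /=; case: (bit _ _); rewrite ?addn0.
Qed.

Lemma pos_lt w k : (pos w k < 2 ^ k)%N.
Proof.
elim: k => //= k IH; rewrite expnS mul2n.
by apply: leq_trans (_ : (pos w k).+1.*2 <= _)%N; [rewrite doubleS; case: bit; lia|rewrite leq_double].
Qed.

Definition avg_weight (k : nat) w (i : 'I_(2 ^ n)) : R :=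
  (2 ^ (n - k))%:R^-1 * (i %/ 2 ^ (n - k) == pos w k)%N%:R.

Definition dyadic_avg (k : nat) w : X := \sum_i inK s (avg_weight k w i) *: x i.

(** Flipping coordinate [k] exchanges the two halves of the interval of rank [k], on each of which
    the uniform weight is twice as large. *)
Lemma avg_weight_flip (k : 'I_n) w i :
  avg_weight k.+1 w i + avg_weight k.+1 (flip k w) i = 2 * avg_weight k w i.
Proof.
have kn := ltn_ord k; rewrite /avg_weight.
have -> : (n - k = (n - k.+1).+1)%N by rewrite subnSK.
set m := (n - k.+1)%N; rewrite expnSr divnMA natrM invfM -mulrDr -natrD.
have -> : 2 * ((2 ^ m)%:R^-1 * 2^-1 * (i %/ 2 ^ m %/ 2 == pos w k)%N%:R) =
    (2 ^ m)%:R^-1 * (i %/ 2 ^ m %/ 2 == pos w k)%N%:R :> R by field; rewrite pnatr_eq0 expn_eq0.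
congr (_ * _%:R); rewrite /= -(pos_adapted (ltnW kn) (flip_agree k w)) !bitE ffunE eqxx divn2.
set q := (i %/ 2 ^ m)%N; have := odd_double_half q.
by case: (w k) => /=; case: eqP; case: eqP; case: eqP; case: (odd q) => /=; lia.
Qed.

Lemma dyadic_avg_flip (k : 'I_n) w :
  dyadic_avg k.+1 w + dyadic_avg k.+1 (flip k w) = dyadic_avg k w *+ 2.
Proof.
rewrite /dyadic_avg -big_split -sumrMnl; apply: eq_bigr => i _ /=.
by rewrite -scalerDl -inKD avg_weight_flip inKM inK_nat -scalerA scaler_nat.
Qed.

Lemma dyadic_avg_martingale (z : X) : walsh_paley_martingale (fun k w => dyadic_avg k w - z).
Proof.
have ad k : (k <= n)%N -> adapted k (fun w => dyadic_avg k w).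
  move=> kn w u wu; apply: eq_bigr => i _.
  by rewrite /avg_weight (pos_adapted kn wu).
have adz j : adapted (n := n) j (fun=> z) by [].
apply: walsh_paleyP => k kn; first by move=> w u /ad->.
apply: condexpB; last exact: condexp_adapted.
split=> [|w]; first exact/ad/ltnW.
pose k' := Ordinal kn.
apply/eqP; rewrite -subr_eq0 -rnorm_eq0.
(* Doubling the sum over an atom allows each path to be paired with its flip, which stays in the
   same atom. *)
have two (u : X) : rnorm (u *+ 2) = 0 -> rnorm u == 0.
  by rewrite rnormMn => /eqP; rewrite mulf_eq0 pnatr_eq0.
apply: two; rewrite mulrnBl mulr2n.
have -> : \sum_(u | agree k w u) dyadic_avg k.+1 u + \sum_(u | agree k w u) dyadic_avg k.+1 u =
    \sum_(u | agree k w u) (dyadic_avg k.+1 u + dyadic_avg k.+1 (flip k' u)).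
  rewrite big_split /=; congr (_ + _).
  rewrite (reindex_inj (inv_inj (flipK k'))) /=; apply: eq_bigl => u.
  have h := flip_agree k' u; apply/idP/idP => wu.
    by apply: agree_trans wu _; rewrite agree_sym.
  exact: agree_trans wu h.
under eq_bigr do rewrite (dyadic_avg_flip k').
by rewrite sumrMnl subrr rnorm0.
Qed.

(** The coefficient that the [k]-th increment contributes when the James inequality is applied with
    its tail starting at [pos w n]. *)
Definition tail_weight (k : nat) w : R :=
  \sum_(i < 2 ^ n | (pos w n <= i)%N) (avg_weight k.+1 w i - avg_weight k w i).

Lemma sum_ltn_ord N e : (e <= N)%N -> \sum_(i < N) (i < e)%:R = e%:R :> R.
Proof.
move=> eN; rewrite -[RHS]mulr1n -[in RHS](card_ord e) -sumr_const (big_ord_widen N (fun=> 1)) //.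
by rewrite [RHS]big_mkcond; apply: eq_bigr => i _; case: (i < e)%N.
Qed.

(** The interval of rank [k] around the path has [D] points, contains [pos w n] and ends just before
    [e], so the tail cuts off the fraction [(e - pos w n) / D] of it. *)
Lemma tail_avg_weight k w : (k <= n)%N ->
  \sum_(i < 2 ^ n | (pos w n <= i)%N) avg_weight k w i = (pos w k).+1%:R - (pos w n)%:R / (2 ^ (n - k))%:R.
Proof.
move=> kn; rewrite /avg_weight -mulr_sumr; set D := (2 ^ (n - k))%N.
have D0 : (0 < D)%N by rewrite expn_gt0.
have jD : (pos w n %/ D)%N = pos w k by rewrite -[in LHS](subnKC kn) pos_divE.
set e := ((pos w k).+1 * D)%N.
have je : (pos w n <= e)%N by rewrite ltnW // /e -ltn_divLR // jD.
have eN : (e <= 2 ^ n)%N by rewrite -(subnKC kn) expnD leq_mul2r pos_lt orbT.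
have -> : \sum_(i < 2 ^ n | (pos w n <= i)%N) (i %/ D == pos w k)%N%:R =
    \sum_(i < 2 ^ n) (i < e)%:R - \sum_(i < 2 ^ n) (i < pos w n)%:R :> R.
  rewrite -sumrB big_mkcond; apply: eq_bigr => i _.
  rewrite ltnNge; case: (leqP (pos w n) i) => ji /=; last first.
    by rewrite -ltnNge (leq_trans ji je) subrr.
  by rewrite subr0 -ltnNge /e -ltn_divLR // ltnS eqn_leq -{2}jD leq_div2r // andbT.
rewrite !sum_ltn_ord // ?(ltnW (pos_lt _ _)) // /e natrM; field.
by rewrite pnatr_eq0 -lt0n.
Qed.

Lemma tail_weightE (k : 'I_n) w : tail_weight k w =
  (pos w k)%:R + (w k)%:R - (pos w n)%:R / (2 ^ (n - k))%:R.
Proof.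
have kn := ltn_ord k; rewrite /tail_weight sumrB !tail_avg_weight ?(ltnW kn) //=.
have -> : (n - k = (n - k.+1).+1)%N by rewrite subnSK.
rewrite bitE -mul2n -!natr1 natrD natrM expnS natrM; field.
by rewrite pnatr_eq0 expn_eq0.
Qed.

(** The two positions first differ at rank [k.+1], by one; each further rank doubles the difference,
    since later bits coincide. *)
Lemma pos_flip (k : 'I_n) w m : (k < m <= n)%N ->
  (pos (flip k w) m)%:R - (pos w m)%:R =
  ((~~ w k)%:R - (w k)%:R) * (2 ^ (m - k.+1))%:R :> R.
Proof.
move=> /andP[]; elim: m => // m IH; rewrite ltnS leq_eqVlt => /orP[/eqP<- kn|km mn].
  rewrite /= -(pos_adapted (ltnW kn) (flip_agree k w)) !bitE ffunE eqxx subnn expn0 mulr1.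
  by rewrite !natrD; ring.
rewrite /= -!addnn !natrD.
have -> : bit (flip k w) m = bit w m.
  rewrite (bitE _ (Ordinal mn)) (bitE _ (Ordinal mn)) ffunE -val_eqE /=.
  by rewrite gtn_eqF.
have := IH km (ltnW mn); rewrite (subSn km) expnS natrM => h.
have -> : ((~~ w k)%:R - (w k)%:R) * (2 * (2 ^ (m - k.+1))%:R) =
  2 * ((pos (flip k w) m)%:R - (pos w m)%:R) :> R by rewrite h; ring.
by ring.
Qed.

(** Under the flip the term [w k] changes by 1 and the term with [pos w n] offsets half of it. Two
    numbers at distance 1/2 have squares adding up to at least 1/8. *)
Lemma tail_weight_flip (k : 'I_n) w :
  8^-1 <= tail_weight k w ^+ 2 + tail_weight k (flip k w) ^+ 2.
Proof.
have kn := ltn_ord k.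
have : (tail_weight k (flip k w) - tail_weight k w) ^+ 2 = 4^-1.
  rewrite !tail_weightE -(pos_adapted (ltnW kn) (flip_agree k w)) ffunE eqxx.
  have := @pos_flip k w n; rewrite kn leqnn => /(_ isT).
  have -> : (n - k = (n - k.+1).+1)%N by rewrite subnSK.
  set a : R := (pos (flip k w) n)%:R; set b : R := (pos w n)%:R.
  rewrite expnS natrM; set D : R := (2 ^ _)%:R => h.
  have D0 : D != 0 by rewrite pnatr_eq0 expn_eq0.
  have -> : (pos w k)%:R + (~~ w k)%:R - a / (2 * D) - ((pos w k)%:R + (w k)%:R - b / (2 * D)) =
     (~~ w k)%:R - (w k)%:R - (a - b) / (2 * D) :> R by field.
  by rewrite h; case: (w k) => /=; field.
move=> h; have := sqr_ge0 (tail_weight k w + tail_weight k (flip k w)).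
by move: h; rewrite sqrrB sqrrD; lra.
Qed.

Lemma sum_tail_weight (k : 'I_n) : #|Omega n|%:R / 16 <= \sum_w tail_weight k w ^+ 2.
Proof.
have h : \sum_(w : Omega n) 8^-1 <= \sum_w (tail_weight k w ^+ 2 + tail_weight k (flip k w) ^+ 2).
  by apply: ler_sum => w _; exact: tail_weight_flip.
rewrite big_split /= (sum_flip k (fun w => tail_weight k w ^+ 2)) sumr_const in h.
by move: h; rewrite -[X in X <= _]mulr_natl; lra.
Qed.

(** The start of the tail depends on the path [w] but not on the signs [e], so for fixed [w] the
    lower bound is a Rademacher sum with constant coefficients and orthogonality applies. *)
Lemma dyadic_energy (th : R) (z : X) : 0 < th ->
  (forall (a : 'I_(2 ^ n) -> K R s) (j : nat),
    th * rabs (\sum_(i < 2 ^ n | (j <= i)%N) a i) <= rnorm (\sum_(i < 2 ^ n) a i *: x i)) ->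
  th ^+ 2 * (#|Omega n|%:R ^+ 2 * n%:R / 16) <= transform_energy (fun k w => dyadic_avg k w - z).
Proof.
move=> th0 xP; rewrite /transform_energy.
rewrite -(pair_bigA _ (fun e w : Omega n =>
  rnorm (\sum_(k < n) sgn (K R s) (e k) *: (dyadic_avg k.+1 w - z - (dyadic_avg k w - z))) ^+ 2)) /=.
have pt (e w : Omega n) : th ^+ 2 * (\sum_(k < n) sgn R (e k) * tail_weight k w) ^+ 2 <=
    rnorm (\sum_(k < n) sgn (K R s) (e k) *: (dyadic_avg k.+1 w - z - (dyadic_avg k w - z))) ^+ 2.
  pose a i := \sum_(k < n) sgn R (e k) * (avg_weight k.+1 w i - avg_weight k w i).
  have -> : \sum_(k < n) sgn (K R s) (e k) *: (dyadic_avg k.+1 w - z - (dyadic_avg k w - z)) =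
      \sum_i inK s (a i) *: x i.
    under [RHS]eq_bigr do rewrite /a inK_sum scaler_suml.
    rewrite exchange_big; apply: eq_bigr => k _ /=.
    rewrite opprB addrA subrK /dyadic_avg -sumrB scaler_sumr; apply: eq_bigr => i _.
    rewrite -scalerBl -inKB scalerA inKM; congr (_ * _ *: _).
    by rewrite /sgn; case: (e k); rewrite ?expr0 ?expr1 ?inKN inK1.
  have := xP (fun i => inK s (a i)) (pos w n).
  rewrite -inK_sum rabs_inK (_ : \sum_(i | _) a i = \sum_(k < n) sgn R (e k) * tail_weight k w).
    move=> h; rewrite -[X in _ * X]real_normK ?num_real // -exprMn.
    by rewrite lerXn2r ?nnegrE ?rnorm_ge0 // mulr_ge0 // ltW.
  rewrite exchange_big; apply: eq_bigr => k _ /=.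
  by rewrite /tail_weight mulr_sumr.
apply: le_trans (ler_sum _ (fun e _ => ler_sum _ (fun w _ => pt e w))).
rewrite exchange_big /=.
under eq_bigr do rewrite -mulr_sumr rademacher_orthogonal.
rewrite -mulr_sumr; apply: ler_wpM2l; first exact: sqr_ge0.
rewrite -mulr_sumr expr2 -!mulrA; apply: ler_wpM2l => //.
rewrite exchange_big /=.
apply: le_trans (ler_sum _ (fun k _ => sum_tail_weight k)).
rewrite sumr_const card_ord -[X in _ <= X]mulr_natl; lra.
Qed.

Lemma dyadic_avg_last w : (forall i, rnorm (x i) <= 1) -> rnorm (dyadic_avg n w) <= 1.
Proof.
move=> x1; have pn := pos_lt w n; rewrite /dyadic_avg (bigD1 (Ordinal pn)) //= big1 ?addr0.
  by rewrite /avg_weight subnn expn0 divn1 eqxx invr1 mulr1 inK1 scale1r.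
move=> i ip; rewrite /avg_weight subnn expn0 divn1.
by rewrite (_ : (i == pos w n :> nat) = false) ?mulr0 ?inK0 ?scale0r //; exact/negbTE.
Qed.

End DyadicMartingale.

(** Subtracting the mean [z] of all the [x i] makes the martingale start at 0 and leaves terminal
    norms at most 2. Comparing [th ^+ 2 * n / 16] with [4 * b ^+ 2] yields the factor [th / 8]. *)
Lemma james_RUMD (R : realType) (s : scalars) (X : completeNormedModType (K R s)) (th : R) :
  0 < th -> (forall N, james_system X th N) ->
  forall n (b : R), 0 <= b -> RUMD_bound X n b -> th / 8 * Num.sqrt n%:R <= b.
Proof.
move=> th0 XJ n b b0 /(RUMD_boundP _ b0) hb.
have [x [x1 xP]] := XJ (2 ^ n)%N.
have C0 := card_Omega_gt0 (R := R) n.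
pose w0 : Omega n := [ffun=> false]; pose z := dyadic_avg x 0 w0.
have zE w : dyadic_avg x 0 w = z by apply: eq_bigr => i _; rewrite /avg_weight.
have M0 w : dyadic_avg x 0 w - z = 0 by rewrite zE subrr.
have h1 := dyadic_energy z th0 xP.
have h2 := hb _ (dyadic_avg_martingale x z) M0.
have h3 : sqnorm (fun w => dyadic_avg x n w - z) <= #|Omega n|%:R * 4.
  rewrite mulr_natl -sumr_const; apply: ler_sum => w _.
  rewrite (_ : 4 = 2 ^+ 2 :> R); last by rewrite -natrX.
  rewrite lerXn2r ?nnegrE ?rnorm_ge0 //.
  apply: le_trans (rnormB _ _) _; rewrite (_ : 2 = 1 + 1 :> R) //; apply: lerD.
    exact: dyadic_avg_last.
  rewrite /z /dyadic_avg; apply: le_trans (rnorm_sum _ _ _) _.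
  apply: (@le_trans _ _ (\sum_(i < 2 ^ n) (2 ^ n)%:R^-1)).
    apply: ler_sum => i _; rewrite rnormZ_inK /avg_weight subn0 /=.
    rewrite divn_small ?ltn_ord // eqxx mulr1 ger0_norm ?invr_ge0 //.
    by rewrite -[X in _ <= X]mulr1 ler_wpM2l ?invr_ge0.
  by rewrite sumr_const card_ord -[X in X <= _]mulr_natl mulfV // pnatr_eq0 expn_eq0.
have h4 : th ^+ 2 * (#|Omega n|%:R ^+ 2 * n%:R / 16) <= b ^+ 2 * (#|Omega n|%:R * (#|Omega n|%:R * 4)).
  apply: le_trans h1 (le_trans h2 _); apply: ler_wpM2l; first exact: sqr_ge0.
  by rewrite ler_pM2l.
have h5 : (th / 8 * Num.sqrt n%:R) ^+ 2 <= b ^+ 2.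
  have C2 : 0 < #|Omega n|%:R ^+ 2 * 4 :> R by rewrite mulr_gt0 // exprn_gt0.
  rewrite -(ler_pM2l C2); apply: le_trans (le_trans h4 _); last first.
    by rewrite le_eqVlt; apply/orP; left; apply/eqP; ring.
  by rewrite !exprMn sqr_sqrtr // le_eqVlt; apply/orP; left; apply/eqP; field.
rewrite -(ler_pXn2r (n := 2)) // nnegrE // mulr_ge0 ?sqrtr_ge0 // divr_ge0 //; exact: ltW.
Qed.

Theorem theorem4p4 (R : realType) (s : scalars)
    (X : completeNormedModType (K R s)) (hX : type2 X) :
  [<-> ~ superreflexive X;
       exists2 c : R, 0 < c &
         forall n : nat, (1 <= n)%N ->
           ((c^-1 * Num.sqrt n%:R)%:E <= RUMD X n <= (c * Num.sqrt n%:R)%:E)%E;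
       exists2 c' : R, 0 < c' &
         forall n : nat, (1 <= n)%N ->
           ((c'^-1 * Num.sqrt n%:R)%:E <= RUMD X n)%E].
Proof.
tfae.
- move=> /james_of_not_superreflexive[th th0 XJ]; have [c c0 hc] := hX.
  have th8 : 0 < 8 / th by rewrite divr_gt0.
  (* One constant for both sides: its inverse is at most [th / 8], and it is at least the [2 * c] of
     the type 2 estimate. *)
  exists (Num.max (8 / th) (2 * c)) => [|n n1]; first by rewrite lt_max th8.
  have n0 : 0 < Num.sqrt n%:R :> R by rewrite sqrtr_gt0 ltr0n.
  apply/andP; split.
    apply: le_ereal_inf_tmp => _ [b [b0 hb] <-]; rewrite lee_fin.
    apply: le_trans _ (james_RUMD th0 XJ (ltW b0) hb).
    rewrite ler_pM2r // -[X in _ <= X]invf_div lef_pV2 ?posrE ?lt_max ?th8 //.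
    by rewrite le_max lexx.
  apply: (@le_trans _ _ (2 * c * Num.sqrt n%:R)%:E).
    apply: ereal_inf_lbound; exists (2 * c * Num.sqrt n%:R) => //.
    by split; [rewrite !mulr_gt0|exact: type2_RUMD_bound].
  by rewrite lee_fin ler_pM2r // le_max lexx orbT.
- by move=> [c c0 hc]; exists c => // n /hc/andP[].
- exact: not_superreflexive_of_RUMD hX.
Qed.
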